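(* There is a one-to-one correspondence, up to congruence, between almost complex surfaces in the nearly Kähler $S^3\times S^3$ and solutions of the general $H$-system equation. Precisely, let $M$ be a simply connected Riemann surface. For every almost complex immersion $\phi\colon M\to S^3\times S^3$ an associated map $\epsilon\colon M\to\mathbb R^3$ exists, is unique up to an additive constant, has nowhere vanishing differential, and satisfies $$\epsilon_{uu}+\epsilon_{vv}=-\frac{4}{\sqrt3}\,\epsilon_u\times\epsilon_v$$ in every holomorphic coordinate $u+iv$ on $M$. Conversely, every map $\epsilon\colon M\to\mathbb R^3$ with nowhere vanishing differential satisfying this equation is associated to some almost complex immersion $\phi\colon M\to S^3\times S^3$. Moreover, two such solutions $\epsilon,\epsilon^*$ of the equation are congruent in $\mathbb R^3$ if and only if the associated almost complex immersions $\phi,\phi^*$ are congruent in $S^3\times S^3$.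
   Context: All maps are smooth. $S^3$ is the set of unit quaternions; tangent vectors at $(p,q)\in S^3\times S^3$ are written $Z=(U,V)$ with $U\in T_pS^3$, $V\in T_qS^3$. The nearly Kähler structure consists of $JZ=\frac{1}{\sqrt3}\bigl(2pq^{-1}V-U,\,-2qp^{-1}U+V\bigr)$ and $g(Z,Z')=\frac12\bigl(\langle Z,Z'\rangle+\langle JZ,JZ'\rangle\bigr)$, where $\langle\cdot,\cdot\rangle$ is the standard product metric. Imaginary quaternions are identified with $\mathbb R^3$, with vector product $\times$. An immersion $\phi=(p,q)\colon M\to S^3\times S^3$ of a Riemann surface $M$ is almost complex if $\phi_v=J\phi_u$ in every holomorphic coordinate $u+iv$ (such coordinates are then isothermal for the metric induced by $g$). Associated map: given such $\phi=(p,q)$ and a local holomorphic coordinate $u+iv$, define the $\mathbb R^3$-valued functions $\tilde\alpha=p^{-1}p_u$, $\tilde\beta=p^{-1}p_v$, and, with $\theta=2\pi/3$, $\alpha=\cos\theta\,\tilde\alpha+\sin\theta\,\tilde\beta$, $\beta=-\sin\theta\,\tilde\alpha+\cos\theta\,\tilde\beta$. A map $\epsilon\colon M\to\mathbb R^3$ is associated to $\phi$ (and $\phi$ is associated to $\epsilon$) if $\epsilon_u=\alpha$ and $\epsilon_v=\beta$ in every local holomorphic coordinate. Congruence: $\phi=(p,q)$ and $\phi^*$ are congruent in $S^3\times S^3$ if $\phi^*=(apc^{-1},bqc^{-1})$ for some constant unit quaternions $a,b,c$ (the maps $(p,q)\mapsto(apc^{-1},bqc^{-1})$ are isometries of $g$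 preserving $J$). $\epsilon$ and $\epsilon^*$ are congruent in $\mathbb R^3$ if $\epsilon^*=c\epsilon c^{-1}+d$ for some constant unit quaternion $c$ and imaginary quaternion $d$, i.e. they differ by an orientation-preserving Euclidean isometry. *)

(* Defs.v *)
From HB Require Import structures.
From mathcomp Require Import all_boot all_order all_algebra.
From mathcomp Require Import complex.
From mathcomp Require Import all_classical all_reals all_analysis.
Set Implicit Arguments. Unset Strict Implicit. Unset Printing Implicit Defensive.
Import Order.TTheory GRing.Theory Num.Theory.
Import numFieldNormedType.Exports.
Local Open Scope classical_set_scope.
Local Open Scope complex_scope.
Local Open Scope ring_scope.

Section SimplyConnected.
Context {R : realType}.

Definition path_connected (T : topologicalType) : Prop :=
  forall x y : T, exists gamma : R -> T,
    [/\ {within `[0, 1], continuous gamma}, gamma 0 = x & gamma 1 = y].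

Definition null_homotopic (T : topologicalType) (gamma : R -> T) : Prop :=
  exists H : R * R -> T,
    {within `[0, 1] `*` `[0, 1], continuous H} /\
    forall t, t \in `[0, 1] ->
      [/\ H (0, t) = gamma t, H (1, t) = gamma 0,
          H (t, 0) = gamma 0 & H (t, 1) = gamma 0].

Definition simply_connected (T : topologicalType) : Prop :=
  path_connected T /\
  forall gamma : R -> T, {within `[0, 1], continuous gamma} ->
    gamma 0 = gamma 1 -> null_homotopic gamma.

End SimplyConnected.

Section Calculus.
Context {R : realType} {V : normedModType R}.

Fixpoint Cn (n : nat) (D : set (R * R)) (f : R * R -> V) : Prop :=
  if n is m.+1 then
    [/\ forall z, D z -> derivable f z (1, 0) /\ derivable f z (0, 1),
        Cn m D ('D_(1, 0) f) & Cn m D ('D_(0, 1) f)]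
  else forall z, D z -> {for z, continuous f}.

Definition Cinfty (D : set (R * R)) (f : R * R -> V) : Prop :=
  forall n, Cn n D f.

End Calculus.

Section Holomorphic.
Context {R : realType}.

(* R[i]^o is R[i] as a normed module over itself, so that the derivative below
   is the limit of the complex difference quotients. *)
Definition to_C (z : R * R) : R[i]^o := z.1 +i* z.2.
Definition of_C (z : R[i]^o) : R * R := (complex.Re z, complex.Im z).

Definition holomorphic_at (f : R * R -> R * R) (z : R * R) : Prop :=
  derivable (to_C \o f \o of_C : R[i]^o -> R[i]^o) (to_C z) 1.

End Holomorphic.

Section Charts.
Context {R : realType}.

(* coord x = (u, v) stands for u + iv; coord and param are total functions that
   are only meaningful on cdom and on its image respectively. *)
Record chart (M : topologicalType) := Chart {
  cdom : set M;
  coord : M -> R * R;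
  param : R * R -> M;
  cdom_open : open cdom;
  cimg_open : open (coord @` cdom);
  coordK : forall x, cdom x -> param (coord x) = x;
  coord_continuous : forall x, cdom x -> {for x, continuous coord};
  param_continuous :
    forall z, (coord @` cdom) z -> {for z, continuous param} }.

Definition cimg (M : topologicalType) (c : chart M) : set (R * R) :=
  coord c @` cdom c.

Definition holomorphically_compatible (M : topologicalType) (c d : chart M) :
    Prop :=
  forall x, cdom c x -> cdom d x ->
    holomorphic_at (coord d \o param c) (coord c x) /\
    holomorphic_at (coord c \o param d) (coord d x).

End Charts.

(* Second countability is not required: it is automatic for Riemann surfaces
   (Rado). *)
Record riemannSurface (R : realType) := RiemannSurface {
  carrier :> topologicalType;
  atlas : set (@chart R carrier);
  carrier_hausdorff : hausdorff_space carrier;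
  carrier_connected : connected [set: carrier];
  atlas_cover : forall x, exists2 c, atlas c & cdom c x;
  atlas_compatible : forall c d, atlas c -> atlas d ->
    holomorphically_compatible c d }.

Section MapsOnSurfaces.
Context {R : realType} {M : riemannSurface R}.

(* The maximal atlas: all local holomorphic coordinates. *)
Definition holomorphic_coordinate (c : @chart R M) : Prop :=
  forall d, atlas d -> holomorphically_compatible c d.

Definition smooth (V : normedModType R) (F : M -> V) : Prop :=
  forall c, holomorphic_coordinate c -> Cinfty (cimg c) (F \o param c).

(* Meaningful at points of cdom c only. *)
Definition partial_u (V : normedModType R) (c : @chart R M) (F : M -> V) :
  M -> V := fun x => 'D_(1, 0) (F \o param c) (coord c x).
Definition partial_v (V : normedModType R) (c : @chart R M) (F : M -> V) :
  M -> V := fun x => 'D_(0, 1) (F \o param c) (coord c x).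

Definition nowhere_vanishing_differential (V : normedModType R) (F : M -> V) :
    Prop :=
  forall c, holomorphic_coordinate c -> forall x, cdom c x ->
    ~ (partial_u c F x = 0 /\ partial_v c F x = 0).

Definition immersion (V : normedModType R) (F : M -> V) : Prop :=
  smooth F /\
  forall c, holomorphic_coordinate c -> forall x, cdom c x ->
    forall a b : R, a *: partial_u c F x + b *: partial_v c F x = 0 ->
      a = 0 /\ b = 0.

End MapsOnSurfaces.

(* A quaternion is a pair (real part, imaginary part). *)
Notation quat R := (R * 'rV[R]_3)%type.

Section Quaternions.
Context {R : realType}.

Definition dot (x y : 'rV[R]_3) : R := \sum_i x 0 i * y 0 i.

(* Indices are added in 'I_3, i.e., modulo 3. *)
Definition cross (x y : 'rV[R]_3) : 'rV[R]_3 :=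
  \row_k (x 0 (k + 1) * y 0 (k + 2) - x 0 (k + 2) * y 0 (k + 1)).

Definition qmul (p q : quat R) : quat R :=
  (p.1 * q.1 - dot p.2 q.2, p.1 *: q.2 + q.1 *: p.2 + cross p.2 q.2).

Definition qnorm2 (p : quat R) : R := p.1 ^+ 2 + dot p.2 p.2.

Definition qinv (p : quat R) : quat R := (qnorm2 p)^-1 *: (p.1, - p.2).

Definition im (x : 'rV[R]_3) : quat R := (0, x).

Definition S3 : set (quat R) := [set p | qnorm2 p = 1].

End Quaternions.

Notation "p *q q" := (qmul p q) (at level 40, left associativity).

Section AlmostComplexSurfaces.
Context {R : realType}.

(* The almost complex structure at the point x = (p, q), acting on Z = (U, V). *)
Definition J (x Z : quat R * quat R) : quat R * quat R :=
  let: (p, q) := x in let: (U, V) := Z in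
  (Num.sqrt 3)^-1 *:
    (2 *: (p *q qinv q *q V) - U, - (2 *: (q *q qinv p *q U)) + V).

Context {M : riemannSurface R}.

(* Maps into S^3 x S^3 are maps into the ambient R^4 x R^4 with values in the
   submanifold S^3 x S^3. *)
Definition almost_complex_immersion (phi : M -> quat R * quat R) : Prop :=
  [/\ forall x, (S3 `*` S3) (phi x),
      immersion phi
    & forall c, holomorphic_coordinate c -> forall x, cdom c x ->
        partial_v c phi x = J (phi x) (partial_u c phi x)].

Definition associated (phi : M -> quat R * quat R) (eps : M -> 'rV[R]_3) :
    Prop :=
  forall c, holomorphic_coordinate c -> forall x, cdom c x ->
    let p y := (phi y).1 in
    let theta : R := 2 * pi / 3 in
    let talpha := qinv (p x) *q partial_u c p x in
    let tbeta := qinv (p x) *q partial_v c p x in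
    im (partial_u c eps x) = cos theta *: talpha + sin theta *: tbeta /\
    im (partial_v c eps x) = - sin theta *: talpha + cos theta *: tbeta.

Definition Hsystem (eps : M -> 'rV[R]_3) : Prop :=
  forall c, holomorphic_coordinate c -> forall x, cdom c x ->
    partial_u c (partial_u c eps) x + partial_v c (partial_v c eps) x =
    - (4 / Num.sqrt 3) *: cross (partial_u c eps x) (partial_v c eps x).

Definition congruent_S3S3 (phi phi' : M -> quat R * quat R) : Prop :=
  exists a b c, [/\ S3 a, S3 b, S3 c &
    forall x, phi' x =
      (a *q (phi x).1 *q qinv c, b *q (phi x).2 *q qinv c)].

Definition congruent_R3 (eps eps' : M -> 'rV[R]_3) : Prop :=
  exists c d, S3 c /\
    forall x, im (eps' x) = c *q im (eps x) *q qinv c + im d.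

End AlmostComplexSurfaces.

(* Main.v *)
Require Import Defs.
From HB Require Import structures.
From mathcomp Require Import all_boot all_order all_algebra.
From mathcomp Require Import complex.
From mathcomp Require Import all_classical all_reals all_analysis.
From mathcomp Require Import ring lra.
(* Imported last, so that [coord] is the coordinate map of a chart and not the
   coordinate of a vector in a basis. *)
Require Import Defs.
Set Implicit Arguments. Unset Strict Implicit. Unset Printing Implicit Defensive.
Import Order.TTheory GRing.Theory Num.Theory.
Import numFieldNormedType.Exports.
Local Open Scope classical_set_scope.
Local Open Scope ring_scope.

(** Let [A du + B dv] be the form [p^-1 dp] of the first factor of
    [phi = (p, q)].  Comparing the mixed derivatives of [p] gives the
    Maurer-Cartan equation [A_v - B_u = A B - B A] ([logd_maurer_cartan]), and
    the same holds for [q].  Holomorphic changes of coordinates act on [A + i B]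
    by complex multiplications, so a form may be multiplied by a complex
    constant.  In the left invariant frames, [phi_v = J phi_u] means that
    [q^-1 dq] is the product of [p^-1 dp] with [exp (- i pi / 3)]
    ([J_rotation]), whereas the definition of an associated map says that
    [d eps] is its product with [exp (- 2 i pi / 3)].

    Multiplication by [m + i n] turns the left side of the Maurer-Cartan
    equation into a combination of the curl [A_v - B_u] and the divergence
    [A_u + B_v], and its right side into a multiple of the same commutator
    ([maurer_cartan_product]).  The Maurer-Cartan equations of [p] and [q] are
    therefore two independent linear equations for the curl and the divergence,
    and they are equivalent to the following statement about [d eps]: it is
    closed, and its divergence is [- 4 / sqrt 3] times the vector product
    [eps_u x eps_v], which is half of the commutator.  This is the H-system
    ([rotation_closed], [closed_rotation]).

    Hence [eps] is obtained from [phi] by integrating a closed form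
    ([associated_exists]), and [phi] from [eps] by rotating [d eps] back in two
    ways and integrating the Maurer-Cartan equations of both results
    ([immersion_exists]).  A map with values in the unit quaternions is
    determined by its form up to a left translation, and a right translation
    conjugates the form; thus the conjugations of [d eps] correspond to the
    congruences of [phi] ([associated_congruence]).

    Both integrations are instances of one theorem.  For a bilinear map [b], the
    system [F_u = b F al], [F_v = b F be] has a solution with a prescribed value
    at a point of a simply connected surface as soon as the mixed derivatives
    are compatible ([parallel_exists]); [b] is the product of quaternions for
    [p] and [q], and [qprimitive] for [eps].  On a small square one solves
    linear differential equations along a horizontal line and then along all
    vertical lines ([flat_parallel_exists]).  These local solutions are
    continued along paths, and lifting the homotopies provided by simple
    connectedness shows that the result depends only on the end point
    ([global_solution]). *)

(** * Linear identities in modules *)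

(** Syntax of linear combinations, so that an identity between two of them is
    reduced to the equality of the coefficients of each atom. *)
Inductive lincomb (R : Type) :=
| LAtom of nat
| LZero
| LAdd of lincomb R & lincomb R
| LOpp of lincomb R
| LScale of R & lincomb R.
Arguments LAtom {R}. Arguments LZero {R}.

Section LinComb.
Variables (R : pzRingType) (V : lmodType R).

Fixpoint lin_eval (env : seq V) (e : lincomb R) : V :=
  match e with
  | LAtom n => nth 0 env n
  | LZero => 0
  | LAdd e1 e2 => lin_eval env e1 + lin_eval env e2
  | LOpp e1 => - lin_eval env e1
  | LScale k e1 => k *: lin_eval env e1
  end.

Fixpoint lin_coef (e : lincomb R) (i : nat) : R :=
  match e with
  | LAtom n => if n == i then 1 else 0
  | LZero => 0
  | LAdd e1 e2 => lin_coef e1 i + lin_coef e2 i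
  | LOpp e1 => - lin_coef e1 i
  | LScale k e1 => k * lin_coef e1 i
  end.

Fixpoint lin_bounded (n : nat) (e : lincomb R) : bool :=
  match e with
  | LAtom i => (i < n)%N
  | LZero => true
  | LAdd e1 e2 => lin_bounded n e1 && lin_bounded n e2
  | LOpp e1 => lin_bounded n e1
  | LScale _ e1 => lin_bounded n e1
  end.

Lemma lin_evalE env e : lin_bounded (size env) e ->
  lin_eval env e = \sum_(i < size env) lin_coef e i *: nth 0 env i.
Proof.
elim: e => [n|//|e1 IH1 e2 IH2|e IH|k e IH] /=.
- move=> lt_n; rewrite (bigD1 (Ordinal lt_n)) //= eqxx scale1r big1 ?addr0//.
  by move=> i; rewrite -val_eqE /= eq_sym => /negPf ->; rewrite scale0r.
- by rewrite big1 // => i _; rewrite scale0r.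
- by case/andP=> /IH1 -> /IH2 ->; rewrite -big_split; apply: eq_bigr => i _;
    rewrite scalerDl.
- by move/IH => ->; rewrite -sumrN; apply: eq_bigr => i _; rewrite scaleNr.
- by move/IH => ->; rewrite scaler_sumr; apply: eq_bigr => i _; rewrite scalerA.
Qed.

Fixpoint all_below (n : nat) (P : nat -> Prop) : Prop :=
  if n is m.+1 then P m /\ all_below m P else True.

Lemma lin_eval_eq env e1 e2 :
  lin_bounded (size env) e1 && lin_bounded (size env) e2 ->
  all_below (size env) (fun i => lin_coef e1 i = lin_coef e2 i) ->
  lin_eval env e1 = lin_eval env e2.
Proof.
case/andP=> b1 b2 eqc; rewrite !lin_evalE //; apply: eq_bigr => -[i /= lt_i] _.
congr (_ *: _).
elim: (size env) lt_i eqc => //= n IH; rewrite ltnS leq_eqVlt.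
by case/predU1P => [-> []//|/IH{}IH [_ /IH]].
Qed.

End LinComb.

Ltac lin_index a l :=
  lazymatch l with
  | a :: _ => constr:(O)
  | _ :: ?t => let n := lin_index a t in constr:(S n)
  end.

Ltac lin_atoms t l :=
  lazymatch t with
  | (?x + ?y)%R => let l1 := lin_atoms x l in lin_atoms y l1
  | (- ?x)%R => lin_atoms x l
  | (_ *: ?x)%R => lin_atoms x l
  | 0%R => l
  | ?a => match l with
          | _ => let i := lin_index a l in l
          | _ => constr:(a :: l)
          end
  end.

Ltac lin_reify R t l :=
  lazymatch t with
  | (?x + ?y)%R => let e1 := lin_reify R x l in let e2 := lin_reify R y l in
                   constr:(@LAdd R e1 e2)
  | (- ?x)%R => let e := lin_reify R x l in constr:(@LOpp R e)
  | (?k *: ?x)%R => let e := lin_reify R x l in constr:(@LScale R k e)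
  | 0%R => constr:(@LZero R)
  | ?a => let i := lin_index a l in constr:(@LAtom R i)
  end.

(** The coefficients of each atom are compared by [ring], or by [lra] when they
    agree only modulo relations of the context such as [s * s = 3 / 4]. *)
Ltac lin_module R V :=
  lazymatch goal with
  | |- ?x = ?y =>
    let l0 := lin_atoms x constr:(@nil V) in
    let l := lin_atoms y l0 in
    let e1 := lin_reify R x l in
    let e2 := lin_reify R y l in
    apply: (@lin_eval_eq _ _ l e1 e2);
    [ exact isT | cbn [size all_below lin_coef Equality.sort eqn]; rewrite /=;
      repeat (split; [first [ring | lra]|]); exact I ]
  end.

(** * Differential calculus in normed modules *)

Section IntervalInduction.
Context {R : realType}.

(** A property of subintervals that is additive and holds near every point holds
    on the whole interval, by the least upper bound principle.  This replaces
    subdivisions into small pieces: it gives the mean value inequality, and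
    later the lifting of maps of a square. *)
Lemma interval_glue (P : R -> R -> Prop) (a b : R) :
  (forall s t u, a <= s -> s <= t -> t <= u -> u <= b ->
     P s t -> P t u -> P s u) ->
  (forall t, a <= t -> t <= b -> exists2 e, 0 < e &
     forall s u, a <= s -> s <= t -> t <= u -> u <= b -> t - e < s -> u < t + e ->
       P s u) ->
  a <= b -> P a b.
Proof.
move=> Padd Ploc ab.
have Paa : P a a.
  have [e e0 He] := Ploc a (lexx a) ab.
  by apply: He => //; lra.
pose S := [set t | [/\ a <= t, t <= b & P a t]].
have Sa : S a by split.
have hS : has_sup S by split; [exists a | exists b => t []].
have Sc : forall t, S t -> t <= sup S by move=> t St; exact: ub_le_sup hS.2 _ St.
have cb : sup S <= b by apply: ge_sup => [|t []//]; exists a.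
have [e e0 He] := Ploc _ (Sc _ Sa) cb.
have [s [as_ sb Ps] cs] := sup_adherent e0 hS.
have sc : s <= sup S by apply: Sc.
pose c' := Num.min b (sup S + e / 2).
have cc' : sup S <= c' by rewrite /c' le_min cb /=; lra.
have c'b : c' <= b by rewrite /c' ge_min lexx.
have c'e : c' < sup S + e by rewrite /c' gt_min; apply/orP; right; lra.
have Pac' : P a c'.
  have sc' := le_trans sc cc'.
  apply: (Padd a s c') => //; apply: He => //.
have : c' <= sup S by apply: (Sc); split => //; exact: le_trans (Sc _ Sa) cc'.
rewrite /c' ge_min => /orP[bc|]; last by lra.
suff -> : b = c' by [].
by apply/eqP; rewrite eq_le c'b andbT; apply: le_trans cc'.
Qed.

End IntervalInduction.

Section Derivatives.
Context {R : realType}.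
Implicit Types U V W : normedModType R.

Lemma continuousP_norm U V (f : U -> V) z :
  {for z, continuous f} <->
  forall e : R, 0 < e -> exists2 d : R, 0 < d &
    forall w, `|w - z| < d -> `|f w - f z| <= e.
Proof.
split=> [cf e e0|H].
  have /cvgrPdist_le/(_ _ e0)/nbhs_normP[d /= d0 Hd] := cf.
  exists d => // w wz; rewrite distrC; apply: Hd.
  by rewrite /ball_ /= distrC.
apply/cvgrPdist_le => e /H[d d0 Hd].
apply/nbhs_normP; exists d => //= w; rewrite /ball_ /= distrC => wz.
by rewrite distrC; exact: Hd.
Qed.

Lemma is_deriveP U V (f : U -> V) z v df :
  is_derive z v f df <->
  forall e : R, 0 < e -> exists2 d : R, 0 < d &
    forall h : R, `|h| < d -> `|f (h *: v + z) - f z - h *: df| <= e * `|h|.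
Proof.
split=> [[/cvg_ex[l fl] dfE] e e0|H].
  have ldf : l = df by rewrite -dfE; apply/esym/(cvg_lim _ fl).
  rewrite {}ldf in fl.
  have /cvgrPdist_le/(_ _ e0) := fl.
  rewrite near_withinE => /nbhs_normP[d /= d0 Hd].
  exists d => // h hd.
  have [->|h0] := eqVneq h 0.
    by rewrite scale0r add0r subrr scale0r subrr !normr0 mulr0.
  have := Hd h; rewrite /ball_ /= sub0r normrN => /(_ hd h0) /= {}Hd.
  rewrite -ler_pdivrMr ?normr_gt0// mulrC -normfV -normrZ scalerBr scalerA mulVf//.
  by rewrite scale1r distrC.
have fl : (fun h => h^-1 *: ((f \o shift z) (h *: v) - f z)) @ 0^' --> df.
  apply/cvgrPdist_le => e /H[d d0 Hd].
  apply/nbhs_normP; exists d => //= h; rewrite /ball_ /= sub0r normrN => hd h0.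
  have := Hd _ hd; rewrite -ler_pdivrMr ?normr_gt0// mulrC -normfV -normrZ.
  by rewrite scalerBr scalerA mulVf// scale1r distrC.
split; first by apply/cvg_ex; exists df.
exact: cvg_lim fl.
Qed.

Lemma is_derive_sub U V (f g : U -> V) z v df dg :
  is_derive z v f df -> is_derive z v g dg ->
  is_derive z v (fun w => f w - g w) (df - dg).
Proof. by move=> fD gD; exact: (@is_deriveB _ _ _ f g). Qed.

Lemma is_derive_scale U V (f : U -> V) z v df (k : R) :
  is_derive z v f df -> is_derive z (k *: v) f (k *: df).
Proof.
have [->|k0] := eqVneq k 0; first by rewrite !scale0r => _; exact: is_derive0.
move=> /is_deriveP H; apply/is_deriveP => e e0.
have k0' : 0 < `|k| by rewrite normr_gt0.
have [d d0 Hd] := H (e / `|k|) (divr_gt0 e0 k0').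
exists (d / `|k|) => [|h]; first exact: divr_gt0.
rewrite ltr_pdivlMr// -normrM => /Hd.
by rewrite !scalerA normrM (mulrC `|h|) mulrA divfK// gt_eqF.
Qed.

Lemma is_derive_line U V (f : U -> V) z v df (t : R) :
  is_derive (t *: v + z) v f df -> is_derive t 1 (fun s => f (s *: v + z)) df.
Proof.
move=> /is_deriveP H; apply/is_deriveP => e /H[d d0 Hd].
by exists d => // h /Hd; rewrite scalerDl -[h%:A]/(h * 1) mulr1 addrA.
Qed.

Lemma is_derive_cont U V (f : U -> V) z v df (e : R) : 0 < e ->
  is_derive z v f df ->
  exists2 d, 0 < d & forall h : R, `|h| < d -> `|f (h *: v + z) - f z| <= e.
Proof.
move=> e0 /is_deriveP/(_ 1 ltr01)[d d0 Hd].
have n0 : 0 < 1 + `|df| by rewrite ltr_wpDr.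
exists (Num.min d (e / (1 + `|df|))) => [|h].
  by rewrite lt_min d0 divr_gt0.
rewrite lt_min => /andP[hd he].
rewrite -[X in `|X|](subrK (h *: df)); apply: le_trans (ler_normD _ _) _.
rewrite normrZ; have := Hd _ hd; rewrite mul1r => H1.
move: he; rewrite ltr_pdivlMr// mulrDr mulr1 => he.
lra.
Qed.

(** The estimate with a slightly larger constant is additive in the interval and
    holds near every point, by the definition of the derivative. *)
Lemma mean_value_le V (f df : R -> V) (M a b : R) : a <= b ->
  (forall t, a <= t -> t <= b -> is_derive t 1 f (df t)) ->
  (forall t, a <= t -> t <= b -> `|df t| <= M) ->
  `|f b - f a| <= M * (b - a).
Proof.
move=> ab fdf dfM; apply/ler_addgt0Pr => e e0.
have [->|nab] := eqVneq a b; first by rewrite !subrr normr0 mulr0 add0r ltW.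
have ba : 0 < b - a by rewrite subr_gt0 lt_neqAle nab.
pose k := e / (b - a); have k0 : 0 < k by rewrite divr_gt0.
have -> : M * (b - a) + e = (M + k) * (b - a) by rewrite mulrDl divfK// gt_eqF.
apply: (interval_glue (P := fun s t => `|f t - f s| <= (M + k) * (t - s))) => //.
  move=> s t u _ st tu _ H1 H2.
  have -> : f u - f s = (f u - f t) + (f t - f s) by rewrite addrA subrK.
  apply: le_trans (ler_normD _ _) _.
  by apply: le_trans (lerD H2 H1) _; rewrite -mulrDr addrA subrK.
move=> t at_ tb; have /is_deriveP/(_ k k0)[d d0 Hd] := fdf _ at_ tb.
have near_t w : `|w - t| < d -> `|f w - f t| <= (M + k) * `|w - t|.
  move=> /Hd; rewrite -[_ *: 1]/(_ * 1) mulr1 subrK => H.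
  rewrite -[X in `|X|](subrK ((w - t) *: df t)).
  apply: le_trans (ler_normD _ _) _; rewrite normrZ mulrDl addrC.
  by apply: lerD => //; rewrite mulrC ler_wpM2r// dfM.
exists d => // s u as_ st tu ub ts ut.
have -> : f u - f s = (f u - f t) - (f s - f t).
  by rewrite opprB addrA subrK.
apply: le_trans (ler_normB _ _) _.
have /near_t H1 : `|u - t| < d by rewrite ger0_norm; lra.
have /near_t H2 : `|s - t| < d by rewrite ler0_norm; lra.
apply: le_trans (lerD H1 H2) _.
rewrite ger0_norm ?subr_ge0// ler0_norm ?subr_le0// -mulrDr.
by rewrite (_ : u - t + - (s - t) = u - s)//; ring.
Qed.

Lemma mean_value_line U V (f : U -> V) (df : U -> V) z v (k M : R) :
  (forall s : R, `|s| <= `|k| -> is_derive (s *: v + z) v f (df (s *: v + z))) ->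
  (forall s : R, `|s| <= `|k| -> `|df (s *: v + z)| <= M) ->
  `|f (k *: v + z) - f z| <= M * `|k|.
Proof.
move=> fdf dfM.
have H (t : R) : 0 <= t -> t <= 1 ->
    is_derive t 1 (fun s => f (s *: (k *: v) + z)) (k *: df ((t * k) *: v + z)).
  move=> t0 t1; apply: is_derive_line.
  apply: is_derive_scale; rewrite scalerA; apply: fdf.
  by rewrite normrM (ger0_norm t0) ler_piMl.
have := mean_value_le (M := M * `|k|) ler01 H.
rewrite scale1r scale0r add0r subr0 mulr1; apply=> t t0 t1.
rewrite normrZ mulrC ler_wpM2r//; apply: dfM.
by rewrite normrM (ger0_norm t0) ler_piMl.
Qed.

Definition bounded_linear V W (L : V -> W) :=
  (forall (k : R) x y, L (k *: x + y) = k *: L x + L y) /\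
  exists K : R, forall x, `|L x| <= K * `|x|.

Lemma is_derive_linear U V W (L : V -> W) (f : U -> V) z v df :
  bounded_linear L -> is_derive z v f df ->
  is_derive z v (fun w => L (f w)) (L df).
Proof.
move=> [Ll [K0 LK0]].
have LB x y : L (x - y) = L x - L y.
  by rewrite -[x - y]addrC -(scaleN1r y) Ll scaleN1r addrC.
have L0 : L 0 = 0 by rewrite -(subrr 0) LB subrr.
have LZ k x : L (k *: x) = k *: L x by rewrite -[k *: x]addr0 Ll L0 addr0.
pose K := 1 + `|K0|.
have K_gt0 : 0 < K by rewrite ltr_wpDr.
have LK x : `|L x| <= K * `|x|.
  apply: le_trans (LK0 x) _; rewrite ler_wpM2r// /K.
  by apply: le_trans (ler_norm _) _; rewrite lerDr.
move=> /is_deriveP H; apply/is_deriveP => e e0.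
have [d d0 Hd] := H (e / K) (divr_gt0 e0 K_gt0).
exists d => // h /Hd H1; rewrite -LZ -!LB.
apply: le_trans (LK _) _; rewrite -ler_pdivlMl//.
by rewrite mulrA (mulrC K^-1).
Qed.

Lemma continuous_of_bounded_linear V W (L : V -> W) z :
  bounded_linear L -> {for z, continuous L}.
Proof.
move=> [Ll [K LK]]; apply/continuousP_norm => e e0.
have n0 : 0 < 1 + `|K| by rewrite ltr_wpDr.
exists (e / (1 + `|K|)) => [|w]; first exact: divr_gt0.
have -> : L w - L z = L (w - z).
  by rewrite -[w - z]addrC -(scaleN1r z) Ll scaleN1r addrC.
rewrite ltr_pdivlMr// => /ltW wz; apply: le_trans (LK _) _.
apply: le_trans wz; rewrite mulrC ler_wpM2l//.
by apply: le_trans (ler_norm _) _; rewrite lerDr.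
Qed.

Definition bounded_bilinear U V W (b : U -> V -> W) :=
  [/\ forall (k : R) x x' y, b (k *: x + x') y = k *: b x y + b x' y,
      forall (k : R) x y y', b x (k *: y + y') = k *: b x y + b x y'
    & exists2 K : R, 0 < K & forall x y, `|b x y| <= K * `|x| * `|y|].

Section Bilinear.
Variables (U V W : normedModType R) (b : U -> V -> W).
Hypothesis bb : bounded_bilinear b.

Lemma bilBl x x' y : b (x - x') y = b x y - b x' y.
Proof.
by case: bb => bl _ _; rewrite -[x - x']addrC -(scaleN1r x') bl scaleN1r addrC.
Qed.
Lemma bilBr x y y' : b x (y - y') = b x y - b x y'.
Proof.
by case: bb => _ br _; rewrite -[y - y']addrC -(scaleN1r y') br scaleN1r addrC.
Qed.
Lemma bil0l y : b 0 y = 0. Proof. by rewrite -(subrr 0) bilBl subrr. Qed.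
Lemma bil0r x : b x 0 = 0. Proof. by rewrite -(subrr 0) bilBr subrr. Qed.
Lemma bilZl k x y : b (k *: x) y = k *: b x y.
Proof. by case: bb => bl _ _; rewrite -[k *: x]addr0 bl bil0l addr0. Qed.
Lemma bilZr k x y : b x (k *: y) = k *: b x y.
Proof. by case: bb => _ br _; rewrite -[k *: y]addr0 br bil0r addr0. Qed.
Lemma bilDl x x' y : b (x + x') y = b x y + b x' y.
Proof. by case: bb => bl _ _; rewrite -[x in LHS]scale1r bl scale1r. Qed.
Lemma bilDr x y y' : b x (y + y') = b x y + b x y'.
Proof. by case: bb => _ br _; rewrite -[y in LHS]scale1r br scale1r. Qed.

Lemma is_derive_bilinear (T : normedModType R) (f : T -> U) (g : T -> V) z v df dg :
  is_derive z v f df -> is_derive z v g dg ->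
  is_derive z v (fun w => b (f w) (g w)) (b df (g z) + b (f z) dg).
Proof.
move=> fdf gdg; have [_ _ [K K0 bK]] := bb; apply/is_deriveP => e e0.
(* b (f w) (g w) - b (f z) (g z) splits into the error of f paired with g z,
   f z paired with the error of g, and the product of the two increments *)
pose N := K * (1 + `|g z| + `|f z| + `|df| + 1).
have N0 : 0 < N.
  by rewrite mulr_gt0//; have := normr_ge0 (g z); have := normr_ge0 (f z);
     have := normr_ge0 df; lra.
pose e1 := Num.min 1 (e / N).
have e10 : 0 < e1 by rewrite lt_min ltr01 divr_gt0.
have e11 : e1 <= 1 by rewrite ge_min lexx.
have e1N : e1 * N <= e by rewrite -ler_pdivlMr// ge_min lexx orbT.
have /is_deriveP/(_ _ e10)[d1 d10 H1] := fdf.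
have /is_deriveP/(_ _ e10)[d2 d20 H2] := gdg.
have [d3 d30 H3] := is_derive_cont e10 gdg.
exists (Num.min d1 (Num.min d2 d3)) => [|h]; first by rewrite !lt_min d10 d20.
rewrite !lt_min => /andP[/H1 {}H1 /andP[/H2 {}H2 /H3 {}H3]].
set w := h *: v + z in H1 H2 H3 *.
set F := f w - f z - h *: df in H1; set G := g w - g z - h *: dg in H2.
have -> : b (f w) (g w) - b (f z) (g z) - h *: (b df (g z) + b (f z) dg) =
    b F (g z) + b (f z) G + b F (g w - g z) + h *: b df (g w - g z).
  have fE : f w = F + f z + h *: df by rewrite /F; lin_module R U.
  have gE : g w = G + g z + h *: dg by rewrite /G; lin_module R V.
  have gzE : g w - g z = G + h *: dg by rewrite /G; lin_module R V.
  rewrite gzE fE gE !(bilDl, bilDr, bilZl, bilZr); lin_module R W.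
have n0 : 0 <= `|h| by [].
have T1 : `|b F (g z)| <= e1 * `|h| * (K * `|g z|).
  apply: le_trans (bK _ _) _; rewrite mulrAC mulrC.
  by rewrite ler_wpM2r// mulr_ge0// ltW.
have T2 : `|b (f z) G| <= e1 * `|h| * (K * `|f z|).
  apply: le_trans (bK _ _) _; rewrite mulrC.
  by rewrite ler_wpM2r// mulr_ge0// ltW.
have T3 : `|b F (g w - g z)| <= e1 * `|h| * K.
  apply: le_trans (bK _ _) _; rewrite -mulrA mulrC ler_pM2r//.
  apply: le_trans (_ : e1 * `|h| * 1 <= _); last by rewrite mulr1.
  by apply: ler_pM => //; apply: le_trans H3 _.
have T4 : `|h *: b df (g w - g z)| <= e1 * `|h| * (K * `|df|).
  rewrite normrZ (mulrC e1) -mulrA ler_wpM2l//.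
  apply: le_trans (bK _ _) _; rewrite mulrC ler_wpM2r//.
  by rewrite mulr_ge0// ltW.
apply: le_trans (ler_normD _ _) _.
apply: le_trans (lerD (ler_normD _ _) (lexx _)) _.
apply: le_trans (lerD (lerD (ler_normD _ _) (lexx _)) (lexx _)) _.
apply: le_trans (_ : e1 * N * `|h| <= _); last by rewrite ler_wpM2r.
have : 0 <= e1 * `|h| * K by rewrite !mulr_ge0// ltW.
rewrite /N; nra.
Qed.

End Bilinear.

Lemma bounded_bilinear_continuous (U V W : normedModType R) (b : U -> V -> W)
    (T : topologicalType) (f : T -> U) (g : T -> V) z :
  bounded_bilinear b -> {for z, continuous f} -> {for z, continuous g} ->
  {for z, continuous (fun w => b (f w) (g w))}.
Proof.
move=> bb cf cg; have [_ _ [K K0 bK]] := bb.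
apply/cvgrPdist_le => e e0.
pose N := K * (1 + `|g z| + `|f z|).
have N0 : 0 < N.
  by rewrite mulr_gt0//; have := normr_ge0 (g z); have := normr_ge0 (f z); lra.
pose e1 := Num.min 1 (e / N).
have e10 : 0 < e1 by rewrite lt_min ltr01 divr_gt0.
have e11 : e1 <= 1 by rewrite ge_min lexx.
have e1N : e1 * N <= e by rewrite -ler_pdivlMr// ge_min lexx orbT.
move/cvgrPdist_le : cf => /(_ _ e10) cf.
move/cvgrPdist_le : cg => /(_ _ e10) cg.
near=> w.
have H1 : `|f z - f w| <= e1 by near: w.
have H2 : `|g z - g w| <= e1 by near: w.
have -> : b (f z) (g z) - b (f w) (g w) =
   b (f z - f w) (g z) + b (f z) (g z - g w) - b (f z - f w) (g z - g w).
  rewrite !(bilBl bb) !(bilBr bb); lin_module R W.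
apply: le_trans (ler_normB _ _) _.
apply: le_trans (lerD (ler_normD _ _) (lexx _)) _.
have T1 : `|b (f z - f w) (g z)| <= e1 * (K * `|g z|).
  apply: le_trans (bK _ _) _; rewrite mulrAC mulrC.
  by rewrite ler_wpM2r// mulr_ge0// ltW.
have T2 : `|b (f z) (g z - g w)| <= e1 * (K * `|f z|).
  apply: le_trans (bK _ _) _; rewrite mulrC.
  by rewrite ler_wpM2r// mulr_ge0// ltW.
have T3 : `|b (f z - f w) (g z - g w)| <= e1 * K.
  apply: le_trans (bK _ _) _; rewrite -mulrA mulrC ler_pM2r//.
  apply: le_trans (_ : e1 * 1 <= _); last by rewrite mulr1.
  by apply: ler_pM => //; apply: le_trans H2 _.
apply: le_trans e1N; rewrite /N; lra.
Unshelve. all: by end_near. Qed.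

End Derivatives.

Section MoreDerivatives.
Context {R : realType}.
Implicit Types U V W : normedModType R.

Lemma is_derive_translate U V (f : U -> V) a z v df :
  is_derive (a + z) v f df -> is_derive z v (fun x => f (a + x)) df.
Proof.
move=> /is_deriveP H; apply/is_deriveP => e /H[d d0 Hd].
by exists d => // h /Hd; rewrite addrCA.
Qed.

Lemma mean_value_affine U V (f : U -> V) (df : R -> V) z v c (k M : R) :
  (forall s : R, `|s| <= `|k| -> is_derive (s *: v + z) v f (df s)) ->
  (forall s : R, `|s| <= `|k| -> `|df s - c| <= M) ->
  `|f (k *: v + z) - f z - k *: c| <= M * `|k|.
Proof.
move=> fdf dfM.
pose F (s : R) := f (s *: v + z) - s *: c.
have FD (s : R) : `|s| <= `|k| ->
    is_derive (s *: (1 : R) + 0) (1 : R) F (df s - c).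
  rewrite addr0 -[s *: 1]/(s * 1) mulr1 => sk.
  apply: is_derive_sub; first exact/is_derive_line/fdf.
  apply/is_deriveP => e e0; exists 1 => // h _.
  rewrite -[h *: 1]/(h * 1) mulr1 -scalerBl addrK subrr normr0.
  by rewrite mulr_ge0 // ltW.
have := @mean_value_line _ _ _ F (fun s => df s - c) 0 1 k M.
rewrite addr0 -[k *: 1]/(k * 1) mulr1 /F !scale0r add0r subr0.
have -> : f (k *: v + z) - k *: c - f z = f (k *: v + z) - f z - k *: c.
  by rewrite addrAC.
apply=> s sk; first by move: (FD s sk); rewrite !addr0 -[s *: 1]/(s * 1) !mulr1.
by rewrite addr0 -[s *: 1]/(s * 1) mulr1; apply: dfM.
Qed.

(** The second difference divided by [h * k] tends to the iterated derivative
    in either order; comparing the two limits gives the symmetry below. *)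
Lemma second_difference U V (f f1 f12 : U -> V) (v1 v2 z : U) (r : R) : 0 < r ->
  (forall w, `|w - z| < r -> is_derive w v1 f (f1 w)) ->
  (forall w, `|w - z| < r -> is_derive w v2 f1 (f12 w)) ->
  {for z, continuous f12} ->
  forall e : R, 0 < e -> exists2 d : R, 0 < d &
    forall h k : R, `|h| < d -> `|k| < d ->
      `|f (k *: v2 + (h *: v1 + z)) - f (h *: v1 + z) - (f (k *: v2 + z) - f z)
        - h *: (k *: f12 z)| <= e * `|k| * `|h|.
Proof.
move=> r0 fD f1D /continuousP_norm cf e e0; have [d0 d00 Hd] := cf e e0.
pose N := 1 + `|v1| + `|v2|.
have n1 : 0 <= `|v1| by []. have n2 : 0 <= `|v2| by [].
have N0 : 0 < N by rewrite /N; lra.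
pose d := Num.min r d0 / N.
have dd0 : 0 < d by rewrite divr_gt0// lt_min r0.
have near_z (s t : R) : `|s| < d -> `|t| < d ->
    `|t *: v2 + (s *: v1 + z) - z| < Num.min r d0.
  move=> sd td; rewrite addrA addrK; apply: le_lt_trans (ler_normD _ _) _.
  rewrite !normrZ -[Num.min r d0](divfK (lt0r_neq0 N0)) -/d.
  have := normr_ge0 s; have := normr_ge0 t; rewrite /N; nra.
have near_z0 (s : R) : `|s| < d -> `|s *: v1 + z - z| < Num.min r d0.
  by move=> sd; rewrite -[s *: v1 + z]add0r -[0](scale0r v2) near_z// normr0.
exists d => // h k hd kd.
pose F x := f (k *: v2 + x) - f x.
apply: (mean_value_affine (f := F)
  (df := fun s => f1 (k *: v2 + (s *: v1 + z)) - f1 (s *: v1 + z))) => s sh.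
  have sd := le_lt_trans sh hd.
  apply: is_derive_sub; last first.
    by apply: fD; have := near_z0 _ sd; rewrite lt_min => /andP[].
  apply: is_derive_translate; apply: fD.
  by have := near_z _ _ sd kd; rewrite lt_min => /andP[].
have sd := le_lt_trans sh hd.
apply: (mean_value_affine (df := fun t => f12 (t *: v2 + (s *: v1 + z)))) => t tk.
  apply: f1D.
  by have := near_z _ _ sd (le_lt_trans tk kd); rewrite lt_min => /andP[].
apply: Hd.
by have := near_z _ _ sd (le_lt_trans tk kd); rewrite lt_min => /andP[].
Qed.

Lemma mixed_derivatives U V (f f1 f2 f12 f21 : U -> V) (v1 v2 z : U) (r : R) :
  0 < r ->
  (forall w, `|w - z| < r -> is_derive w v1 f (f1 w)) ->
  (forall w, `|w - z| < r -> is_derive w v2 f (f2 w)) ->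
  (forall w, `|w - z| < r -> is_derive w v2 f1 (f12 w)) ->
  (forall w, `|w - z| < r -> is_derive w v1 f2 (f21 w)) ->
  {for z, continuous f12} -> {for z, continuous f21} ->
  f12 z = f21 z.
Proof.
move=> r0 D1 D2 D12 D21 c12 c21.
apply/eqP; rewrite -subr_eq0 -normr_le0; apply/ler_addgt0Pr => e e0.
have e20 : 0 < e / 2 by rewrite divr_gt0.
have [d d0 Hd] := second_difference r0 D1 D12 c12 e20.
have [d' d'0 Hd'] := second_difference r0 D2 D21 c21 e20.
pose h : R := Num.min d d' / 2.
have h0 : 0 < h by rewrite divr_gt0// lt_min d0.
have hm : `|h| < Num.min d d'.
  by rewrite gtr0_norm// /h ltr_pdivrMr// mulr_natr mulr2n ltrDl lt_min d0.
move: hm; rewrite lt_min => /andP[hd hd']; clearbody h.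
have H1 := Hd h h hd hd; have H2 := Hd' h h hd' hd'.
have swap : f (h *: v1 + (h *: v2 + z)) = f (h *: v2 + (h *: v1 + z)).
  by rewrite addrCA.
set A := _ - _ in H1; set B := _ - _ in H2.
have E : h *: (h *: (f12 z - f21 z)) = B - A.
  by rewrite /A /B swap; lin_module R V.
have : `|B - A| <= e * `|h| * `|h|.
  apply: le_trans (ler_normB _ _) _; apply: le_trans (lerD H2 H1) _; lra.
rewrite -E !normrZ add0r mulrA (mulrC _ `|f12 z - f21 z|) -(mulrA e).
by rewrite ler_pM2r// mulr_gt0// normr_gt0 gt_eqF.
Qed.

Notation e1 := ((1, 0) : R * R).
Notation e2 := ((0, 1) : R * R).

Lemma pair_basis (k z : R * R) : k + z = k.2 *: e2 + (k.1 *: e1 + z).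
Proof.
case: k z => [k1 k2] [z1 z2] /=; congr pair.
  by rewrite /= scaler0 add0r -[_ *: 1]/(_ * 1) mulr1.
by rewrite /= scaler0 add0r -[_ *: 1]/(_ * 1) mulr1.
Qed.

Lemma normr_fst U V (k : U * V) : `|k.1| <= `|k|.
Proof. by rewrite prod_normE le_max lexx. Qed.
Lemma normr_snd U V (k : U * V) : `|k.2| <= `|k|.
Proof. by rewrite prod_normE le_max lexx orbT. Qed.

Lemma normr_pair_le (a b M : R) : `|a| <= M -> `|b| <= M -> `|(a, b)| <= M.
Proof. by move=> aM bM; rewrite prod_normE ge_max aM bM. Qed.
Lemma normr_pair_lt (a b M : R) : `|a| < M -> `|b| < M -> `|(a, b)| < M.
Proof. by move=> aM bM; rewrite prod_normE gt_max aM bM. Qed.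

(** Continuous partial derivatives give a total derivative: the increment is
    taken first along the first axis and then along the second. *)
Lemma total_derivative V (f fu fv : R * R -> V) z (r : R) : 0 < r ->
  (forall w, `|w - z| < r -> is_derive w e1 f (fu w)) ->
  (forall w, `|w - z| < r -> is_derive w e2 f (fv w)) ->
  {for z, continuous fu} -> {for z, continuous fv} ->
  forall e : R, 0 < e -> exists2 d : R, 0 < d & forall k : R * R, `|k| < d ->
    `|f (k + z) - f z - (k.1 *: fu z + k.2 *: fv z)| <= e * `|k|.
Proof.
move=> r0 fD gD /continuousP_norm cu /continuousP_norm cv e e0.
have e20 : 0 < e / 2 by rewrite divr_gt0.
have [d1 d10 H1] := cu _ e20; have [d2 d20 H2] := cv _ e20.
pose d := Num.min r (Num.min d1 d2).
exists d => [|k kd]; first by rewrite !lt_min r0 d10.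
have k1 := normr_fst k; have k2 := normr_snd k.
have near_z (s t : R) : `|s| <= `|k.1| -> `|t| <= `|k.2| ->
    `|t *: e2 + (s *: e1 + z) - z| < d.
  move=> sk tk; rewrite addrA addrK; apply: le_lt_trans kd.
  have := pair_basis (s, t) 0; rewrite !addr0 => /= <-.
  by apply: normr_pair_le; [apply: le_trans k1 | apply: le_trans k2].
have near_z0 (s : R) : `|s| <= `|k.1| -> `|s *: e1 + z - z| < d.
  by move=> sd; rewrite -[s *: e1 + z]add0r -[0](scale0r e2) near_z// normr0.
rewrite pair_basis.
have A : `|f (k.1 *: e1 + z) - f z - k.1 *: fu z| <= e / 2 * `|k.1|.
  apply: (mean_value_affine (df := fun s => fu (s *: e1 + z))) => s /near_z0;
    rewrite !lt_min => /and3P[? ? ?]; first exact: fD.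
  exact: H1.
have B : `|f (k.2 *: e2 + (k.1 *: e1 + z)) - f (k.1 *: e1 + z) - k.2 *: fv z|
    <= e / 2 * `|k.2|.
  apply: (mean_value_affine (df := fun s => fv (s *: e2 + (k.1 *: e1 + z)))) =>
    s /(near_z _ _ (lexx _)); rewrite !lt_min => /and3P[? ? ?]; first exact: gD.
  exact: H2.
set X := _ - _ in A; set Y := _ - _ in B.
have -> : f (k.2 *: e2 + (k.1 *: e1 + z)) - f z - (k.1 *: fu z + k.2 *: fv z) =
   X + Y by rewrite /X /Y; lin_module R V.
apply: le_trans (ler_normD _ _) _; apply: le_trans (lerD A B) _.
by rewrite [leRHS](_ : _ = e / 2 * `|k| + e / 2 * `|k|); [
   apply: lerD; rewrite ler_pM2l | rewrite -mulrDl -splitr].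
Qed.

(** [total_derivative] controls [f] along the increments of [T], which need not
    be parallel to an axis. *)
Lemma chain_rule U V (T : U -> R * R) (f fu fv : R * R -> V) z v a (r : R) :
  0 < r ->
  is_derive z v T a ->
  (forall w, `|w - T z| < r -> is_derive w e1 f (fu w)) ->
  (forall w, `|w - T z| < r -> is_derive w e2 f (fv w)) ->
  {for T z, continuous fu} -> {for T z, continuous fv} ->
  is_derive z v (f \o T) (a.1 *: fu (T z) + a.2 *: fv (T z)).
Proof.
move=> r0 TD fD gD cu cv; apply/is_deriveP => e e0.
set p := fu (T z); set q := fv (T z).
pose N := 1 + `|a| + `|p| + `|q|.
have n1 : 0 <= `|a| by []. have n2 : 0 <= `|p| by [].
have n3 : 0 <= `|q| by [].
have N0 : 0 < N by rewrite /N; lra.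
pose e' := Num.min 1 (e / (2 * N)).
have e'0 : 0 < e' by rewrite lt_min ltr01 divr_gt0// mulr_gt0.
have e'1 : e' <= 1 by rewrite ge_min lexx.
have e'N : e' * (2 * N) <= e by rewrite -ler_pdivlMr ?mulr_gt0// ge_min lexx orbT.
have [d1 d10 H1] := total_derivative r0 fD gD cu cv e'0.
have /is_deriveP/(_ _ e'0)[d2 d20 H2] := TD.
have [d3 d30 H3] : exists2 d, 0 < d &
    forall h : R, `|h| < d -> `|T (h *: v + z) - T z| < d1.
  have [d d0 H] := is_derive_cont (divr_gt0 d10 (ltr0n _ 2)) TD.
  by exists d => // h /H; move/le_lt_trans; apply; rewrite ltr_pdivrMr//; lra.
exists (Num.min d2 d3) => [|h]; first by rewrite lt_min d20.
rewrite lt_min => /andP[/H2 {}H2 /H3 hd3].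
have := H1 _ hd3; rewrite -/p -/q subrK /comp.
set k := T _ - T z in H2 *; set X := f _ - f _ => H4.
have -> : X - h *: (a.1 *: p + a.2 *: q) =
   (X - (k.1 *: p + k.2 *: q)) + ((k - h *: a).1 *: p + (k - h *: a).2 *: q).
  by rewrite /= -[h *: a.1]/(h * a.1) -[h *: a.2]/(h * a.2); lin_module R V.
have kn : `|k| <= (1 + `|a|) * `|h|.
  rewrite -[k](subrK (h *: a)); apply: le_trans (ler_normD _ _) _.
  rewrite normrZ mulrDl (mulrC `|a|); apply: lerD => //.
  by apply: le_trans H2 _; rewrite ler_wpM2r.
apply: le_trans (ler_normD _ _) _.
have A : `|(k - h *: a).1 *: p + (k - h *: a).2 *: q| <= e' * `|h| * (`|p| + `|q|).
  apply: le_trans (ler_normD _ _) _; rewrite !normrZ mulrDr; apply: lerD.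
    by rewrite ler_wpM2r//; apply: le_trans (normr_fst _) _.
  by rewrite ler_wpM2r//; apply: le_trans (normr_snd _) _.
apply: le_trans (lerD H4 A) _.
apply: le_trans (_ : e' * (2 * N) * `|h| <= _); last by rewrite ler_wpM2r.
apply: le_trans (lerD (ler_wpM2l (ltW e'0) kn) (lexx _)) _.
have : 0 <= e' * `|h| by rewrite mulr_ge0// ltW.
rewrite /N; nra.
Qed.

Lemma is_derive_pair U V W (f : U -> V) (g : U -> W) z v df dg :
  is_derive z v f df -> is_derive z v g dg ->
  is_derive z v (fun w => (f w, g w)) (df, dg).
Proof.
move=> /is_deriveP H1 /is_deriveP H2; apply/is_deriveP => e e0.
have [d1 d10 {}H1] := H1 e e0; have [d2 d20 {}H2] := H2 e e0.
exists (Num.min d1 d2) => [|h]; first by rewrite lt_min d10.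
rewrite lt_min => /andP[/H1 {}H1 /H2 {}H2].
by rewrite prod_normE ge_max; apply/andP; split.
Qed.

End MoreDerivatives.

Section SmoothFunctions.
Context {R : realType}.
Implicit Types U V W : normedModType R.
Notation e1 := ((1, 0) : R * R).
Notation e2 := ((0, 1) : R * R).
Variables (D : set (R * R)) (oD : open D).

Lemma Cn_ext V n (f g : R * R -> V) :
  (forall z, D z -> f z = g z) -> Cn n D f -> Cn n D g.
Proof.
elim: n f g => [|n IH] f g fg.
  move=> cf z Dz; have cfz := cf z Dz.
  have nfg : \forall w \near z, f w = g w.
    by apply: (filterS (P := D)) => [w Dw|]; [exact: fg | exact: open_nbhs_nbhs].
  rewrite /prop_for /continuous_at -(fg _ Dz).
  by apply: cvg_trans cfz; apply: near_eq_cvg.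
have nfg z : D z -> \forall w \near z, f w = g w.
  by move=> Dz; apply: (filterS (P := D)) => [w Dw|];
    [exact: fg | exact: open_nbhs_nbhs].
case=> df c1 c2; split.
- by move=> z Dz; have [? ?] := df z Dz; split; apply: near_eq_derivable (nfg z Dz) _.
- by apply: IH c1 => z Dz; apply: near_eq_derive; exact: nfg.
- by apply: IH c2 => z Dz; apply: near_eq_derive; exact: nfg.
Qed.

Lemma CnS V n (f fu fv : R * R -> V) :
  (forall z, D z -> is_derive z e1 f (fu z)) ->
  (forall z, D z -> is_derive z e2 f (fv z)) ->
  Cn n D fu -> Cn n D fv -> Cn n.+1 D f.
Proof.
move=> fD gD cu cv; split.
- by move=> z Dz; split; [have [] := fD z Dz | have [] := gD z Dz].
- by apply: Cn_ext cu => z Dz; have [_ ->] := fD z Dz.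
- by apply: Cn_ext cv => z Dz; have [_ ->] := gD z Dz.
Qed.

Lemma Cinfty_ext V (f g : R * R -> V) :
  (forall z, D z -> f z = g z) -> Cinfty D f -> Cinfty D g.
Proof. by move=> fg cf n; exact: Cn_ext fg (cf n). Qed.

Lemma Cinfty_continuous V (f : R * R -> V) z :
  Cinfty D f -> D z -> {for z, continuous f}.
Proof. by move=> /(_ 0); exact. Qed.

Lemma Cinfty_du V (f : R * R -> V) z :
  Cinfty D f -> D z -> is_derive z e1 f ('D_e1 f z).
Proof. by move=> /(_ 1)[+ _ _] => H /H[H1 _]; exact/derivableP. Qed.

Lemma Cinfty_dv V (f : R * R -> V) z :
  Cinfty D f -> D z -> is_derive z e2 f ('D_e2 f z).
Proof. by move=> /(_ 1)[+ _ _] => H /H[_ H1]; exact/derivableP. Qed.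

Lemma Cinfty_Du V (f : R * R -> V) : Cinfty D f -> Cinfty D ('D_e1 f).
Proof. by move=> cf n; have [] := cf n.+1. Qed.

Lemma Cinfty_Dv V (f : R * R -> V) : Cinfty D f -> Cinfty D ('D_e2 f).
Proof. by move=> cf n; have [] := cf n.+1. Qed.

Lemma Cn_cst V n (c : V) : Cn n D (fun=> c).
Proof.
elim: n c => [|n IH] c; first by move=> z _; exact: cst_continuous.
by apply: (CnS (fu := fun=> 0) (fv := fun=> 0)) => // z _; exact: is_derive_cst.
Qed.

Lemma Cn_linear V W (L : V -> W) n (f : R * R -> V) :
  bounded_linear L -> Cn n D f -> Cn n D (fun z => L (f z)).
Proof.
move=> bL; elim: n f => [|n IH] f.
  move=> cf z Dz; apply: (@continuous_comp _ _ _ f L); first exact: cf.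
  exact: continuous_of_bounded_linear.
case=> df c1 c2.
apply: (CnS (fu := fun z => L ('D_e1 f z)) (fv := fun z => L ('D_e2 f z))) => //.
- move=> z Dz; apply: is_derive_linear => //; apply/derivableP.
  by have [] := df z Dz.
- move=> z Dz; apply: is_derive_linear => //; apply/derivableP.
  by have [] := df z Dz.
- exact: IH.
- exact: IH.
Qed.

Lemma Cn_pair V W n (f : R * R -> V) (g : R * R -> W) :
  Cn n D f -> Cn n D g -> Cn n D (fun z => (f z, g z)).
Proof.
elim: n f g => [|n IH] f g.
  by move=> cf cg z Dz; apply: cvg_pair; [exact: cf | exact: cg].
case=> df c1 c2 [dg d1 d2].
apply: (CnS (fu := fun z => ('D_e1 f z, 'D_e1 g z))
            (fv := fun z => ('D_e2 f z, 'D_e2 g z))).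
- move=> z Dz; apply: is_derive_pair; apply/derivableP.
    by have [] := df z Dz.
  by have [] := dg z Dz.
- move=> z Dz; apply: is_derive_pair; apply/derivableP.
    by have [] := df z Dz.
  by have [] := dg z Dz.
- exact: IH.
- exact: IH.
Qed.

Lemma bounded_linear_add V : bounded_linear (fun x : V * V => x.1 + x.2).
Proof.
split=> [k x y /=|]; first by rewrite scalerDr addrACA.
exists 2 => x; apply: le_trans (ler_normD _ _) _.
by rewrite mulr_natl mulr2n lerD ?normr_fst ?normr_snd.
Qed.

Lemma Cn_add V n (f g : R * R -> V) :
  Cn n D f -> Cn n D g -> Cn n D (fun z => f z + g z).
Proof.
by move=> cf cg; have := Cn_linear (bounded_linear_add V) (Cn_pair cf cg).
Qed.

(** The hypotheses for all [m <= n] are needed because the Leibniz formula for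
    the derivatives also contains [f] and [g] themselves. *)
Lemma Cn_bilinear U V W (b : U -> V -> W) n (f : R * R -> U) (g : R * R -> V) :
  bounded_bilinear b ->
  (forall m, (m <= n)%N -> Cn m D f) -> (forall m, (m <= n)%N -> Cn m D g) ->
  Cn n D (fun z => b (f z) (g z)).
Proof.
move=> bb; elim: n f g => [|n IH] f g cf cg.
  move=> z Dz; apply: bounded_bilinear_continuous => //.
    exact: (cf 0 isT).
  exact: (cg 0 isT).
have [df fu fv] := cf n.+1 (leqnn _); have [dg gu gv] := cg n.+1 (leqnn _).
have cf' m : (m <= n)%N -> Cn m D f by move/leqW; exact: cf.
have cg' m : (m <= n)%N -> Cn m D g by move/leqW; exact: cg.
have cfu m : (m <= n)%N -> Cn m D ('D_e1 f) by move=> mn; have [] := cf m.+1 mn.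
have cfv m : (m <= n)%N -> Cn m D ('D_e2 f) by move=> mn; have [] := cf m.+1 mn.
have cgu m : (m <= n)%N -> Cn m D ('D_e1 g) by move=> mn; have [] := cg m.+1 mn.
have cgv m : (m <= n)%N -> Cn m D ('D_e2 g) by move=> mn; have [] := cg m.+1 mn.
apply: (CnS (fu := fun z => b ('D_e1 f z) (g z) + b (f z) ('D_e1 g z))
            (fv := fun z => b ('D_e2 f z) (g z) + b (f z) ('D_e2 g z))).
- move=> z Dz; have [? _] := df z Dz; have [? _] := dg z Dz.
  by apply: is_derive_bilinear => //; exact/derivableP.
- move=> z Dz; have [_ ?] := df z Dz; have [_ ?] := dg z Dz.
  by apply: is_derive_bilinear => //; exact/derivableP.
- by apply: Cn_add; exact: IH.
- by apply: Cn_add; exact: IH.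
Qed.

Lemma Cinfty_mixed V (f : R * R -> V) z : Cinfty D f -> D z ->
  'D_e2 ('D_e1 f) z = 'D_e1 ('D_e2 f) z.
Proof.
move=> cf Dz.
have [r /= r0 Hr] : nbhs_ball_ (ball_ Num.Def.normr) z D.
  by apply/nbhs_normP; exact: open_nbhs_nbhs.
have inD w : `|w - z| < r -> D w.
  by move=> wz; apply: Hr; rewrite /ball_ /= distrC.
apply: (@mixed_derivatives _ _ _ f ('D_e1 f) ('D_e2 f)
  ('D_e2 ('D_e1 f)) ('D_e1 ('D_e2 f)) e1 e2 z r) => //.
- by move=> w /inD; exact: Cinfty_du.
- by move=> w /inD; exact: Cinfty_dv.
- by move=> w /inD; apply: Cinfty_dv; exact: Cinfty_Du.
- by move=> w /inD; apply: Cinfty_du; exact: Cinfty_Dv.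
- by apply: Cinfty_continuous => //; apply: Cinfty_Dv; exact: Cinfty_Du.
- by apply: Cinfty_continuous => //; apply: Cinfty_Du; exact: Cinfty_Dv.
Qed.

End SmoothFunctions.

(** * Linear differential equations on short intervals *)

Section LinearODE.
Context {R : realType} (V : normedModType R).

Lemma mean_value_R (f df : R -> V) (a b M : R) :
  (forall t, `|t - a| <= `|b - a| -> is_derive t 1 f (df t)) ->
  (forall t, `|t - a| <= `|b - a| -> `|df t| <= M) ->
  `|f b - f a| <= M * `|b - a|.
Proof.
move=> fD dfM; rewrite -[X in `|f X - _|](subrK a).
have sE (s : R) : s *: (1 : R) + a - a = s by rewrite addrK /GRing.scale /= mulr1.
have := @mean_value_line _ _ _ f df a 1 (b - a) M.
rewrite -[(b - a) *: 1]/((b - a) * 1) mulr1; apply=> s sb.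
  by apply: fD; rewrite sE.
by apply: dfM; rewrite sE.
Qed.

Lemma is_derive_continuous (f : R -> V) (t : R) (df : V) :
  is_derive t 1 f df -> {for t, continuous f}.
Proof.
move=> fD; apply/continuousP_norm => e e0.
have [d d0 Hd] := is_derive_cont e0 fD; exists d => // w wt.
by have := Hd _ wt; rewrite -[(w - t) *: 1]/(_ * 1) mulr1 subrK.
Qed.

(** At a point [c] where [|y|] is maximal, the mean value inequality bounds
    [|y c|] by [|y a| + l * eta] plus one half of [|y c|]. *)
Lemma short_gronwall (y dy : R -> V) (a l C eta : R) :
  0 <= l -> 0 <= C -> C * l <= 1 / 2 ->
  (forall t, `|t - a| <= l -> is_derive t 1 y (dy t)) ->
  (forall t, `|t - a| <= l -> `|dy t| <= C * `|y t| + eta) ->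
  forall t, `|t - a| <= l -> `|y t| <= 2 * (`|y a| + l * eta).
Proof.
move=> l0 C0 Cl yD dyM t tl.
have [c cal Hc] : exists2 c, c \in `[a - l, a + l] &
    forall t, t \in `[a - l, a + l] -> `|y t| <= `|y c|.
  apply: EVT_max; first by lra.
  apply: continuous_in_subspaceT => x; rewrite inE /= in_itv /= => /andP[x1 x2].
  have xl : `|x - a| <= l by rewrite ler_norml; apply/andP; split; lra.
  exact: continuous_comp (is_derive_continuous (yD _ xl)) (@norm_continuous _ _ _).
have inI (s : R) : `|s - a| <= l -> s \in `[a - l, a + l].
  by rewrite ler_norml in_itv /= => /andP[? ?]; apply/andP; split; lra.
have ca : `|c - a| <= l.
  by move: cal; rewrite in_itv /= ler_norml => /andP[? ?]; apply/andP; split; lra.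
have H : `|y c - y a| <= (C * `|y c| + eta) * `|c - a|.
  apply: (mean_value_R (df := dy)) => s sc.
    by apply: yD; exact: le_trans ca.
  have sl := le_trans sc ca; apply: le_trans (dyM _ sl) _.
  by rewrite lerD2r ler_wpM2l// Hc// inI.
apply: le_trans (Hc _ (inI _ tl)) _.
have H2 : `|y c| <= `|y c - y a| + `|y a|.
  by rewrite -{1}[y c](subrK (y a)); exact: ler_normD.
have [eta0|eta0] := leP 0 (C * `|y c| + eta); last first.
  have : (C * `|y c| + eta) * `|c - a| <= 0.
    by rewrite mulr_le0_ge0// ltW.
  have := normr_ge0 (y c - y a); have := normr_ge0 (y c).
  have : `|y c| * (C * l) <= `|y c| * (1 / 2) by rewrite ler_wpM2l.
  have := normr_ge0 (dy a).
  have /dyM : `|a - a| <= l by rewrite subrr normr0.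
  have : C * `|y a| <= C * `|y c|.
    by rewrite ler_wpM2l// Hc// inI// subrr normr0.
  lra.
have : (C * `|y c| + eta) * `|c - a| <= (C * `|y c| + eta) * l.
  by rewrite ler_wpM2l.
have : `|y c| * (C * l) <= `|y c| * (1 / 2) by rewrite ler_wpM2l.
lra.
Qed.

(** These two properties are the completeness of [V] needed by Picard iteration,
    in a form that passes to finite products componentwise. *)
Definition has_primitives := forall g : R -> V, continuous g ->
  exists G : R -> V, forall t : R, is_derive t 1 G (g t).

Definition geometrically_complete := forall (a : nat -> V) (K : R),
  (forall k, `|a k.+1 - a k| <= K / 2 ^+ k) ->
  exists l, forall k, `|l - a k| <= 2 * K / 2 ^+ k.

(** Reparametrizing by [clamp] extends a coefficient that is continuous on the
    interval of radius [r] to a continuous function on the line. *)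
Definition clamp (a r t : R) := Num.max (a - r) (Num.min (a + r) t).

Lemma clamp_dist a r t : 0 <= r -> `|clamp a r t - a| <= r.
Proof.
move=> r0; rewrite /clamp ler_norml lerBrDr lerBlDr le_max ge_max ge_min.
by rewrite (addrC (- r)) lexx /= (addrC r) lexx /=; lra.
Qed.

Lemma clamp_id a r t : `|t - a| <= r -> clamp a r t = t.
Proof.
rewrite ler_norml => /andP[t1 t2]; rewrite /clamp.
have -> : Num.min (a + r) t = t by apply/min_idPr; lra.
by apply/max_idPr; lra.
Qed.

Lemma clamp_lipschitz a r s t : `|clamp a r s - clamp a r t| <= `|s - t|.
Proof.
wlog st : s t / s <= t.
  move=> H; case: (leP s t) => [/H//|/ltW/H]; by rewrite distrC (distrC t).
rewrite (ler0_norm (_ : s - t <= 0)); last lra.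
have mono : clamp a r s <= clamp a r t.
  rewrite /clamp ge_max le_max lexx /= le_max; apply/orP; right.
  by rewrite le_min !ge_min lexx st orbT.
rewrite ler0_norm ?subr_le0// /clamp !opprB.
rewrite lerBlDr ge_max; apply/andP; split.
  apply: le_trans (_ : 0 + (a - r) <= _); first by rewrite add0r.
  by apply: lerD; [lra | rewrite le_max lexx].
apply: le_trans (_ : (t - s) + Num.min (a + r) s <= _); last first.
  by rewrite lerD2l le_max lexx orbT.
rewrite -lerBlDl le_min; apply/andP; split.
  by apply: le_trans (_ : a + r - (t - s) <= _); [rewrite lerD2r ge_min lexx | lra].
apply: le_trans (_ : t - (t - s) <= _); first by rewrite lerD2r ge_min lexx orbT.
by lra.
Qed.

(** Picard iteration: on an interval where the contraction factor is 1/2 the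
    iterates form a geometric Cauchy sequence. *)
Lemma linear_ode_short (B : R -> V -> V) (C a l : R) (xi : V) :
  has_primitives -> geometrically_complete ->
  0 <= l -> 0 <= C -> C * l <= 1 / 2 ->
  (forall t x y, B t (x - y) = B t x - B t y) ->
  (forall t y, `|B t y| <= C * `|y|) ->
  (forall y, continuous (B ^~ y)) ->
  exists y : R -> V, y a = xi /\
    forall t, `|t - a| <= l -> is_derive t 1 y (B t (y t)).
Proof.
move=> prim complV l0 C0 Cl BB BC Bc.
have Bcont (y : R -> V) : continuous y -> continuous (fun t => B t (y t)).
  move=> cy t; apply/continuousP_norm => e e0.
  have C1 : 0 < C + 1 by lra.
  have /continuousP_norm/(_ (e / 2 / (C + 1)))[|d1 d10 H1] := cy t.
    by rewrite !divr_gt0.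
  have /continuousP_norm/(_ (e / 2))[|d2 d20 H2] := Bc (y t) t.
    by rewrite divr_gt0.
  exists (Num.min d1 d2) => [|w]; first by rewrite lt_min d10.
  rewrite lt_min => /andP[/H1 {}H1 /H2 {}H2].
  have -> : B w (y w) - B t (y t) = B w (y w - y t) + (B w (y t) - B t (y t)).
    by rewrite BB addrA subrK.
  apply: le_trans (ler_normD _ _) _; rewrite [e]splitr lerD//.
  apply: le_trans (BC _ _) _.
  move: H1; rewrite ler_pdivlMr//; have := normr_ge0 (y w - y t); lra.
have /choice[P HP] : forall g : R -> V, exists G : R -> V, continuous g ->
    G a = xi /\ forall t : R, is_derive t 1 G (g t).
  move=> g; have [cg|ncg] := pselect (continuous g); last by exists g.
  have [G HG] := prim g cg; exists (fun t => G t - (G a - xi)) => _; split.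
    by rewrite opprB addrC subrK.
  move=> t; rewrite -[g t]subr0; apply: is_derive_sub; exact: is_derive_cst.
pose Y := fix Y k := if k is k'.+1 then P (fun t => B t (Y k' t)) else fun=> xi.
have Ycont k : continuous (Y k).
  elim: k => [|k IH] t; first exact: cst_continuous.
  have [_ /(_ t)] := HP _ (Bcont _ IH).
  exact: is_derive_continuous.
have Ya k : Y k a = xi.
  by case: k => [//|k]; have [] := HP _ (Bcont _ (Ycont k)).
have YD k (t : R) : is_derive t 1 (Y k.+1) (B t (Y k t)).
  by have [_ /(_ t)] := HP _ (Bcont _ (Ycont k)).
have Ydist k t : `|t - a| <= l -> `|Y k.+1 t - Y k t| <= `|xi| / 2 ^+ k.
  elim: k t => [|k IH] t tl.
    have -> : Y 1%N t - Y 0%N t = Y 1%N t - Y 1%N a by rewrite Ya.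
    rewrite divr1.
    have := @mean_value_R (Y 1%N) (fun t => B t xi) a t (C * `|xi|).
    move=> /(_ (fun t _ => YD _ t) (fun t _ => BC _ _)) H; apply: le_trans H _.
    have : C * `|xi| * `|t - a| <= C * `|xi| * l by rewrite ler_wpM2l// mulr_ge0.
    have : `|xi| * (C * l) <= `|xi| * (1 / 2) by rewrite ler_wpM2l.
    have := normr_ge0 xi; lra.
  have := @mean_value_R (fun t => Y k.+2 t - Y k.+1 t)
    (fun t => B t (Y k.+1 t) - B t (Y k t)) a t (C * (`|xi| / 2 ^+ k)).
  rewrite !Ya subrr subr0 => H.
  have {}H : `|Y k.+2 t - Y k.+1 t| <= C * (`|xi| / 2 ^+ k) * `|t - a|.
    apply: H => s sl.
    rewrite -BB; apply: le_trans (BC _ _) _; rewrite ler_wpM2l// IH//.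
    exact: le_trans tl.
  apply: le_trans H _.
  have p0 : 0 <= `|xi| / 2 ^+ k by rewrite divr_ge0// exprn_ge0.
  rewrite exprSr invfM (mulrA `|xi|).
  have : C * (`|xi| / 2 ^+ k) * `|t - a| <= C * (`|xi| / 2 ^+ k) * l.
    by rewrite ler_wpM2l// mulr_ge0.
  have : (`|xi| / 2 ^+ k) * (C * l) <= (`|xi| / 2 ^+ k) * (1 / 2).
    by rewrite ler_wpM2l.
  lra.
have /choice[y Hy] : forall t, exists w, forall k,
    `|w - Y k (clamp a l t)| <= 2 * `|xi| / 2 ^+ k.
  move=> t; apply: (complV (fun k => Y k (clamp a l t))) => k.
  by apply: Ydist; exact: clamp_dist.
have small (e : R) : 0 < e -> exists k, 2 * `|xi| / 2 ^+ k <= e.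
  move=> e0; have [->|xi0] := eqVneq xi 0.
    by exists 0%N; rewrite normr0 mulr0 mul0r ltW.
  have : (fun k => 2 * `|xi| / 2 ^+ k) @ \oo --> (2 * `|xi| * 0 : R).
    apply: cvgMr => /=.
    have -> : (fun k => (2 ^+ k)^-1 : R) = (fun k => 2^-1 ^+ k).
      by apply/funext => k; rewrite exprVn.
    apply: cvg_expr; rewrite ger0_norm ?invr_ge0//; lra.
  rewrite mulr0 => /cvgrPdist_le/(_ _ e0)[k _ /(_ k (leqnn k))] /=.
  rewrite sub0r normrN ger0_norm; last by rewrite divr_ge0// exprn_ge0.
  by exists k.
have ycont : continuous y.
  move=> t; apply/continuousP_norm => e e0.
  have e3 : 0 < e / 3 by rewrite divr_gt0.
  have [k Hk] := small _ e3.
  have /continuousP_norm/(_ _ e3)[d d0 Hd] := Ycont k (clamp a l t).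
  exists d => // w wt.
  have := Hd (clamp a l w) (le_lt_trans (clamp_lipschitz _ _ _ _) wt).
  set Yw := Y k _; set Yt := Y k _ => H3.
  have -> : y w - y t = (y w - Yw) + (Yw - Yt) - (y t - Yt) by lin_module R V.
  apply: le_trans (ler_normB _ _) _.
  have H1 : `|y w - Yw| <= e / 3.
    exact: le_trans (Hy w k) Hk.
  have H2 : `|y t - Yt| <= e / 3.
    exact: le_trans (Hy t k) Hk.
  have := ler_normD (y w - Yw) (Yw - Yt); lra.
have [Za ZD] := HP _ (Bcont _ ycont).
set Z := P _ in Za ZD.
suff ZE t : `|t - a| <= l -> Z t = y t.
  by exists Z; split => // t /ZE ->.
move=> tl; apply/eqP; rewrite -subr_eq0 -normr_le0; apply/ler_addgt0Pr => e e0.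
rewrite add0r; have [k Hk] := small _ e0.
have H1 := Hy t k.+1; rewrite clamp_id// in H1.
have H2 : `|Z t - Y k.+1 t| <= C * (2 * `|xi| / 2 ^+ k) * `|t - a|.
  have := @mean_value_R (fun t => Z t - Y k.+1 t)
    (fun t => B t (y t) - B t (Y k t)) a t (C * (2 * `|xi| / 2 ^+ k)).
  rewrite Za Ya subrr subr0; apply=> s sl.
  rewrite -BB; apply: le_trans (BC _ _) _; rewrite ler_wpM2l//.
  by have := Hy s k; rewrite clamp_id//; exact: le_trans tl.
have -> : Z t - y t = (Z t - Y k.+1 t) - (y t - Y k.+1 t) by lin_module R V.
apply: le_trans (ler_normB _ _) _; apply: le_trans (lerD H2 H1) _.
have p0 : 0 <= 2 * `|xi| / 2 ^+ k by rewrite divr_ge0// ?mulr_ge0// exprn_ge0.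
rewrite exprSr invfM (mulrA (2 * `|xi|)).
have : C * (2 * `|xi| / 2 ^+ k) * `|t - a| <= C * (2 * `|xi| / 2 ^+ k) * l.
  by rewrite ler_wpM2l// mulr_ge0.
have : (2 * `|xi| / 2 ^+ k) * (C * l) <= (2 * `|xi| / 2 ^+ k) * (1 / 2).
  by rewrite ler_wpM2l.
lra.
Qed.

End LinearODE.

(** * Parallel maps of a flat connection on a square *)

Section Connection.
Context {R : realType} (V W : normedModType R) (b : V -> W -> V).
Hypothesis bb : bounded_bilinear b.
Notation e1 := ((1, 0) : R * R).
Notation e2 := ((0, 1) : R * R).

Lemma is_derive_axis2 (F : R * R -> V) (z : R * R) df :
  is_derive z.2 1 (fun t => F (z.1, t)) df -> is_derive z e2 F df.
Proof.
move=> /is_deriveP H; apply/is_deriveP => e /H[d d0 Hd].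
exists d => // h /Hd; rewrite -[h *: 1]/(h * 1) mulr1.
have -> : h *: e2 + z = (z.1, h + z.2).
  by case: z {H Hd} => x y; congr pair; rewrite /= ?scaler0 ?add0r// /GRing.scale /= mulr1.
by case: z {H Hd}.
Qed.

Lemma derive_axis1 (U : normedModType R) (F : R * R -> U) (x y : R) df :
  is_derive (x, y) e1 F df -> is_derive x 1 (fun t => F (t, y)) df.
Proof.
move=> /is_deriveP H; apply/is_deriveP => e /H[d d0 Hd].
exists d => // h /Hd; rewrite -[h *: 1]/(h * 1) mulr1.
have -> // : h *: e1 + (x, y) = (h + x, y).
by congr pair; rewrite /= ?scaler0 ?add0r// /GRing.scale /= mulr1.
Qed.

Lemma derive_axis2 (U : normedModType R) (F : R * R -> U) (x y : R) df :
  is_derive (x, y) e2 F df -> is_derive y 1 (fun t => F (x, t)) df.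
Proof.
move=> /is_deriveP H; apply/is_deriveP => e /H[d d0 Hd].
exists d => // h /Hd; rewrite -[h *: 1]/(h * 1) mulr1.
have -> // : h *: e2 + (x, y) = (x, h + y).
by congr pair; rewrite /= ?scaler0 ?add0r// /GRing.scale /= mulr1.
Qed.

(** The equation [dF = b (F, al du + be dv)] of the parallel sections of a
    connection with values in [V]. *)
Definition parallel_at (al be : R * R -> W) (F : R * R -> V) (z : R * R) :=
  is_derive z e1 F (b (F z) (al z)) /\ is_derive z e2 F (b (F z) (be z)).

Lemma continuous_near_bounded (U : normedModType R) (f : R * R -> U) z :
  {for z, continuous f} -> exists r N : R, [/\ 0 < r, 0 < N &
    forall w, `|w - z| < r -> `|f w| <= N].
Proof.
move=> /continuousP_norm/(_ 1 ltr01)[d d0 Hd].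
exists d, (1 + `|f z|); split=> [//||w /Hd H]; first by rewrite ltr_wpDr.
by rewrite -[f w](subrK (f z)); apply: le_trans (ler_normD _ _) _; rewrite lerD2r.
Qed.

(** The short Gronwall estimate is applied along a horizontal and then along a
    vertical segment, each contributing a factor 2. *)
Lemma parallel_bound (al be : R * R -> W) (F : R * R -> V) (z0 : R * R) (r C : R) :
  0 <= C -> C * (2 * r) <= 1 / 2 ->
  (forall z, `|z - z0| < r -> parallel_at al be F z) ->
  (forall z y, `|z - z0| < r -> `|b y (al z)| <= C * `|y|) ->
  (forall z y, `|z - z0| < r -> `|b y (be z)| <= C * `|y|) ->
  forall z1 z, `|z1 - z0| + `|z - z1| < r -> `|F z| <= 4 * `|F z1|.
Proof.
move=> C0 Cr FP alC beC z1 z zr.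
case: z0 z1 z FP alC beC zr => [x0 y0] [x1 y1] [x y] FP alC beC zr.
have n1 := normr_fst ((x1, y1) - (x0, y0)); have n2 := normr_snd ((x1, y1) - (x0, y0)).
have n3 := normr_fst ((x, y) - (x1, y1)); have n4 := normr_snd ((x, y) - (x1, y1)).
move: n1 n2 n3 n4 zr => /=.
set D := `|(x1, y1) - _|; set E := `|(x, y) - _| => n1 n2 n3 n4 zr.
have r0 : 0 <= r.
  have := normr_ge0 ((x1, y1) - (x0, y0)); have := normr_ge0 ((x, y) - (x1, y1)).
  by rewrite -/D -/E; lra.
have near (s t : R) : `|s - x1| <= `|x - x1| -> `|t - y1| <= `|y - y1| ->
    `|(s, t) - (x0, y0)| < r.
  move=> sx ty; apply: normr_pair_lt => /=.
    by have := ler_distD x1 s x0; lra.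
  by have := ler_distD y1 t y0; lra.
have Cl (l : R) : 0 <= l -> l <= E -> C * l <= 1 / 2.
  move=> l0 lE; apply: le_trans Cr; rewrite ler_wpM2l//.
  have := normr_ge0 ((x1, y1) - (x0, y0)); rewrite -/D; lra.
have H1 : `|F (x, y1)| <= 2 * (`|F (x1, y1)| + `|x - x1| * 0).
  apply: (@short_gronwall _ _ (fun t => F (t, y1)) (fun t => b (F (t, y1)) (al (t, y1)))
    x1 `|x - x1| C) => //; first exact: Cl.
    move=> t tx; have /FP[H _] : `|(t, y1) - (x0, y0)| < r.
      by apply: near; rewrite // subrr normr0.
    exact: derive_axis1.
  by move=> t tx; rewrite addr0; apply: alC; apply: near; rewrite // subrr normr0.
have H2 : `|F (x, y)| <= 2 * (`|F (x, y1)| + `|y - y1| * 0).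
  apply: (@short_gronwall _ _ (fun t => F (x, t)) (fun t => b (F (x, t)) (be (x, t)))
    y1 `|y - y1| C) => //; first exact: Cl.
    move=> t tx; have /FP[_ H] : `|(x, t) - (x0, y0)| < r by exact: near.
    exact: derive_axis2.
  by move=> t tx; rewrite addr0; apply: beC; apply: near.
lra.
Qed.

Lemma form_bound (al be : R * R -> W) (z0 : R * R) :
  {for z0, continuous al} -> {for z0, continuous be} ->
  exists r C : R, [/\ 0 < r, 0 <= C, C * (2 * r) <= 1 / 2,
   (forall z y, `|z - z0| < r -> `|b y (al z)| <= C * `|y|) &
   (forall z y, `|z - z0| < r -> `|b y (be z)| <= C * `|y|)].
Proof.
move=> /continuous_near_bounded[r1 [N1 [r10 N10 H1]]].
move=> /continuous_near_bounded[r2 [N2 [r20 N20 H2]]].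
have [_ _ [K K0 bK]] := bb.
pose C := K * (N1 + N2); have C0 : 0 < C by rewrite mulr_gt0// addr_gt0.
exists (Num.min (Num.min r1 r2) (4 * C)^-1), C; split.
- by rewrite !lt_min r10 r20 invr_gt0 mulr_gt0.
- exact: ltW.
- apply: le_trans (_ : C * (2 * (4 * C)^-1) <= _).
    by rewrite ler_wpM2l ?(ltW C0)// ler_wpM2l// ge_min lexx orbT.
  have C4 : (4 * C)^-1 = C^-1 / 4 by rewrite invfM mulrC.
  have CC : C * C^-1 = 1 by rewrite mulfV// gt_eqF.
  rewrite C4; have -> : C * (2 * (C^-1 / 4)) = (C * C^-1) / 2 by field; rewrite gt_eqF.
  by rewrite CC.
- move=> z y; rewrite !lt_min => /andP[/andP[/H1 zr _] _].
  apply: le_trans (bK _ _) _; rewrite mulrAC ler_wpM2r// /C ler_pM2l//; lra.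
- move=> z y; rewrite !lt_min => /andP[/andP[_ /H2 zr] _].
  apply: le_trans (bK _ _) _; rewrite mulrAC ler_wpM2r// /C ler_pM2l//; lra.
Qed.

Lemma parallel_sub al be F G z : parallel_at al be F z -> parallel_at al be G z ->
  parallel_at al be (fun w => F w - G w) z.
Proof.
by move=> [F1 F2] [G1 G2]; split; rewrite bilBl//; exact: is_derive_sub.
Qed.

(** The difference of two parallel maps is parallel, so [parallel_bound] in both
    directions between [z] and [z0] shows that it vanishes at both or at
    neither.  The factor 2 leaves room for the path between the two points. *)
Lemma parallel_unique (al be : R * R -> W) (z0 : R * R) :
  {for z0, continuous al} -> {for z0, continuous be} ->
  exists2 r0 : R, 0 < r0 & forall (F G : R * R -> V) (r : R), r <= r0 ->
    (forall z, `|z - z0| < r -> parallel_at al be F z) ->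
    (forall z, `|z - z0| < r -> parallel_at al be G z) ->
    forall z, 2 * `|z - z0| < r -> (F z = G z <-> F z0 = G z0).
Proof.
move=> cal cbe; have [r0 [C [r00 C0 Cr alC beC]]] := form_bound cal cbe.
exists r0 => // F G r rr0 FP GP z zr.
have dr w : `|w - z0| < r -> `|w - z0| < r0 by move/lt_le_trans; apply.
have FG w : `|w - z0| < r -> parallel_at al be (fun w => F w - G w) w.
  by move=> wr; apply: parallel_sub; [exact: FP | exact: GP].
have Cr' : C * (2 * r) <= 1 / 2.
  by apply: le_trans Cr; rewrite ler_wpM2l// ler_pM2l.
have B := parallel_bound C0 Cr' FG (fun w y h => alC w y (dr w h))
  (fun w y h => beC w y (dr w h)).
have n0 := normr_ge0 (z - z0).
split=> E; apply/eqP; rewrite -subr_eq0 -normr_le0.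
  have /B : `|z - z0| + `|z0 - z| < r by rewrite (distrC z0); lra.
  by rewrite E subrr normr0 mulr0.
have /B : `|z0 - z0| + `|z - z0| < r by rewrite subrr normr0 add0r; lra.
by rewrite E subrr normr0 mulr0.
Qed.

Lemma parallel_continuous (al be : R * R -> W) (F : R * R -> V) (z0 : R * R) (r1 : R) : 0 < r1 ->
  {for z0, continuous al} -> {for z0, continuous be} ->
  (forall z, `|z - z0| < r1 -> parallel_at al be F z) ->
  {for z0, continuous F}.
Proof.
move=> r10 cal cbe FP; have [r0 [C [r00 C0 Cr alC beC]]] := form_bound cal cbe.
pose r := Num.min r0 r1.
have r_gt0 : 0 < r by rewrite lt_min r00.
have rr0 : r <= r0 by rewrite ge_min lexx.
have dr w : `|w - z0| < r -> `|w - z0| < r0 by move/lt_le_trans; apply.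
have dr1 w : `|w - z0| < r -> `|w - z0| < r1.
  by move/lt_le_trans; apply; rewrite ge_min lexx orbT.
have Cr' : C * (2 * r) <= 1 / 2.
  by apply: le_trans Cr; rewrite ler_wpM2l// ler_pM2l.
have B := parallel_bound C0 Cr' (fun w h => FP w (dr1 w h))
  (fun w y h => alC w y (dr w h)) (fun w y h => beC w y (dr w h)).
have {}B w : `|w - z0| < r -> `|F w| <= 4 * `|F z0|.
  by move=> wr; apply: B; rewrite subrr normr0 add0r.
pose M := C * (4 * `|F z0|).
have M0 : 0 <= M by rewrite /M !mulr_ge0.
apply/continuousP_norm => e e0.
exists (Num.min r (e / (2 * (M + 1)))) => [|w].
  by rewrite lt_min r_gt0 divr_gt0// mulr_gt0//; lra.
rewrite lt_min => /andP[wr we].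
have k1 := normr_fst (w - z0); have k2 := normr_snd (w - z0).
have nr (s t : R) : `|s| <= `|(w - z0).1| -> `|t| <= `|(w - z0).2| ->
    `|t *: e2 + (s *: e1 + z0) - z0| < r.
  move=> sk tk; rewrite addrA addrK; apply: le_lt_trans wr.
  have := pair_basis (s, t) 0; rewrite !addr0 => /= <-.
  by apply: normr_pair_le; [apply: le_trans k1 | apply: le_trans k2].
have nr1 (s : R) : `|s| <= `|(w - z0).1| -> `|s *: e1 + z0 - z0| < r.
  by move=> sd; rewrite -[s *: e1 + z0]add0r -[0](scale0r e2) nr// normr0.
rewrite -[w](subrK z0) pair_basis; set k := w - z0.
have H1 : `|F (k.1 *: e1 + z0) - F z0| <= M * `|k.1|.
  apply: (mean_value_line (df := fun w => b (F w) (al w))) => s /nr1 sr.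
    by have [] := FP _ (dr1 _ sr).
  by apply: le_trans (alC _ _ (dr _ sr)) _; rewrite ler_wpM2l// B.
have H2 : `|F (k.2 *: e2 + (k.1 *: e1 + z0)) - F (k.1 *: e1 + z0)| <= M * `|k.2|.
  apply: (mean_value_line (df := fun w => b (F w) (be w))) => s /(nr _ _ (lexx _)) sr.
    by have [] := FP _ (dr1 _ sr).
  by apply: le_trans (beC _ _ (dr _ sr)) _; rewrite ler_wpM2l// B.
set X := F (k.2 *: _ + _) in H2 *; set Y := F (k.1 *: _ + _) in H1 H2.
have -> : X - F z0 = (X - Y) + (Y - F z0) by lin_module R V.
apply: le_trans (ler_normD _ _) _; apply: le_trans (lerD H2 H1) _.
apply: le_trans (_ : M * `|k| + M * `|k| <= _).
  by apply: lerD; rewrite ler_wpM2l.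
move: we; rewrite ltr_pdivlMr -/k; last by rewrite mulr_gt0//; lra.
have := normr_ge0 k; lra.
Qed.

End Connection.

Section TaylorBounds.
Context {R : realType} (W : normedModType R).
Notation e1 := ((1, 0) : R * R).
Notation e2 := ((0, 1) : R * R).

Lemma increment_bounds (D : set (R * R)) (f : R * R -> W) (u t h N : R) : 0 <= N ->
  Cinfty D f ->
  (forall s : R, `|s| <= `|h| -> [/\ D (s + u, t), `|'D_e1 f (s + u, t)| <= N &
     `|'D_e1 ('D_e1 f) (s + u, t)| <= N]) ->
  `|f (h + u, t) - f (u, t)| <= N * `|h| /\
  `|f (h + u, t) - f (u, t) - h *: 'D_e1 f (u, t)| <= N * `|h| * `|h|.
Proof.
move=> N0 cf H; have cfu := Cinfty_Du cf.
have lineE (s : R) : s *: e1 + (u, t) = (s + u, t).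
  by congr pair; rewrite /= ?scaler0 ?add0r// /GRing.scale /= mulr1.
have fu (s : R) : `|s| <= `|h| ->
    `|'D_e1 f (s + u, t) - 'D_e1 f (u, t)| <= N * `|s|.
  move=> sh; rewrite -lineE.
  apply: (mean_value_line (f := 'D_e1 f) (df := 'D_e1 ('D_e1 f))) => s' s's;
    rewrite lineE; have [Ds _ Ns] := H s' (le_trans s's sh) => //.
  exact: Cinfty_du cfu Ds.
split; rewrite -lineE.
  apply: (mean_value_line (f := f) (df := 'D_e1 f)) => s' s's; rewrite lineE;
    have [Ds Ns _] := H s' s's => //.
  exact: Cinfty_du cf Ds.
apply: (mean_value_affine (f := f) (df := fun s => 'D_e1 f (s *: e1 + (u, t))))
  => s' s's; rewrite lineE.
  by have [Ds _ _] := H s' s's; exact: Cinfty_du cf Ds.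
by apply: le_trans (fu _ s's) _; rewrite ler_wpM2l.
Qed.

Lemma dist_le (x y z r s : R) : `|x - y| <= r -> `|y - z| <= s -> `|x - z| <= r + s.
Proof. by move=> H1 H2; have := ler_distD y x z; lra. Qed.

Lemma dist_lt (x y z r s : R) : `|x - y| < r -> `|y - z| < s -> `|x - z| < r + s.
Proof. by move=> H1 H2; have := ler_distD y x z; lra. Qed.

End TaylorBounds.

Local Notation e1 := (1, 0).
Local Notation e2 := (0, 1).

(** Integrate along the horizontal line through [z1] and then along every
    vertical line.  Flatness says that the candidate [b F al] for the
    horizontal derivative of the result [F] satisfies the equation obtained by
    differentiating the vertical one, so that the error of the difference
    quotient is controlled by the Gronwall estimate. *)
Lemma flat_parallel_exists (R : realType) (V W : normedModType R)
    (b : V -> W -> V) (D : set (R * R)) (al be : R * R -> W) (z0 : R * R) :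
  bounded_bilinear b -> has_primitives V -> geometrically_complete V ->
  open D -> Cinfty D al -> Cinfty D be ->
  (forall z y, D z ->
     b y ('D_e2 al z) + b (b y (be z)) (al z) =
     b y ('D_e1 be z) + b (b y (al z)) (be z)) ->
  D z0 ->
  exists r : R, [/\ 0 < r, forall z, `|z - z0| < r -> D z &
    forall z1 xi, `|z1 - z0| < r -> exists F : R * R -> V, F z1 = xi /\
      forall z, `|z - z0| < r -> parallel_at b al be F z].
Proof.
move=> bb primV complV oD cal cbe flat Dz0.
have [_ _ [K K0 bK]] := bb.
have cbeu := Cinfty_Du cbe; have cbeuu := Cinfty_Du cbeu.
have [r1 [N1 [r10 N10 H1]]] := continuous_near_bounded (Cinfty_continuous cal Dz0).
have [r2 [N2 [r20 N20 H2]]] := continuous_near_bounded (Cinfty_continuous cbe Dz0).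
have [r3 [N3 [r30 N30 H3]]] := continuous_near_bounded (Cinfty_continuous cbeu Dz0).
have [r4 [N4 [r40 N40 H4]]] := continuous_near_bounded (Cinfty_continuous cbeuu Dz0).
have [r5 /= r50 Hr5] : nbhs_ball_ (ball_ Num.Def.normr) z0 D.
  by apply/nbhs_normP; exact: open_nbhs_nbhs.
pose N := N1 + N2 + N3 + N4.
have N0 : 0 < N by rewrite /N; lra.
have KN0 : 0 < K * N by rewrite mulr_gt0.
(* all data are controlled on the square of radius 4 r, the equations are
   integrated on the one of radius 3 r, starting from a point at distance r *)
have [r [r0 rD rN rC]] : exists r : R, [/\ 0 < r,
    forall z, `|z - z0| < 4 * r -> D z,
    forall z, `|z - z0| < 4 * r -> [/\ `|al z| <= N, `|be z| <= N,
      `|'D_e1 be z| <= N & `|'D_e1 ('D_e1 be) z| <= N]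
    & K * N * (2 * r) <= 1 / 2].
  pose r' := Num.min (Num.min r1 r2) (Num.min (Num.min r3 r4) r5).
  have r'0 : 0 < r' by rewrite !lt_min r10 r20 r30 r40.
  exists (Num.min (r' / 4) (4 * (K * N))^-1); split.
  - by rewrite lt_min divr_gt0//= invr_gt0 mulr_gt0.
  - move=> z; rewrite -ltr_pdivrMl// lt_min => /andP[+ _].
    rewrite mulrC ltr_pM2r ?invr_gt0// !lt_min => /andP[_ /andP[_ zr]].
    by apply: Hr5; rewrite /ball_ /= distrC.
  - move=> z; rewrite -ltr_pdivrMl// lt_min => /andP[+ _].
    rewrite mulrC ltr_pM2r ?invr_gt0// !lt_min.
    move=> /andP[/andP[/H1 a1 /H2 a2] /andP[/andP[/H3 a3 /H4 a4] _]].
    by rewrite /N; split; lra.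
  - apply: le_trans (_ : K * N * (2 * (4 * (K * N))^-1) <= _).
      by rewrite ler_wpM2l ?(ltW KN0)// ler_wpM2l// ge_min lexx orbT.
    have -> : K * N * (2 * (4 * (K * N))^-1) = (K * N) * (K * N)^-1 / 2.
      by rewrite (invfM 4); field; rewrite gt_eqF//= gt_eqF.
    by rewrite mulfV// gt_eqF.
have C0 := ltW KN0.
have bal z y : `|z - z0| < 4 * r -> `|b y (al z)| <= K * N * `|y|.
  move=> /rN[zN _ _ _]; apply: le_trans (bK _ _) _.
  by rewrite mulrAC ler_wpM2r// ler_pM2l.
have bbe z y : `|z - z0| < 4 * r -> `|b y (be z)| <= K * N * `|y|.
  move=> /rN[_ zN _ _]; apply: le_trans (bK _ _) _.
  by rewrite mulrAC ler_wpM2r// ler_pM2l.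
exists r; split=> // [z zr|z1 xi z1r]; first by apply: rD; lra.
pose cl1 := clamp z0.1 (3 * r); pose cl2 := clamp z0.2 (3 * r).
have r30' : 0 <= 3 * r by lra.
have cl_in (u v : R) : `|u - z0.1| <= 3 * r -> `|v - z0.2| <= 3 * r ->
    `|(u, v) - z0| < 4 * r.
  by move=> ur vr; case: (z0) ur vr => x y /= ur vr; apply: normr_pair_lt => /=; lra.
have clcont (a : R) (f : R -> R * R) (g : R * R -> W) :
    (forall s t, `|f s - f t| <= `|s - t|) ->
    (forall t, {for f t, continuous g}) ->
    forall y, continuous (fun t => b y (g (f t))).
  move=> flip gc y t; apply: bounded_bilinear_continuous => //.
    exact: cst_continuous.
  apply: continuous_comp (gc t).
  by apply/continuousP_norm => e e0; exists e => // w wt; apply: le_trans (ltW wt).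
have z1r1 := le_lt_trans (normr_fst _) z1r.
have z1r2 := le_lt_trans (normr_snd _) z1r.
rewrite /= in z1r1 z1r2.
have r20' : 0 <= 2 * r by lra.
have [g [ga gD]] : exists g : R -> V, g z1.1 = xi /\
    forall t : R, `|t - z1.1| <= 2 * r ->
      is_derive t 1 g (b (g t) (al (cl1 t, z1.2))).
  apply: (linear_ode_short (B := fun t y => b y (al (cl1 t, z1.2))) (C := K * N)) => //.
  - by move=> t x y; exact: bilBl.
  - by move=> t y; apply: bal; apply: cl_in; [exact: clamp_dist | lra].
  - apply: (clcont 0 (fun t => (cl1 t, z1.2))) => [s t|t].
      apply: normr_pair_le; first exact: clamp_lipschitz.
      by rewrite subrr normr0.
    apply: Cinfty_continuous cal _; apply: rD; apply: cl_in; last lra.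
    exact: clamp_dist.
have /choice[G HG] : forall u, exists G : R -> V, G z1.2 = g u /\
    forall t : R, `|t - z1.2| <= 2 * r ->
      is_derive t 1 G (b (G t) (be (cl1 u, cl2 t))).
  move=> u.
  apply: (linear_ode_short (B := fun t y => b y (be (cl1 u, cl2 t))) (C := K * N)) => //.
  - by move=> t x y; exact: bilBl.
  - by move=> t y; apply: bbe; apply: cl_in; exact: clamp_dist.
  - apply: (clcont 0 (fun t => (cl1 u, cl2 t))) => [s t|t].
      apply: normr_pair_le; first by rewrite subrr normr0.
      exact: clamp_lipschitz.
    by apply: Cinfty_continuous cbe _; apply: rD; apply: cl_in; exact: clamp_dist.
pose F (z : R * R) := G z.1 z.2.
have GD (u t : R) : `|u - z0.1| <= 3 * r -> `|t - z1.2| <= 2 * r ->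
    is_derive t 1 (G u) (b (G u t) (be (u, t))).
  move=> ur tr; have [_ /(_ t tr)] := HG u.
  rewrite /cl1 clamp_id// /cl2 clamp_id//.
  have := dist_le tr (ltW z1r2); move/le_trans; apply.
  by clear -r0; lra.
have gD' (t : R) : `|t - z0.1| < r -> is_derive t 1 g (b (g t) (al (t, z1.2))).
  rewrite distrC in z1r1; move=> tr.
  have := gD t; rewrite /cl1 clamp_id; last by clear -r0 tr; lra.
  apply; have := dist_lt tr z1r1; clear; lra.
exists F; split=> [|z zr]; first by rewrite /F (HG _).1.
have zr1 := le_lt_trans (normr_fst _) zr; have zr2 := le_lt_trans (normr_snd _) zr.
rewrite /= in zr1 zr2.
have z12 : `|z.2 - z1.2| < 2 * r.
  by rewrite distrC in z1r2; have := dist_lt zr2 z1r2; clear; lra.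
split; last first.
  apply: is_derive_axis2; rewrite [z in b _ (be z)]surjective_pairing.
  by apply: GD; [clear -zr1 r0; lra | exact: ltW].
case: z zr zr1 zr2 z12 => u v /= zr zr1 zr2 z12.
have gb s : `|s - z0.1| < r -> `|g s| <= 2 * `|xi|.
  move=> sr; have := @short_gronwall _ _ g (fun t => b (g t) (al (cl1 t, z1.2)))
     z1.1 (2 * r) (K * N) 0 r20' C0 rC gD.
  rewrite ga mulr0 addr0; apply.
    move=> t _; rewrite addr0; apply: bal; apply: cl_in; first exact: clamp_dist.
    by clear -z1r2 r0; lra.
  by rewrite distrC in z1r1; have := dist_lt sr z1r1; clear; lra.
pose X := 4 * `|xi|.
have X0 : 0 <= X by rewrite mulr_ge0.
have Fb s t : `|s - z0.1| < r -> `|t - z1.2| <= 2 * r -> `|F (s, t)| <= X.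
  move=> sr tr; have := @short_gronwall _ _ (G s) (fun t => b (G s t) (be (cl1 s, cl2 t)))
     z1.2 (2 * r) (K * N) 0 r20' C0 rC (HG s).2.
  rewrite (HG s).1 mulr0 addr0 => H; apply: le_trans (H _ t tr) _.
    by move=> t' _; rewrite addr0; apply: bbe; apply: cl_in; exact: clamp_dist.
  by have := gb s sr; rewrite /X; clear; lra.
apply/is_deriveP => e e0.
pose c := K * X * N + K * (K * N * X) * N.
have c0 : 0 <= c by rewrite /c addr_ge0// !mulr_ge0 ?(ltW K0)// ltW.
have e40 : 0 < e / 4 by rewrite divr_gt0.
have /is_deriveP/(_ _ e40)[d1 d10 Hd1] := gD' u zr1.
pose d2 := e / (2 * (4 * r * c + 1)).
have rc0 : 0 <= 4 * r * c by rewrite !mulr_ge0// ltW.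
have d20 : 0 < d2 by rewrite divr_gt0// mulr_gt0//; clear -rc0; lra.
pose d3 := r - `|u - z0.1|.
exists (Num.min d1 (Num.min d2 d3)) => [|h].
  by rewrite !lt_min d10 d20 /d3 subr_gt0.
rewrite !lt_min => /and3P[hd1 hd2 hd3].
have shr s : `|s| <= `|h| -> `|s + u - z0.1| < r.
  move=> sh; rewrite -addrA; apply: le_lt_trans (ler_normD _ _) _.
  by move: hd3; rewrite /d3; clear -sh; lra.
have -> : h *: e1 + (u, v) = (h + u, v).
  by congr pair; rewrite /= ?scaler0 ?add0r// /GRing.scale /= mulr1.
pose Wf (t : R) := b (F (u, t)) (al (u, t)).
pose E (t : R) := F (h + u, t) - F (u, t) - h *: Wf t.
pose dE (t : R) := b (F (h + u, t)) (be (h + u, t)) - b (F (u, t)) (be (u, t)) -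
  h *: (b (b (F (u, t)) (be (u, t))) (al (u, t)) + b (F (u, t)) ('D_e2 al (u, t))).
rewrite -/(E v).
pose l := `|v - z1.2|.
have hu : `|h + u - z0.1| < r by exact: shr.
have t2r (t : R) : `|t - z1.2| <= l -> `|t - z1.2| <= 2 * r.
  by move=> tl; apply: le_trans tl (ltW _).
have hu3 : `|h + u - z0.1| <= 3 * r by clear -hu r0; lra.
have u3 : `|u - z0.1| <= 3 * r by clear -zr1 r0; lra.
have inD (s t : R) : `|s + u - z0.1| < r -> `|t - z1.2| <= l -> `|(s + u, t) - z0| < 4 * r.
  move=> sr /t2r tl; apply: cl_in; first by clear -sr r0; lra.
  by have := dist_le tl (ltW z1r2); clear; lra.
have inD0 (t : R) : `|t - z1.2| <= l -> `|(u, t) - z0| < 4 * r.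
  by move=> tl; have := inD 0 t; rewrite add0r; apply.
have ED (t : R) : `|t - z1.2| <= l -> is_derive t 1 E (dE t).
  move=> tl.
  have D1 : is_derive t 1 (fun t => F (h + u, t)) (b (F (h + u, t)) (be (h + u, t))).
    by apply: GD => //; exact: t2r.
  have D2 : is_derive t 1 (fun t => F (u, t)) (b (F (u, t)) (be (u, t))).
    by apply: GD => //; exact: t2r.
  refine (is_derive_sub (is_derive_sub D1 D2) _).
  apply: (@is_deriveZ _ _ _ Wf h).
  apply: is_derive_bilinear => //.
  by apply: derive_axis2; apply: Cinfty_dv cal _; exact/rD/inD0.
have dEb (t : R) : `|t - z1.2| <= l -> `|dE t| <= K * N * `|E t| + c * `|h| ^+ 2.
  move=> tl; have Dt : D (u, t) by exact/rD/inD0.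
  have [B1 B2] : `|be (h + u, t) - be (u, t)| <= N * `|h| /\
      `|be (h + u, t) - be (u, t) - h *: 'D_e1 be (u, t)| <= N * `|h| * `|h|.
    apply: (increment_bounds (D := D)) => // [|s sh]; first exact: ltW.
    have /rN[_ _ ? ?] := inD s t (shr _ sh) tl; split=> //.
    exact/rD/inD/tl/shr.
  have -> : dE t = b (E t) (be (h + u, t)) +
      b (F (u, t)) (be (h + u, t) - be (u, t) - h *: 'D_e1 be (u, t)) +
      h *: b (Wf t) (be (h + u, t) - be (u, t)).
    rewrite /dE /E (addrC (b (b _ _) _)) flat// -/(Wf t).
    rewrite !(bilBl bb, bilBr bb, bilZl bb, bilZr bb)//; lin_module R V.
  have FX : `|F (u, t)| <= X by apply: Fb => //; exact: t2r.
  apply: le_trans (ler_normD _ _) _.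
  apply: le_trans (lerD (ler_normD _ _) (lexx _)) _.
  have T1 : `|b (E t) (be (h + u, t))| <= K * N * `|E t| by apply: bbe; exact: inD.
  have T2 : `|b (F (u, t)) (be (h + u, t) - be (u, t) - h *: 'D_e1 be (u, t))|
      <= K * X * (N * `|h| * `|h|).
    by apply: le_trans (bK _ _) _; apply: ler_pM => //;
      rewrite ?mulr_ge0 ?(ltW K0)// ler_pM2l.
  have T3 : `|h *: b (Wf t) (be (h + u, t) - be (u, t))| <=
      `|h| * (K * (K * N * X) * (N * `|h|)).
    rewrite normrZ ler_wpM2l//; apply: le_trans (bK _ _) _.
    apply: ler_pM => //; first by rewrite mulr_ge0// ltW.
    rewrite ler_pM2l//; apply: le_trans (bal _ _ (inD0 _ tl)) _.
    by rewrite ler_pM2l.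
  by rewrite /c; clear -T1 T2 T3; lra.
have E1 : `|E z1.2| <= e / 4 * `|h|.
  have := Hd1 h hd1; rewrite -[h *: 1]/(h * 1) mulr1.
  by rewrite /E /Wf /F /= !(HG _).1.
have Cl : K * N * l <= 1 / 2.
  by apply: le_trans rC; rewrite ler_pM2l// /l ltW.
have := @short_gronwall _ _ E dE z1.2 l (K * N) _ (normr_ge0 _) C0 Cl ED dEb v (lexx _).
move/le_trans; apply.
have l2r : l * (c * `|h| ^+ 2) <= 2 * r * (c * `|h| ^+ 2).
  by rewrite ler_wpM2r ?mulr_ge0 ?exprn_ge0// ltW.
have hc : `|h| * (4 * r * c + 1) <= e / 2.
  move: hd2; rewrite /d2 ltr_pdivlMr ?mulr_gt0//; last by clear -rc0; lra.
  by clear; lra.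
have : `|h| * (`|h| * (4 * r * c + 1)) <= `|h| * (e / 2) by rewrite ler_wpM2l.
have := mulr_ge0 (normr_ge0 h) (normr_ge0 h).
by rewrite expr2 in l2r *; clear -E1 l2r; lra.
Qed.

(** * Monodromy on a simply connected space *)

Lemma within_continuous_comp (S T K : topologicalType) (A : set S) (f : S -> T)
    (phi : K -> S) :
  {within A, continuous f} -> continuous phi -> (forall k, A (phi k)) ->
  continuous (f \o phi).
Proof.
move=> cf cphi Aphi k O /= nO.
have : nbhs_subspace (A := A) (phi k) (f @^-1` O) := cf (phi k) O nO.
rewrite -nbhs_subspace_in; last exact: Aphi.
move=> H; have {}H : \forall k' \near k, A (phi k') -> O (f (phi k')) := cphi k _ H.
change (\forall k' \near k, O (f (phi k'))).
by apply: filterS H => k' /(_ (Aphi k')).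
Qed.

Section Lifting.
Context {R : realType} (T : topologicalType) (X : Type).
(** [Sol U f]: on the open set [U], [f] is one of the local solutions whose
    analytic continuation is studied.  [Sol_germ] is the identity theorem, and
    [Sol_exists] gives local solutions on an open set that depends neither on
    the initial point nor on the initial value, which prevents continuation
    from stopping. *)
Variable Sol : set T -> (T -> X) -> Prop.
Hypothesis Sol_germ : forall U V f g y, Sol U f -> Sol V g -> U y -> V y ->
  \forall y' \near y, (f y' = g y' <-> f y = g y).
Hypothesis Sol_exists : forall x, exists U, [/\ open U, U x &
  forall y xi, U y -> exists f, Sol U f /\ f y = xi].

(** The continuation of a solution along [h], over the set [A]: a lift of [h] to
    the space of germs of solutions. *)
Definition lift (K : topologicalType) (h : K -> T) (A : set K) (l : K -> X) :=
  forall k, A k -> exists U f, [/\ Sol U f, U (h k) &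
    \forall k' \near k, A k' -> l k' = f (h k')].

Section Lifts.
Variable K : topologicalType.
Implicit Types (h : K -> T) (A : set K) (l : K -> X).

(** By the identity theorem, the set where two lifts agree is open and closed. *)
Lemma lift_unique h A l l' k0 : continuous h -> connected A ->
  lift h A l -> lift h A l' -> A k0 -> l k0 = l' k0 -> forall k, A k -> l k = l' k.
Proof.
move=> ch cA hl hl' Ak0 lk0.
have dich k : A k -> \forall k' \near k, A k' -> (l k' = l' k' <-> l k = l' k).
  move=> Ak; have [U [f [SU Uk nl]]] := hl k Ak.
  have [U' [f' [SU' Uk' nl']]] := hl' k Ak.
  have nff : \forall k' \near k, (f (h k') = f' (h k') <-> f (h k) = f' (h k)) :=
    ch k _ (Sol_germ SU SU' Uk Uk').
  have lk := nbhs_singleton nl Ak; have lk' := nbhs_singleton nl' Ak.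
  rewrite lk lk'; move: nl nl' nff; apply: filterS3 => k' H H' Hf Ak'.
  by rewrite H ?H'.
pose B := [set k | A k /\ l k = l' k].
suff BA : B = A by move=> k; rewrite -BA => -[].
apply: cA.
- by exists k0.
- exists (interior [set k | A k -> l k = l' k]); first exact: open_interior.
  apply/seteqP; split=> k /=.
    move=> [Ak lk]; split=> //; apply: filterS (dich k Ak) => k' H Ak'.
    exact/(H Ak').
  by case=> Ak /interior_subset /(_ Ak).
- exists (~` interior [set k | A k -> l k <> l' k]).
    by apply: open_closedC; exact: open_interior.
  apply/seteqP; split=> k /=.
    by move=> [Ak lk]; split=> // /interior_subset /(_ Ak).
  case=> Ak nk; split=> //; apply: contrapT => lk; apply: nk.
  by apply: filterS (dich k Ak) => k' H Ak' /(H Ak').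
Qed.

Definition liftable h A := forall k0 xi, A k0 -> exists l, lift h A l /\ l k0 = xi.

Lemma liftable_local h A : continuous h ->
  (forall k0, A k0 -> exists2 U, (forall k, A k -> U (h k)) &
    forall y xi, U y -> exists f, Sol U f /\ f y = xi) ->
  liftable h A.
Proof.
move=> ch AU k0 xi Ak0; have [U hU HU] := AU k0 Ak0.
have [f [SU fk]] := HU _ xi (hU k0 Ak0).
exists (f \o h); split=> // k Ak; exists U, f; split=> //; first exact: hU.
by near=> k'.
Unshelve. all: by end_near. Qed.

Lemma lift_near h A l k U f : continuous h -> closed A -> lift h A l ->
  Sol U f -> U (h k) -> f (h k) = l k ->
  \forall k' \near k, A k' -> l k' = f (h k').
Proof.
move=> ch cA hl SU Uk fk; have [Ak|nAk] := pselect (A k); last first.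
  have : nbhs k (~` A) by apply: open_nbhs_nbhs; split=> //; exact: closed_openC.
  by apply: filterS => k' /=.
have [U' [f' [SU' Uk' nl]]] := hl k Ak.
have E : f (h k) = f' (h k) by rewrite fk; exact: (nbhs_singleton nl Ak).
have nff : \forall k' \near k, (f (h k') = f' (h k') <-> f (h k) = f' (h k)) :=
  ch k _ (Sol_germ SU SU' Uk Uk').
by move: nl nff; apply: filterS2 => k' H Hf Ak'; rewrite H//; exact/esym/Hf.
Qed.

(** The two lifts are chosen to agree at [m], hence on the connected
    intersection. *)
Lemma glue_half h A1 A2 m k0 xi : continuous h -> closed A1 -> closed A2 ->
  connected (A1 `&` A2) -> A1 m -> A2 m ->
  liftable h A1 -> liftable h A2 -> A1 k0 ->
  exists l, lift h (A1 `|` A2) l /\ l k0 = xi.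
Proof.
move=> ch c1 c2 cA A1m A2m L1 L2 Ak0.
have [l1 [l1l l1k0]] := L1 k0 xi Ak0.
have [l2 [l2l l2m]] := L2 m (l1 m) A2m.
have l12 k : A1 k -> A2 k -> l1 k = l2 k.
  have H1 : lift h (A1 `&` A2) l1.
    move=> k' [A1k' _]; have [U [f [SU Uk nl]]] := l1l k' A1k'.
    by exists U, f; split=> //; apply: filterS nl => z H [Az _]; exact: H.
  have H2 : lift h (A1 `&` A2) l2.
    move=> k' [_ A2k']; have [U [f [SU Uk nl]]] := l2l k' A2k'.
    by exists U, f; split=> //; apply: filterS nl => z H [_ Az]; exact: H.
  move=> A1k A2k.
  exact: (lift_unique ch cA H1 H2 (conj A1m A2m) (esym l2m) (conj A1k A2k)).
pose l k := if pselect (A1 k) then l1 k else l2 k.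
have lE1 k : A1 k -> l k = l1 k by rewrite /l; case: pselect.
have lE2 k : A2 k -> l k = l2 k.
  by move=> A2k; rewrite /l; case: pselect => // A1k; exact: l12.
have l1l' : lift h A1 l.
  move=> k A1k; have [U [f [SU Uk nl]]] := l1l k A1k; exists U, f; split=> //.
  by apply: filterS nl => k' H A1k'; rewrite lE1// H.
have l2l' : lift h A2 l.
  move=> k A2k; have [U [f [SU Uk nl]]] := l2l k A2k; exists U, f; split=> //.
  by apply: filterS nl => k' H A2k'; rewrite lE2// H.
exists l; split; last by rewrite lE1.
move=> k Ak.
have [U [f [SU Uk fk]]] : exists U f, [/\ Sol U f, U (h k) & f (h k) = l k].
  have [U [oU Uk HU]] := Sol_exists (h k); have [f [SU fk]] := HU _ (l k) Uk.
  by exists U, f.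
exists U, f; split=> //.
move: (lift_near ch c1 l1l' SU Uk fk) (lift_near ch c2 l2l' SU Uk fk).
by apply: filterS2 => k' H1 H2 [/H1|/H2].
Qed.

Lemma liftable_glue h A1 A2 m : continuous h -> closed A1 -> closed A2 ->
  connected (A1 `&` A2) -> A1 m -> A2 m ->
  liftable h A1 -> liftable h A2 -> liftable h (A1 `|` A2).
Proof.
move=> ch c1 c2 cA m1 m2 L1 L2 k0 xi [A1k|A2k].
  exact: (glue_half xi ch c1 c2 cA m1 m2 L1 L2 A1k).
rewrite setUC; rewrite setIC in cA.
exact: (glue_half xi ch c2 c1 cA m2 m1 L2 L1 A2k).
Qed.

Lemma constant_lift h A xi x : (forall k, A k -> h k = x) -> lift h A (fun=> xi).
Proof.
move=> hx k Ak; have [U [oU Uk HU]] := Sol_exists (h k).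
have [f [SU fk]] := HU _ xi Uk; exists U, f; split=> //.
by near=> k' => Ak'; rewrite (hx k' Ak') -(hx k Ak).
Unshelve. all: by end_near. Qed.

End Lifts.

Lemma lift_comp (K K' : topologicalType) (h : K -> T) (h' : K' -> T)
    (phi : K' -> K) A A' l : continuous phi ->
  (forall k, A' k -> A (phi k)) -> (forall k, A' k -> h' k = h (phi k)) ->
  lift h A l -> lift h' A' (l \o phi).
Proof.
move=> cphi AA hh hl k A'k; have [U [f [SU Uk nl]]] := hl _ (AA k A'k).
exists U, f; split=> //; first by rewrite hh.
have {}nl : \forall k' \near k, A (phi k') -> l (phi k') = f (h (phi k')) :=
  cphi k _ nl.
apply: filterS nl => k' H A'k' /=.
by rewrite (hh _ A'k') H//; exact: AA.
Qed.

Lemma connected_image_segment (K : topologicalType) (phi : R -> K) (a b : R) :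
  continuous phi -> connected (phi @` `[a, b]).
Proof.
move=> cphi; apply: connected_continuous_connected; first exact: segment_connected.
exact: continuous_subspaceT.
Qed.

Definition rect (a b c d : R) : set (R * R) := `[a, b] `*` `[c, d].

Lemma rectP a b c d z : rect a b c d z <->
  [/\ a <= z.1, z.1 <= b, c <= z.2 & z.2 <= d].
Proof.
rewrite /rect /=; split; first by rewrite !in_itv /= => -[/andP[? ?] /andP[? ?]].
by case=> ? ? ? ?; rewrite !in_itv /=; split; apply/andP.
Qed.

Lemma continuous_fst : continuous (fst : R * R -> R).
Proof.
move=> z; apply/continuousP_norm => e e0; exists e => // w /ltW wz.
exact: le_trans (normr_fst (w - z)) wz.
Qed.

Lemma continuous_snd : continuous (snd : R * R -> R).
Proof.
move=> z; apply/continuousP_norm => e e0; exists e => // w /ltW wz.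
exact: le_trans (normr_snd (w - z)) wz.
Qed.

Lemma closed_rect a b c d : closed (rect a b c d).
Proof.
have -> : rect a b c d = (fst @^-1` `[a, b]) `&` (snd @^-1` `[c, d]).
  by apply/seteqP; split=> z [].
apply: closedI; apply: preimage_closed => [? _|];
  [exact: continuous_fst | exact: itv_closed |
   exact: continuous_snd | exact: itv_closed].
Qed.

Lemma pair_continuous (K : topologicalType) (f g : K -> R) :
  continuous f -> continuous g -> continuous (fun k => (f k, g k)).
Proof. by move=> cf cg k; exact: (cvg_pair (cf k) (cg k)). Qed.

Lemma connected_edge1 (x c d : R) : connected [set z : R * R | z.1 = x /\ c <= z.2 <= d].
Proof.
have -> : [set z : R * R | z.1 = x /\ c <= z.2 <= d] = (fun t => (x, t)) @` `[c, d].
  apply/seteqP; split=> -[u v] /=; first by case=> -> cv; exists v; rewrite ?in_itv.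
  by case=> t; rewrite in_itv /= => ct [<- <-].
apply: connected_image_segment; apply: pair_continuous; first exact: cst_continuous.
by move=> ?.
Qed.

Lemma connected_edge2 (y c d : R) : connected [set z : R * R | c <= z.1 <= d /\ z.2 = y].
Proof.
have -> : [set z : R * R | c <= z.1 <= d /\ z.2 = y] = (fun t => (t, y)) @` `[c, d].
  apply/seteqP; split=> -[u v] /=; first by case=> cv ->; exists u; rewrite ?in_itv.
  by case=> t; rewrite in_itv /= => ct [<- <-].
apply: connected_image_segment; apply: pair_continuous; last exact: cst_continuous.
by move=> ?.
Qed.

Lemma rect_glue1 (h : R * R -> T) a b c s t : continuous h ->
  a <= b -> b <= c -> s <= t ->
  liftable h (rect a b s t) -> liftable h (rect b c s t) -> liftable h (rect a c s t).
Proof.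
move=> ch ab bc st L1 L2.
have -> : rect a c s t = rect a b s t `|` rect b c s t.
  apply/seteqP; split=> z; last first.
    by case=> /rectP[? ? ? ?]; apply/rectP; split=> //; lra.
  move=> /rectP[? ? ? ?]; have [zb|bz] := leP z.1 b; [left | right];
    by apply/rectP; split=> //; exact: ltW.
apply: (liftable_glue (m := (b, s))) => //; try exact: closed_rect.
- have -> : rect a b s t `&` rect b c s t = [set z : R * R | z.1 = b /\ s <= z.2 <= t].
    apply/seteqP; split=> z; last first.
      by case=> zb /andP[? ?]; split; apply/rectP; split=> //; rewrite zb.
    by case=> /rectP[_ zb sz zt] /rectP[bz _ _ _]; split; [lra | rewrite sz].
  exact: connected_edge1.
- by apply/rectP.
- by apply/rectP.
Qed.

Lemma rect_glue2 (h : R * R -> T) a b c s t : continuous h ->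
  a <= b -> b <= c -> s <= t ->
  liftable h (rect s t a b) -> liftable h (rect s t b c) -> liftable h (rect s t a c).
Proof.
move=> ch ab bc st L1 L2.
have -> : rect s t a c = rect s t a b `|` rect s t b c.
  apply/seteqP; split=> z; last first.
    by case=> /rectP[? ? ? ?]; apply/rectP; split=> //; lra.
  move=> /rectP[? ? ? ?]; have [zb|bz] := leP z.2 b; [left | right];
    by apply/rectP; split=> //; exact: ltW.
apply: (liftable_glue (m := (s, b))) => //; try exact: closed_rect.
- have -> : rect s t a b `&` rect s t b c = [set z : R * R | s <= z.1 <= t /\ z.2 = b].
    apply/seteqP; split=> z; last first.
      by case=> /andP[? ?] zb; split; apply/rectP; split=> //; rewrite zb.
    by case=> /rectP[sz zt _ zb] /rectP[_ _ bz _]; split; [rewrite sz | lra].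
  exact: connected_edge2.
- by apply/rectP.
- by apply/rectP.
Qed.

(** Rectangles are glued along a common edge, and small rectangles lift because
    their image lies in the domain of local solutions; [interval_glue] is used
    once in each direction. *)
Lemma square_liftable (h : R * R -> T) : continuous h -> liftable h (rect 0 1 0 1).
Proof.
move=> ch.
apply: (interval_glue (P := fun s u => liftable h (rect s u 0 1))) => //.
  by move=> s t u _ st tu _; apply: rect_glue1.
move=> s0 _ _.
pose Q c d := exists2 e : R, 0 < e & forall s u, s <= s0 -> s0 <= u ->
   s0 - e < s -> u < s0 + e -> liftable h (rect s u c d).
suff [e e0 He] : Q 0 1.
  by exists e => // s u _ ? ? _ ? ?; exact: He.
apply: (interval_glue (P := Q)) => //.
  move=> c d f _ cd df _ [e1 e10 H1] [e2 e20 H2].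
  exists (Num.min e1 e2) => [|s u su us]; first by rewrite lt_min e10.
  move=> se ue.
  have [m1 m2] : Num.min e1 e2 <= e1 /\ Num.min e1 e2 <= e2.
    by split; rewrite ge_min lexx ?orbT.
  apply: (rect_glue2 (b := d)) => //; first exact: le_trans us.
    by apply: H1 => //; lra.
  by apply: H2 => //; lra.
move=> t0 _ _; have [U [oU Ut HU]] := Sol_exists (h (s0, t0)).
have /nbhs_normP[e /= e0 He] : nbhs (s0, t0) (h @^-1` U).
  by apply: ch; exact: open_nbhs_nbhs.
exists e => // c d _ ct td _ ce de; exists e => // s u su us se ue.
apply: liftable_local => // k0 _; exists U => // k /rectP[k1 k2 k3 k4].
apply: He; rewrite /ball_ /=; case: k k1 k2 k3 k4 => x y /= k1 k2 k3 k4.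
by apply: normr_pair_lt => /=; rewrite ltr_norml; apply/andP; split; lra.
Qed.

Lemma path_lift (gamma : R -> T) xi : continuous gamma ->
  exists l, lift gamma `[0, 1] l /\ l 0 = xi.
Proof.
move=> cg.
have ch : continuous (gamma \o snd : R * R -> T).
  by move=> z; apply: continuous_comp; [exact: continuous_snd | exact: cg].
have [|L [hL L0]] := square_liftable ch (k0 := (0, 0)) xi.
  by apply/rectP.
exists (fun t => L (0, t)); split=> //.
apply: (lift_comp (phi := fun t : R => (0, t)) _ _ _ hL) => //.
  by apply: pair_continuous; [exact: cst_continuous | move=> ?].
by move=> t /=; rewrite in_itv /= => /andP[? ?]; apply/rectP.
Qed.

Lemma path_lift_unique (gamma : R -> T) l l' t0 : continuous gamma ->
  lift gamma `[0, 1] l -> lift gamma `[0, 1] l' -> 0 <= t0 <= 1 -> l t0 = l' t0 ->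
  forall t, 0 <= t <= 1 -> l t = l' t.
Proof.
move=> cg hl hl' t01 E t t1.
apply: (lift_unique cg (@segment_connected _ 0 1) hl hl' _ E);
  by rewrite /= in_itv.
Qed.

(** The lift of the homotopy is constant on the three sides of the square that
    are mapped to the base point, and it is [l] on the fourth side. *)
Lemma loop_lift (h : R * R -> T) (gamma : R -> T) l : continuous h -> continuous gamma ->
  (forall t, 0 <= t <= 1 -> [/\ h (0, t) = gamma t, h (1, t) = gamma 0,
     h (t, 0) = gamma 0 & h (t, 1) = gamma 0]) ->
  lift gamma `[0, 1] l -> l 1 = l 0.
Proof.
move=> ch cg hb hl.
have [|L [hL L0]] := square_liftable ch (k0 := (0, 0)) (l 0); first by apply/rectP.
have c1 (x : R) : continuous (fun t : R => (x, t)).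
  by apply: pair_continuous; [exact: cst_continuous | move=> ?].
have c2 (x : R) : continuous (fun t : R => (t, x)).
  by apply: pair_continuous; [move=> ? | exact: cst_continuous].
have cst x (phi : R -> R * R) : continuous phi ->
    (forall t, 0 <= t <= 1 -> rect 0 1 0 1 (phi t) /\ h (phi t) = x) ->
    L (phi 1) = L (phi 0).
  move=> cphi H.
  apply: (path_lift_unique (gamma := h \o phi) (l := L \o phi)
    (l' := fun=> L (phi 0)) (t0 := 0)) => //; rewrite ?lexx ?ler01//.
  - by move=> t; apply: continuous_comp; [exact: cphi | exact: ch].
  - by apply: lift_comp hL => // t; rewrite /= in_itv /= => /H[].
  - by apply: (constant_lift _ (x := x)) => t; rewrite /= in_itv /= => /H[].
have E1 : L (1, 0) = L (0, 0).
  apply: (cst (gamma 0) (fun t => (t, 0))) => // t t01; split.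
    by case/andP: t01 => ? ?; apply/rectP.
  by have [] := hb t t01.
have E2 : L (1, 1) = L (1, 0).
  apply: (cst (gamma 0) (fun t => (1, t))) => // t t01; split.
    by case/andP: t01 => ? ?; apply/rectP.
  by have [] := hb t t01.
have E3 : L (1, 1) = L (0, 1).
  apply: (cst (gamma 0) (fun t => (t, 1))) => // t t01; split.
    by case/andP: t01 => ? ?; apply/rectP.
  by have [] := hb t t01.
rewrite -[RHS]L0 -E1 -E2 E3.
apply/esym; apply: (path_lift_unique (gamma := gamma) (l := fun t => L (0, t)) (l' := l)
  (t0 := 0)) => //; rewrite ?lexx ?ler01//.
apply: (lift_comp (phi := fun t : R => (0, t)) _ _ _ hL) => //.
  by move=> t /=; rewrite in_itv /= => /andP[? ?]; apply/rectP.
by move=> t; rewrite /= in_itv /= => /hb[].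
Qed.

Definition path_cat (g1 g2 : R -> T) (t : R) : T :=
  if t <= 1 / 2 then g1 (2 * t) else g2 (2 * t - 1).

Lemma continuous_affine (a c : R) : continuous (fun t : R => a * t + c).
Proof.
move=> t; apply: cvgD; last exact: cvg_cst.
by apply: cvgMr; exact: cvg_id.
Qed.

Lemma path_cat_continuous (g1 g2 : R -> T) : continuous g1 -> continuous g2 -> g1 1 = g2 0 ->
  continuous (path_cat g1 g2).
Proof.
move=> c1 c2 E t0.
have C1 : {for t0, continuous (fun t : R => g1 (2 * t))}.
  have := @continuous_affine 2 0 t0; rewrite /prop_for /continuous_at.
  under eq_fun do rewrite addr0.
  by rewrite addr0 => H; apply: (continuous_comp H); exact: c1.
have C2 : {for t0, continuous (fun t : R => g2 (2 * t - 1))}.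
  have H := @continuous_affine 2 (- 1) t0.
  by apply: (continuous_comp H); exact: c2.
have [t0l|t0g|t0e] := ltgtP t0 (1 / 2).
- rewrite /prop_for /continuous_at {2}/path_cat (ltW t0l).
  apply: cvg_trans C1; apply: near_eq_cvg.
  near=> t; rewrite /path_cat ifT//; apply: ltW; near: t.
  exact: lt_nbhsl.
- rewrite /prop_for /continuous_at {2}/path_cat leNgt t0g /=.
  apply: cvg_trans C2; apply: near_eq_cvg.
  near=> t; rewrite /path_cat ifF//; apply/negbTE; rewrite -ltNge; near: t.
  exact: lt_nbhsr.
- move=> O /= nO.
  have gE : path_cat g1 g2 t0 = g1 (2 * t0) by rewrite /path_cat t0e lexx.
  have gE' : path_cat g1 g2 t0 = g2 (2 * t0 - 1).
    rewrite gE t0e; have -> : 2 * (1 / 2) = 1 :> R by lra.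
    by rewrite subrr E.
  have nO1 := nO; have nO2 := nO; rewrite gE in nO1; rewrite gE' in nO2.
  have n1 : \forall t \near t0, O (g1 (2 * t)) := C1 O nO1.
  have n2 : \forall t \near t0, O (g2 (2 * t - 1)) := C2 O nO2.
  change (\forall t \near t0, O (path_cat g1 g2 t)).
  by move: n1 n2; apply: filterS2 => t H1 H2; rewrite /path_cat; case: ifP.
Unshelve. all: by end_near. Qed.

Lemma path_cat1 (g1 g2 : R -> T) t : 0 <= t <= 1 -> path_cat g1 g2 (2^-1 * t + 0) = g1 t.
Proof.
move=> /andP[t0 t1]; rewrite /path_cat ifT; last by lra.
by congr g1; lra.
Qed.

Lemma path_cat2 (g1 g2 : R -> T) t : g1 1 = g2 0 -> 0 <= t <= 1 ->
  path_cat g1 g2 (2^-1 * t + 2^-1) = g2 t.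
Proof.
move=> E /andP[t0 t1]; rewrite /path_cat; case: ifP => h.
  have -> : t = 0 by lra.
  by rewrite -E; congr g1; lra.
by congr g2; lra.
Qed.

Lemma lift_cat (g1 g2 : R -> T) (L : R -> X) : continuous g1 -> continuous g2 -> g1 1 = g2 0 ->
  lift (path_cat g1 g2) `[0, 1] L ->
  lift g1 `[0, 1] (fun t => L (2^-1 * t + 0)) /\
  lift g2 `[0, 1] (fun t => L (2^-1 * t + 2^-1)).
Proof.
move=> c1 c2 E hL; split.
  apply: (lift_comp (phi := fun t : R => 2^-1 * t + 0) _ _ _ hL).
  - exact: continuous_affine.
  - by move=> t /=; rewrite !in_itv /= => /andP[? ?]; apply/andP; split; lra.
  - by move=> t; rewrite /= in_itv /= => t01; rewrite path_cat1.
apply: (lift_comp (phi := fun t : R => 2^-1 * t + 2^-1) _ _ _ hL).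
- exact: continuous_affine.
- by move=> t /=; rewrite !in_itv /= => /andP[? ?]; apply/andP; split; lra.
- by move=> t; rewrite /= in_itv /= => t01; rewrite path_cat2.
Qed.

Section Global.
Hypothesis scT : @simply_connected R T.
Hypothesis locally_path_connected : forall x U, open U -> U x ->
  \forall y \near x, exists gamma : R -> T,
    [/\ continuous gamma, gamma 0 = x, gamma 1 = y & forall t, U (gamma t)].
Variables (x0 : T) (xi0 : X).

(** The retraction of the line onto the unit interval: composing with it turns
    paths and homotopies continuous within their domain into continuous maps. *)
Definition clamp01 : R -> R := clamp (1 / 2) (1 / 2).

Lemma clamp01_in t : 0 <= clamp01 t <= 1.
Proof.
have := @clamp_dist _ (1 / 2) (1 / 2) t; rewrite /clamp01 ler_norml => H.
have h2 : 0 <= 1 / 2 :> R by lra.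
by have /andP[? ?] := H h2; apply/andP; split; lra.
Qed.

Lemma clamp01_id t : 0 <= t <= 1 -> clamp01 t = t.
Proof.
by move=> /andP[? ?]; apply: clamp_id; rewrite ler_norml; apply/andP; split; lra.
Qed.

Lemma clamp01_continuous : continuous clamp01.
Proof.
move=> t; apply/continuousP_norm => e e0; exists e => // w /ltW wt.
exact: le_trans (clamp_lipschitz _ _ _ _) wt.
Qed.

Lemma path_exists x y : exists gamma : R -> T,
  [/\ continuous gamma, gamma 0 = x & gamma 1 = y].
Proof.
have [gamma [cg g0 g1]] := scT.1 x y; exists (gamma \o clamp01); split.
- apply: within_continuous_comp cg clamp01_continuous _ => t /=.
  by rewrite in_itv /=; exact: clamp01_in.
- by rewrite /= clamp01_id// lexx ler01.
- by rewrite /= clamp01_id// lexx ler01.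
Qed.

Lemma loop_lift_sc (gamma : R -> T) (l : R -> X) : continuous gamma -> gamma 0 = gamma 1 ->
  lift gamma `[0, 1] l -> l 1 = l 0.
Proof.
move=> cg g01 hl; have [|H [cH Hb]] := scT.2 gamma _ g01.
  exact: continuous_subspaceT.
pose c2 (z : R * R) := (clamp01 z.1, clamp01 z.2).
have cc2 : continuous c2.
  by apply: pair_continuous => z; apply: continuous_comp;
    [exact: continuous_fst | exact: clamp01_continuous |
     exact: continuous_snd | exact: clamp01_continuous].
apply: (loop_lift (h := H \o c2) (gamma := gamma)) => //.
  apply: within_continuous_comp cH cc2 _ => z /=.
  by rewrite !in_itv /=; split; exact: clamp01_in.
move=> t t01; rewrite /= /c2 /= !(clamp01_id t01) !clamp01_id ?lexx ?ler01//.
by have [] := Hb t; rewrite ?in_itv.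
Qed.

Definition reach (x : T) (eta : X) := exists (gamma : R -> T) (l : R -> X),
  [/\ continuous gamma, gamma 0 = x0, gamma 1 = x, lift gamma `[0, 1] l &
      l 0 = xi0 /\ l 1 = eta].

Lemma reach_exists x : exists eta, reach x eta.
Proof.
have [gamma [cg g0 g1]] := path_exists x0 x.
have [l [hl l0]] := path_lift xi0 cg.
by exists (l 1), gamma, l.
Qed.

(** Continuation along the first path followed by the reverse of the second one
    returns to [xi0], because this loop is null homotopic. *)
Lemma reach_unique x eta eta' : reach x eta -> reach x eta' -> eta = eta'.
Proof.
case=> g1 [l1 [c1 g10 g11 h1 [l10 <-]]].
case=> g2 [l2 [c2 g20 g21 h2 [l20 <-]]].
pose g2' (t : R) := g2 (- 1 * t + 1).
have cg2' : continuous g2'.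
  by move=> t; apply: (continuous_comp (@continuous_affine (- 1) 1 t)); exact: c2.
have hl2' : lift g2' `[0, 1] (fun t => l2 (- 1 * t + 1)).
  apply: (lift_comp (phi := fun t : R => - 1 * t + 1) _ _ _ h2) => //.
    exact: continuous_affine.
  by move=> t /=; rewrite !in_itv /= => /andP[? ?]; apply/andP; split; lra.
have E : g1 1 = g2' 0 by rewrite g11 -g21 /g2' mulr0 add0r.
have cc := path_cat_continuous c1 cg2' E.
have [L [hL L0]] := path_lift xi0 cc.
have [hL1 hL2] := lift_cat c1 cg2' E hL.
have L1 : L 1 = xi0.
  rewrite -L0; apply: (loop_lift_sc cc _ hL); rewrite /path_cat.
  rewrite ifT ?mulr0; last by lra.
  rewrite ifF; last by apply/negbTE; rewrite -ltNge; lra.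
  by rewrite g10 /g2' -g20; congr g2; lra.
have i0 : 0 <= (0 : R) <= 1 by rewrite lexx ler01.
have i1 : 0 <= (1 : R) <= 1 by rewrite lexx ler01.
have A : L 2^-1 = l1 1.
  have := @path_lift_unique g1 _ l1 0 c1 hL1 h1 i0; rewrite mulr0 addr0 L0 l10.
  by move=> /(_ erefl 1 i1) <-; rewrite mulr1 addr0.
have B : L 2^-1 = l2 1.
  have := @path_lift_unique g2' _ _ 1 cg2' hL2 hl2' i1.
  have -> : 2^-1 * 1 + 2^-1 = 1 :> R by lra.
  have -> : - 1 * 1 + 1 = 0 :> R by lra.
  by rewrite L1 l20 => /(_ erefl 0 i0); rewrite !mulr0 !add0r.
by rewrite -A B.
Qed.

(** The monodromy theorem.  By [reach_unique] the continuation along paths is a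
    function of the end point; it is a solution near [x] because the points near
    [x] are reached by prolonging a path to [x] inside the domain of a local
    solution. *)
Lemma global_solution : exists F : T -> X, F x0 = xi0 /\
  forall x, exists U f, [/\ Sol U f, U x & \forall y \near x, F y = f y].
Proof.
have /choice[F HF] := reach_exists; exists F; split.
  apply: (reach_unique (HF x0)); exists (fun=> x0), (fun=> xi0); split=> //.
    by move=> t; exact: cst_continuous.
  exact: (constant_lift _ (x := x0)).
move=> x; have [U [oU Ux HU]] := Sol_exists x.
have [f [SU fx]] := HU x (F x) Ux; exists U, f; split=> //.
have := locally_path_connected oU Ux; apply: filterS => y.
case=> g2 [c2 g20 g21 gU].
apply: (reach_unique (HF y)).
have [g1 [l1 [c1 g10 g11 h1 [l10 l11]]]] := HF x.
have E : g1 1 = g2 0 by rewrite g11 g20.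
have cc := path_cat_continuous c1 c2 E.
have [L [hL L0]] := path_lift xi0 cc.
have [hL1 hL2] := lift_cat c1 c2 E hL.
have i0 : 0 <= (0 : R) <= 1 by rewrite lexx ler01.
have i1 : 0 <= (1 : R) <= 1 by rewrite lexx ler01.
have A : L 2^-1 = F x.
  have := @path_lift_unique g1 _ l1 0 c1 hL1 h1 i0; rewrite mulr0 addr0 L0 l10.
  by move=> /(_ erefl 1 i1); rewrite mulr1 addr0 l11.
have hf : lift g2 `[0, 1] (f \o g2).
  move=> t _; exists U, f; split; [exact: SU | exact: gU | ].
  by near=> s.
have B : L 1 = f y.
  have := @path_lift_unique g2 _ _ 0 c2 hL2 hf i0; rewrite mulr0 add0r A /= g20 fx.
  move=> /(_ erefl 1 i1); rewrite g21.
  by have -> : 2^-1 * 1 + 2^-1 = 1 :> R by lra.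
exists (path_cat g1 g2), L; split=> //.
- by rewrite /path_cat ifT ?mulr0//; lra.
- rewrite /path_cat ifF; last by apply/negbTE; rewrite -ltNge; lra.
  by rewrite -g21; congr g2; lra.
Unshelve. all: by end_near. Qed.

End Global.

End Lifting.

(** * Holomorphic changes of coordinates *)

Section HolomorphicMaps.
Context {R : realType}.
Local Open Scope complex_scope.
Notation e1 := ((1, 0) : R * R).
Notation e2 := ((0, 1) : R * R).

Lemma normc_ge (x : R[i]) :
  `|complex.Re x| <= ComplexField.Normc.normc x /\ `|complex.Im x| <= ComplexField.Normc.normc x.
Proof.
case: x => a b; rewrite /=; split; rewrite -sqrtr_sqr ler_wsqrtr//.
  by rewrite lerDl sqr_ge0.
by rewrite lerDr sqr_ge0.
Qed.

(** The Cauchy-Riemann equations: the complex difference quotient is restricted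
    to real and to imaginary increments. *)
Lemma holomorphic_partials (f : R * R -> R * R) z : holomorphic_at f z ->
  exists a : R * R, is_derive z e1 f a /\ is_derive z e2 f (- a.2, a.1).
Proof.
move=> /cvg_ex[l fl].
pose F : R[i] -> R[i] := to_C \o f \o of_C.
have A (e : R) : 0 < e -> exists2 d : R, 0 < d & forall h : R[i],
    ComplexField.Normc.normc h < d ->
    ComplexField.Normc.normc (F (h + to_C z) - F (to_C z) - h * l) <=
      e * ComplexField.Normc.normc h.
  move=> e0; have e0' : 0 < e%:C by rewrite ltcE /= eqxx.
  have /cvgrPdist_le/(_ _ e0') := fl.
  rewrite near_withinE => /nbhs_normP[d /= d0 Hd].
  have dE : d = (complex.Re d)%:C.
    by case: d d0 {Hd} => x y; rewrite ltcE /= => /andP[/eqP -> _].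
  exists (complex.Re d); first by move: d0; rewrite ltcE => /andP[].
  move=> h hd; have [->|h0] := eqVneq h 0.
    by rewrite add0r subrr mul0r subr0 ComplexField.Normc.normc0 mulr0.
  have hd' : `|h| < d by rewrite dE ltcE /= eqxx.
  have := Hd h; rewrite /ball_ /= sub0r normrN => /(_ hd' h0).
  rewrite lecE /= => /andP[_].
  set q := _ *: _ => H.
  have qE : h * q = F (h + to_C z) - F (to_C z).
    rewrite /q /F /= -[h^-1 *: _]/(h^-1 * _) mulrA mulfV// mul1r.
    by rewrite -[h *: 1]/(h * 1) mulr1.
  rewrite -qE -mulrBr ComplexField.Normc.normcM mulrC ler_wpM2r//.
    by case: (h) => x y; exact: sqrtr_ge0.
  apply: le_trans H; rewrite le_eqVlt; apply/orP; left; apply/eqP.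
  have normcN (w : R[i]) : ComplexField.Normc.normc (- w) = ComplexField.Normc.normc w.
    by case: w => x y; rewrite /= !sqrrN.
  by rewrite -normcN opprB.
have main (v : R * R) (i0 : R[i]) : ComplexField.Normc.normc i0 = 1 ->
    (forall t : R, of_C (t%:C * i0 + to_C z) = t *: v + z) ->
    is_derive z v f (of_C (i0 * l)).
  move=> n0 Hv; apply/is_deriveP => e /A[d d0 Hd]; exists d => // t td.
  have nt : ComplexField.Normc.normc (t%:C * i0) = `|t|.
    by rewrite ComplexField.Normc.normcM n0 mulr1 /= expr0n /= addr0 sqrtr_sqr.
  have := Hd (t%:C * i0); rewrite nt => /(_ td) H.
  have [H1 H2] := normc_ge (F (t%:C * i0 + to_C z) - F (to_C z) - t%:C * i0 * l).
  have E : f (t *: v + z) - f z - t *: of_C (i0 * l) =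
      of_C (F (t%:C * i0 + to_C z) - F (to_C z) - t%:C * i0 * l).
    rewrite /F /= Hv; have -> : of_C (to_C z) = z by case: (z).
    rewrite -mulrA; case: (i0 * l) => x y; case: (f _) => p q; case: (f z) => p' q'.
    by rewrite /of_C /to_C /= !mul0r subr0 addr0.
  rewrite E; apply: le_trans H; apply: normr_pair_le => //.
exists (of_C l); split.
  rewrite -[l]mul1r; apply: main; first by rewrite ComplexField.Normc.normc1.
  by case: (z) => x y t; rewrite mulr1; congr pair; rewrite /= ?scaler0// /GRing.scale /= mulr1.
have -> : (- (of_C l).2, (of_C l).1) = of_C ('i * l).
  by case: (l) => x y; congr pair; rewrite /= mul0r mul1r ?sub0r ?add0r.
apply: main; first by rewrite /= expr0n expr1n add0r sqrtr1.
case: (z) => x y t; congr pair; rewrite /= ?scaler0 ?mulr0 ?mul0r ?mulr1 ?subr0 ?addr0//.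
by rewrite /GRing.scale /= mulr1.
Qed.

End HolomorphicMaps.

Section Surface.
Context {R : realType} {M : riemannSurface R}.
Notation e1 := ((1, 0) : R * R).
Notation e2 := ((0, 1) : R * R).
Implicit Types (c d : @chart R M) (x : M).

Lemma open_cimg c : open (cimg c). Proof. exact: cimg_open. Qed.

Lemma cimg_coord c x : cdom c x -> cimg c (coord c x).
Proof. by exists x. Qed.

Lemma param_cdom c z : cimg c z -> cdom c (param c z).
Proof. by case=> x cx <-; rewrite coordK. Qed.

Lemma paramK c z : cimg c z -> coord c (param c z) = z.
Proof. by case=> x cx <-; rewrite coordK. Qed.

Lemma atlas_holomorphic c : atlas c -> holomorphic_coordinate c.
Proof. by move=> Ac d Ad; exact: atlas_compatible. Qed.

Lemma near_param c x (P : M -> Prop) : cdom c x -> (\forall y \near x, P y) ->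
  \forall z \near coord c x, cimg c z /\ P (param c z).
Proof.
move=> cx nP; have zc := cimg_coord cx.
have n1 : \forall z \near coord c x, cimg c z.
  by apply: open_nbhs_nbhs; split=> //; exact: cimg_open.
have n2 : \forall z \near coord c x, P (param c z).
  by apply: (param_continuous zc); rewrite coordK.
by move: n1 n2; apply: filterS2.
Qed.

Lemma near_coord c x (P : R * R -> Prop) : cdom c x ->
  (\forall z \near coord c x, P z) -> \forall y \near x, cdom c y /\ P (coord c y).
Proof.
move=> cx nP.
have n1 : \forall y \near x, cdom c y.
  by apply: open_nbhs_nbhs; split=> //; exact: cdom_open.
have n2 : \forall y \near x, P (coord c y) by exact: (coord_continuous cx).
by move: n1 n2; apply: filterS2.
Qed.

(** In holomorphic coordinates the pair of partial derivatives transforms like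
    the components of a real covector, by a matrix satisfying the
    Cauchy-Riemann equations. *)
Lemma partial_transition (V : normedModType R) c d x (F : M -> V)
    (fu fv : R * R -> V) (r : R) :
  holomorphic_coordinate c -> atlas d -> cdom c x -> cdom d x -> 0 < r ->
  (forall w, `|w - coord d x| < r -> is_derive w e1 (F \o param d) (fu w)) ->
  (forall w, `|w - coord d x| < r -> is_derive w e2 (F \o param d) (fv w)) ->
  {for coord d x, continuous fu} -> {for coord d x, continuous fv} ->
  let a := partial_u c (coord d) x in
  is_derive (coord c x) e1 (F \o param c)
    (a.1 *: fu (coord d x) + a.2 *: fv (coord d x)) /\
  is_derive (coord c x) e2 (F \o param c)
    (- a.2 *: fu (coord d x) + a.1 *: fv (coord d x)).
Proof.
move=> hc Ad cx dx r0 fD gD cu cv a.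
have [hT _] := hc d Ad x cx dx.
have [a' [T1 T2]] := holomorphic_partials hT.
have aE : a = a' by have [_ <-] := T1.
rewrite {}aE {a}; move: a' T1 T2 => a T1 T2.
pose T := coord d \o param c.
have TxE : T (coord c x) = coord d x by rewrite /T /= coordK.
have nE : \forall w \near coord c x, ((F \o param d) \o T) w = (F \o param c) w.
  have : \forall y \near x, cdom d y.
    by apply: open_nbhs_nbhs; split=> //; exact: cdom_open.
  move=> /(near_param cx); apply: filterS => w [_ dw].
  by rewrite /T /= coordK.
split; apply: near_eq_is_derive nE _; rewrite -TxE in fD gD cu cv *.
  exact: (chain_rule r0 T1 fD gD cu cv).
exact: (chain_rule r0 T2 fD gD cu cv).
Qed.

Lemma cimg_ball c x : cdom c x ->
  exists2 r : R, 0 < r & forall w, `|w - coord c x| < r -> cimg c w.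
Proof.
move=> cx; have [r /= r0 Hr] : nbhs_ball_ (ball_ Num.Def.normr) (coord c x) (cimg c).
  by apply/nbhs_normP/open_nbhs_nbhs; split; [exact: cimg_open | exact: cimg_coord].
by exists r => // w wx; apply: Hr; rewrite /ball_ /= distrC.
Qed.

Lemma smooth_transition (V : normedModType R) c d x (F : M -> V) :
  smooth F -> holomorphic_coordinate c -> atlas d -> cdom c x -> cdom d x ->
  let a := partial_u c (coord d) x in
  partial_u c F x = a.1 *: partial_u d F x + a.2 *: partial_v d F x /\
  partial_v c F x = - a.2 *: partial_u d F x + a.1 *: partial_v d F x.
Proof.
move=> sF hc Ad cx dx a; have hd := atlas_holomorphic Ad.
have [r r0 Hr] := cimg_ball dx.
have cF := sF d hd; have od : open (cimg d) by exact: open_cimg.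
have [] := @partial_transition _ c d x F ('D_e1 (F \o param d)) ('D_e2 (F \o param d))
  r hc Ad cx dx r0.
- by move=> w /Hr; exact: Cinfty_du.
- by move=> w /Hr; exact: Cinfty_dv.
- by apply: Cinfty_continuous (cimg_coord dx); exact: Cinfty_Du.
- by apply: Cinfty_continuous (cimg_coord dx); exact: Cinfty_Dv.
by move=> [_ H1] [_ H2]; split.
Qed.

Lemma locally_path_connected_surface x (U : set M) : open U -> U x ->
  \forall y \near x, exists gamma : R -> M,
    [/\ continuous gamma, gamma 0 = x, gamma 1 = y & forall t, U (gamma t)].
Proof.
move=> oU Ux; have [c Ac cx] := atlas_cover x.
have nU : \forall y \near x, U y by exact: open_nbhs_nbhs.
have /nbhs_normP[r /= r0 Hr] := near_param cx nU.
have : \forall w \near coord c x, `|w - coord c x| < r.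
  by apply/nbhs_normP; exists r => // w; rewrite /ball_ /= distrC.
move=> /(near_coord cx); apply: filterS => y [cy yr].
pose z (t : R) := clamp01 t *: (coord c y - coord c x) + coord c x.
have zr t : `|z t - coord c x| < r.
  rewrite /z addrK normrZ; apply: le_lt_trans yr.
  have /andP[t0 t1] := clamp01_in t.
  by rewrite ger0_norm// ler_piMl.
have zin t : cimg c (z t) /\ U (param c (z t)).
  by apply: Hr; rewrite /ball_ /= distrC.
have cz : continuous z.
  move=> t; apply: cvgD; last exact: cvg_cst.
  apply: cvgZl; exact: clamp01_continuous.
exists (param c \o z); split.
- move=> t; apply: continuous_comp; first exact: cz.
  by apply: param_continuous; have [] := zin t.
- rewrite /= /z clamp01_id ?lexx ?ler01// scale0r add0r coordK//.
- rewrite /= /z clamp01_id ?lexx ?ler01// scale1r subrK coordK//.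
- by move=> t; have [] := zin t.
Qed.

End Surface.

Section ParallelMaps.
Context {R : realType} {M : riemannSurface R} {V W : normedModType R}.
Variable b : V -> W -> V.
Hypothesis bb : bounded_bilinear b.
Notation e1 := ((1, 0) : R * R).
Notation e2 := ((0, 1) : R * R).
Implicit Types (c d : @chart R M) (x : M) (al be : @chart R M -> M -> W).

(** A 1-form with values in [W], given by its components [al c] and [be c] in
    every holomorphic coordinate [c]. *)
Definition smooth_form al be :=
  (forall c, holomorphic_coordinate c ->
     Cinfty (cimg c) (al c \o param c) /\ Cinfty (cimg c) (be c \o param c)) /\
  (forall c d x, holomorphic_coordinate c -> atlas d -> cdom c x -> cdom d x ->
     let a := partial_u c (coord d) x in
     al c x = a.1 *: al d x + a.2 *: be d x /\
     be c x = - a.2 *: al d x + a.1 *: be d x).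

(** Equality of the mixed derivatives of a solution of
    [F_u = b F al], [F_v = b F be]. *)
Definition flat_form al be := forall c, holomorphic_coordinate c ->
  forall z y, cimg c z ->
    b y ('D_e2 (al c \o param c) z) + b (b y (be c (param c z))) (al c (param c z)) =
    b y ('D_e1 (be c \o param c) z) + b (b y (al c (param c z))) (be c (param c z)).

Definition parallel al be c (F : M -> V) x :=
  is_derive (coord c x) e1 (F \o param c) (b (F x) (al c x)) /\
  is_derive (coord c x) e2 (F \o param c) (b (F x) (be c x)).

Lemma parallelE al be c F x : cdom c x -> parallel al be c F x <->
  parallel_at b (al c \o param c) (be c \o param c) (F \o param c) (coord c x).
Proof. by move=> cx; rewrite /parallel /parallel_at /= !coordK. Qed.

Lemma parallel_ext al be c (F G : M -> V) x : cdom c x ->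
  (\forall y \near x, F y = G y) -> parallel al be c F x -> parallel al be c G x.
Proof.
move=> cx nFG [H1 H2].
have FGx : F x = G x := nbhs_singleton nFG.
have n1 : \forall z \near coord c x, (F \o param c) z = (G \o param c) z.
  by apply: filterS (near_param cx nFG) => z [].
by rewrite /parallel -FGx; split; apply: near_eq_is_derive n1 _.
Qed.

(** Bootstrapping: [F] is continuous, and its partial derivatives [b F al] and
    [b F be] are as regular as [F]. *)
Lemma parallel_smooth al be F : smooth_form al be ->
  (forall c, holomorphic_coordinate c -> forall x, cdom c x -> parallel al be c F x) ->
  smooth F.
Proof.
move=> [sm _] FP c hc; have [sa sb] := sm c hc.
have oc : open (cimg c) by exact: open_cimg.
have P z : cimg c z ->
    parallel_at b (al c \o param c) (be c \o param c) (F \o param c) z.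
  move=> cz; rewrite -(paramK cz); apply/parallelE; first exact: param_cdom.
  exact/FP/param_cdom.
suff H n m : (m <= n)%N -> Cn m (cimg c) (F \o param c) by move=> n; exact: (H n).
elim: n m => [|n IH] m.
  rewrite leqn0 => /eqP -> z cz.
  have cx := param_cdom cz.
  have [r r0 Hr] := cimg_ball cx; rewrite paramK// in Hr.
  apply: (parallel_continuous bb r0 _ _ (fun w wr => P w (Hr w wr))).
    exact: Cinfty_continuous sa cz.
  exact: Cinfty_continuous sb cz.
rewrite leq_eqVlt ltnS => /predU1P[->|]; last exact: IH.
apply: (CnS oc (fun z cz => (P z cz).1) (fun z cz => (P z cz).2)).
  by apply: (Cn_bilinear oc bb) => // m' _; exact: sa.
by apply: (Cn_bilinear oc bb) => // m' _; exact: sb.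
Qed.

(** The equation is linear in the form, so it is preserved by changes of
    coordinates once [F] and [al du + be dv] transform compatibly. *)
Lemma parallel_transition al be c d (F : M -> V) x (r : R) : smooth_form al be ->
  holomorphic_coordinate c -> atlas d -> cdom c x -> cdom d x -> 0 < r ->
  (forall w, `|w - coord d x| < r -> cimg d w) ->
  (forall w, `|w - coord d x| < r -> parallel al be d F (param d w)) ->
  parallel al be c F x.
Proof.
move=> sf hc Ad cx dx r0 Hr FP; have hd := atlas_holomorphic Ad.
have [sa sb] := sf.1 d hd.
have P w : `|w - coord d x| < r ->
    parallel_at b (al d \o param d) (be d \o param d) (F \o param d) w.
  move=> wr; have cw := Hr w wr.
  rewrite -(paramK cw); apply/parallelE; first exact: param_cdom.
  exact: FP.
have ca := Cinfty_continuous sa (cimg_coord dx).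
have cb := Cinfty_continuous sb (cimg_coord dx).
have cF : {for coord d x, continuous (F \o param d)}.
  exact: (parallel_continuous bb r0 ca cb P).
have [] := @partial_transition _ _ V c d x F
  (fun w => b ((F \o param d) w) ((al d \o param d) w))
  (fun w => b ((F \o param d) w) ((be d \o param d) w)) r hc Ad cx dx r0.
- by move=> w /P[].
- by move=> w /P[].
- exact: bounded_bilinear_continuous.
- exact: bounded_bilinear_continuous.
rewrite /= !coordK// => H1 H2; rewrite /parallel.
have [-> ->] := sf.2 c d x hc Ad cx dx.
by rewrite !(bilDr bb) !(bilZr bb).
Qed.

Definition local_parallel al be (U : set M) (F : M -> V) :=
  open U /\ forall x, U x -> forall d, atlas d -> cdom d x -> parallel al be d F x.

Lemma local_parallel_germ al be U U' F G y : smooth_form al be ->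
  local_parallel al be U F -> local_parallel al be U' G -> U y -> U' y ->
  \forall y' \near y, (F y' = G y' <-> F y = G y).
Proof.
move=> sf [oU FP] [oU' GP] Uy Uy'.
have [d Ad dy] := atlas_cover y.
have [sa sb] := sf.1 d (atlas_holomorphic Ad).
have ca := Cinfty_continuous sa (cimg_coord dy).
have cb := Cinfty_continuous sb (cimg_coord dy).
have [r0 r00 H] := parallel_unique bb ca cb.
have nU : \forall x \near y, U x /\ U' x.
  have n1 : \forall x \near y, U x by exact: open_nbhs_nbhs.
  have n2 : \forall x \near y, U' x by exact: open_nbhs_nbhs.
  by move: n1 n2; apply: filterS2.
have /nbhs_normP[r1 /= r10 Hr1] := near_param dy nU.
pose r := Num.min r0 r1.
have r_gt0 : 0 < r by rewrite lt_min r00.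
have inU w : `|w - coord d y| < r -> [/\ cimg d w, U (param d w) & U' (param d w)].
  rewrite lt_min => /andP[_ wr].
  have wb : ball_ Num.Def.normr (coord d y) r1 w by rewrite /ball_ /= distrC.
  by have [? []] := Hr1 w wb.
have nr : \forall w \near coord d y, 2 * `|w - coord d y| < r.
  apply/nbhs_normP; exists (r / 2); first by rewrite /= divr_gt0.
  by move=> w; rewrite /ball_ /= distrC ltr_pdivlMr// mulrC.
apply: filterS (near_coord dy nr) => y' [dy' yr].
have := H (F \o param d) (G \o param d) r; rewrite ge_min lexx => /(_ isT).
have FP' w : `|w - coord d y| < r ->
    parallel_at b (al d \o param d) (be d \o param d) (F \o param d) w.
  move=> /inU[cw Uw _]; rewrite -(paramK cw); apply/parallelE; first exact: param_cdom.
  by apply: FP => //; exact: param_cdom.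
have GP' w : `|w - coord d y| < r ->
    parallel_at b (al d \o param d) (be d \o param d) (G \o param d) w.
  move=> /inU[cw _ Uw]; rewrite -(paramK cw); apply/parallelE; first exact: param_cdom.
  by apply: GP => //; exact: param_cdom.
by move=> /(_ FP' GP' _ yr); rewrite /= !coordK.
Qed.

Lemma local_parallel_exists al be x :
  has_primitives V -> geometrically_complete V ->
  smooth_form al be -> flat_form al be ->
  exists U, [/\ open U, U x & forall y xi, U y ->
    exists F, local_parallel al be U F /\ F y = xi].
Proof.
move=> primV complV sf fl; have [d Ad dx] := atlas_cover x.
have hd := atlas_holomorphic Ad; have [sa sb] := sf.1 d hd.
have [r [r0 rD HF]] := flat_parallel_exists bb primV complV (@open_cimg R M d) sa sb
  (fl d hd) (cimg_coord dx).
pose U := [set y | cdom d y /\ `|coord d y - coord d x| < r].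
have nball w : `|w - coord d x| < r -> \forall w' \near w, `|w' - coord d x| < r.
  move=> wr; apply/nbhs_normP; exists (r - `|w - coord d x|) => /=.
    by rewrite subr_gt0.
  move=> w'; rewrite /ball_ /= ltrBrDr distrC; apply: le_lt_trans.
  exact: ler_distD.
have oU : open U.
  rewrite openE => y [dy yr]; exact: (near_coord dy (nball _ yr)).
exists U; split=> //; first by split=> //; rewrite subrr normr0.
move=> y xi [dy yr]; have [f [fy fP]] := HF _ xi yr.
exists (f \o coord d); split=> //; split=> // y' [dy' yr'] c Ac cy'.
have fE w : `|w - coord d x| < r -> (f \o coord d \o param d) w = f w.
  by move=> wr; rewrite /= paramK//; exact: rD.
have P y'' : U y'' -> parallel al be d (f \o coord d) y''.
  move=> [dy'' yr'']; apply/parallelE => //.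
  have [P1 P2] := fP _ yr''.
  have n1 : \forall w \near coord d y'', f w = (f \o coord d \o param d) w.
    by apply: filterS (nball _ yr'') => w /fE ->.
  by split; apply: near_eq_is_derive n1 _; rewrite /= !coordK// in P1 P2 *.
have /nbhs_normP[s /= s0 Hs] : nbhs (coord d y') [set w | `|w - coord d x| < r].
  exact: nball.
have inr w : `|w - coord d y'| < s -> `|w - coord d x| < r.
  by move=> ws; apply: Hs; rewrite /ball_ /= distrC.
apply: (parallel_transition sf (atlas_holomorphic Ac) Ad cy' dy' s0).
  by move=> w /inr/rD.
move=> w /inr wr; apply: P; have cw := rD _ wr.
by split; [exact: param_cdom | rewrite paramK].
Qed.

(** The local solutions provided by [flat_parallel_exists] are continued along
    paths by [global_solution]. *)
Lemma parallel_exists al be x0 xi0 : @simply_connected R M ->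
  has_primitives V -> geometrically_complete V ->
  smooth_form al be -> flat_form al be ->
  exists F : M -> V, F x0 = xi0 /\ forall c, holomorphic_coordinate c ->
    forall x, cdom c x -> parallel al be c F x.
Proof.
move=> scM primV complV sf fl.
have [F [Fx HF]] := @global_solution R M V (local_parallel al be)
  (fun U U' f g y => @local_parallel_germ al be U U' f g y sf)
  (fun x => local_parallel_exists x primV complV sf fl)
  scM (@locally_path_connected_surface R M) x0 xi0.
exists F; split=> // c hc x cx.
have FP d y : atlas d -> cdom d y -> parallel al be d F y.
  move=> Ad dy; have [U [f [[_ fP] Uy nF]]] := HF y.
  apply: (parallel_ext dy _ (fP y Uy d Ad dy)).
  by apply: filterS nF => z ->.
have [d Ad dx] := atlas_cover x; have [r r0 Hr] := cimg_ball dx.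
apply: (parallel_transition sf hc Ad cx dx r0 Hr) => w /Hr dw.
by apply: FP => //; exact: param_cdom.
Qed.

(** By [local_parallel_germ] the set where [F] and [G] agree and its complement
    are open. *)
Lemma parallel_eq al be F G x0 : smooth_form al be ->
  (forall c, atlas c -> forall x, cdom c x -> parallel al be c F x) ->
  (forall c, atlas c -> forall x, cdom c x -> parallel al be c G x) ->
  F x0 = G x0 -> forall x, F x = G x.
Proof.
move=> sf FP GP E.
have LF : local_parallel al be setT F.
  by split; [exact: openT | move=> x _ d Ad dx; exact: FP].
have LG : local_parallel al be setT G.
  by split; [exact: openT | move=> x _ d Ad dx; exact: GP].
have dich x := local_parallel_germ sf LF LG (I : setT x) (I : setT x).
pose B := [set x | F x = G x].
suff BT : B = [set: M] by move=> x; have : [set: M] x by []; rewrite -BT.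
have oB : open B.
  rewrite openE => x Bx; apply: filterS (dich x) => y H; exact/H.
have oB' : open (~` B).
  by rewrite openE => x Bx; apply: filterS (dich x) => y H /H.
apply: carrier_connected; first by exists x0.
- by exists B => //; rewrite setTI.
- by exists B; [rewrite -[B]setCK; exact: open_closedC | rewrite setTI].
Qed.

End ParallelMaps.

(** * Calculus with values in the quaternions *)

Section RealPrimitives.
Context {R : realType}.

Lemma primitive_right (g : R -> R) (a : R) : continuous g ->
  exists F : R -> R, forall t : R, a < t -> is_derive t 1 F (g t).
Proof.
move=> cg.
exists (fun x => (\int[lebesgue_measure]_(t in [set` Interval (BLeft a) (BRight x)]) (g t))%R).
move=> t ta; have tt : t < t + 1 by rewrite ltrDl.
have ig : lebesgue_measure.-integrable [set` Interval (BLeft a) (BRight (t + 1))] (EFin \o g).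
  apply: continuous_compact_integrable; first exact: segment_compact.
  exact: continuous_subspaceT.
have /= H := continuous_FTC1 tt ig.
have {H}[||dF FE] := H; [by rewrite lte_fin | exact: cg |].
by rewrite derive1E in FE; exact: DeriveDef.
Qed.

Lemma has_primitives_R : has_primitives R.
Proof.
move=> g cg.
have /choice[F HF] : forall a, exists F : R -> R, forall t : R, a < t ->
    is_derive t 1 F (g t) by move=> a; exact: primitive_right.
(* the integral from a to t minus the integral from a to 0 does not depend on
   the base point a, provided that it is on the left of both 0 and t *)
have indep a b t : a <= b -> b < - `|t| -> F a t - F a 0 = F b t - F b 0.
  move=> ab bt; apply/eqP; rewrite -subr_eq0 -normr_le0.
  have := @mean_value_R _ _ (fun t => F a t - F b t) (fun t => g t - g t) 0 t 0.
  rewrite mul0r subr0.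
  have -> : F a t - F a 0 - (F b t - F b 0) = F a t - F b t - (F a 0 - F b 0) by ring.
  apply=> s st; last by rewrite subrr normr0.
  rewrite subr0 ler_norml in st; have /andP[s1 _] := st.
  have bs : b < s by exact: lt_le_trans s1.
  by apply: is_derive_sub; apply: HF => //; exact: le_lt_trans bs.
exists (fun t => F (- `|t| - 1) t - F (- `|t| - 1) 0) => t.
have nE : \forall w \near t, F (- `|t| - 2) w - F (- `|t| - 2) 0 =
    F (- `|w| - 1) w - F (- `|w| - 1) 0.
  apply/nbhs_normP; exists 1 => //= w; rewrite /ball_ /= => wt.
  have := ler_normD (w - t) t; rewrite subrK (distrC w) => wn.
  by apply: indep; lra.
apply: near_eq_is_derive nE _.
have nt := ler_norm (- t); rewrite normrN in nt.
have t2 : - `|t| - 2 < t by lra.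
rewrite -[g t]subr0.
exact: (is_derive_sub (HF _ _ t2) (is_derive_cst _ t 1)).
Qed.

Lemma geometrically_complete_R : geometrically_complete R.
Proof.
move=> a K aK; have K0 : 0 <= K by have := aK 0%N; rewrite divr1; apply: le_trans.
pose e k : R := 2 * K / 2 ^+ k.
have e0 k : 0 <= e k by rewrite /e !mulr_ge0 ?invr_ge0 ?exprn_ge0.
have eS k : e k = 2 * e k.+1 by rewrite /e exprS invfM; field; rewrite expf_neq0.
have aS k : - e k.+1 <= a k.+1 - a k <= e k.+1.
  rewrite -ler_norml; apply: le_trans (aK k) _.
  by rewrite /e exprS invfM le_eqVlt; apply/orP; left; apply/eqP; field; rewrite expf_neq0.
have lo : {homo (fun k => a k - e k) : n m / (n <= m)%N >-> n <= m}.
  by apply/nondecreasing_seqP => k; have /andP[? ?] := aS k; rewrite (eS k); lra.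
have up : {homo (fun k => - (a k + e k)) : n m / (n <= m)%N >-> n <= m}.
  by apply/nondecreasing_seqP => k; have /andP[? ?] := aS k; rewrite (eS k); lra.
have le_lu m n : a m - e m <= a n + e n.
  apply: le_trans (lo _ _ (leq_maxl m n)) _.
  have := up _ _ (leq_maxr m n); have := e0 (maxn m n); lra.
pose S := range (fun k => a k - e k).
have hS : has_sup S.
  split; first by exists (a 0%N - e 0%N), 0%N.
  by exists (a 0%N + e 0%N) => _ [m _ <-].
exists (sup S) => k; rewrite -/(e k) ler_norml.
have h1 : a k - e k <= sup S by apply: ub_le_sup hS.2 _ _; exists k.
have h2 : sup S <= a k + e k by apply: ge_sup hS.1 _ => _ [m _ <-].
by apply/andP; split; lra.
Qed.

End RealPrimitives.

Section Rows.
Context {R : realType} {n : nat}.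

Lemma normr_entry (x : 'rV[R]_n.+1) i : `|x 0 i| <= `|x|.
Proof.
rewrite [leRHS]/Num.Def.normr /= mx_normrE.
exact: (le_bigmax 0 (fun ij => `|x ij.1 ij.2|) (0, i)).
Qed.

Lemma normr_row_le (x : 'rV[R]_n.+1) (M : R) :
  (forall i, `|x 0 i| <= M) -> `|x| <= M.
Proof.
move=> xM; rewrite [leLHS]/Num.Def.normr /= mx_normrE.
apply: bigmax_le => [|[i j] _] /=; first exact: le_trans (xM 0).
by rewrite ord1.
Qed.

Lemma is_derive_row (U : normedModType R) (f : U -> 'rV[R]_n.+1) z v (df : 'rV[R]_n.+1) :
  (forall i, is_derive z v (fun w => f w 0 i) (df 0 i)) -> is_derive z v f df.
Proof.
move=> fD; have dF : derivable f z v.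
  by apply/derivable_mxP => i j; rewrite ord1; have [] := fD j.
split=> //; rewrite derive_mx//; apply/matrixP => i j; rewrite mxE ord1.
by have [_ ->] := fD j.
Qed.

Lemma bounded_linear_entry i : bounded_linear (fun x : 'rV[R]_n.+1 => x 0 i).
Proof.
split=> [k x y|]; first by rewrite !mxE.
by exists 1 => x; rewrite mul1r normr_entry.
Qed.

Lemma has_primitives_row : has_primitives 'rV[R]_n.+1.
Proof.
move=> g cg.
have /choice[G HG] : forall i, exists G : R -> R, forall t : R,
    is_derive t 1 G (g t 0 i).
  move=> i; apply: has_primitives_R => t.
  apply: (@continuous_comp _ _ _ g (fun x : 'rV_n.+1 => x 0 i)); first exact: cg.
  exact: continuous_of_bounded_linear (bounded_linear_entry i).
exists (fun t => \row_i G i t) => t; apply: is_derive_row => i.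
by rewrite (_ : (fun w => _) = G i)//; apply/funext => w; rewrite mxE.
Qed.

Lemma geometrically_complete_row : geometrically_complete 'rV[R]_n.+1.
Proof.
move=> a K aK.
have /choice[l Hl] : forall i, exists l : R, forall k,
    `|l - a k 0 i| <= 2 * K / 2 ^+ k.
  move=> i; apply: (geometrically_complete_R (a := fun k => a k 0 i)) => k.
  apply: le_trans (aK k); have := normr_entry (a k.+1 - a k) i.
  by rewrite !mxE.
exists (\row_i l i) => k; apply: normr_row_le => i; rewrite !mxE; exact: Hl.
Qed.

End Rows.

Section Products.
Context {R : realType} (U V : normedModType R).

Lemma bounded_linear_fst : bounded_linear (fst : U * V -> U).
Proof. by split=> //; exists 1 => x; rewrite mul1r normr_fst. Qed.

Lemma bounded_linear_snd : bounded_linear (snd : U * V -> V).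
Proof. by split=> //; exists 1 => x; rewrite mul1r normr_snd. Qed.

Lemma has_primitives_pair : has_primitives U -> has_primitives V ->
  has_primitives (U * V)%type.
Proof.
move=> pU pV g cg.
have [|G1 H1] := pU (fst \o g).
  move=> t; apply: continuous_comp; first exact: cg.
  exact: continuous_of_bounded_linear bounded_linear_fst.
have [|G2 H2] := pV (snd \o g).
  move=> t; apply: continuous_comp; first exact: cg.
  exact: continuous_of_bounded_linear bounded_linear_snd.
exists (fun t => (G1 t, G2 t)) => t; rewrite [g t]surjective_pairing.
by apply: is_derive_pair.
Qed.

Lemma geometrically_complete_pair : geometrically_complete U ->
  geometrically_complete V -> geometrically_complete (U * V)%type.
Proof.
move=> cU cV a K aK.
have [|l1 H1] := cU (fst \o a) K.
  by move=> k; exact: le_trans (normr_fst _) (aK k).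
have [|l2 H2] := cV (snd \o a) K.
  by move=> k; exact: le_trans (normr_snd _) (aK k).
by exists (l1, l2) => k; rewrite prod_normE ge_max H1 H2.
Qed.

End Products.

Section QuaternionAlgebra.
Context {R : realType}.
Implicit Types (x y z : 'rV[R]_3) (p q r : quat R).

Lemma row3P x y : x 0 0 = y 0 0 -> x 0 1 = y 0 1 -> x 0 2 = y 0 2 -> x = y.
Proof.
move=> H0 H1 H2; apply/rowP => -[[|[|[|//]]] lt_i].
- by rewrite (_ : Ordinal lt_i = 0)//; exact: val_inj.
- by rewrite (_ : Ordinal lt_i = 1)//; exact: val_inj.
- by rewrite (_ : Ordinal lt_i = 2)//; exact: val_inj.
Qed.

Lemma dotE x y : dot x y = x 0 0 * y 0 0 + x 0 1 * y 0 1 + x 0 2 * y 0 2.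
Proof.
rewrite /dot !big_ord_recl big_ord0 addr0 addrA.
by congr (_ * _ + _ * _ + _ * _); congr (_ 0 _); exact: val_inj.
Qed.

Lemma cross0 x y : cross x y 0 0 = x 0 1 * y 0 2 - x 0 2 * y 0 1.
Proof. by rewrite mxE !add0r. Qed.

Lemma cross1 x y : cross x y 0 1 = x 0 2 * y 0 0 - x 0 0 * y 0 2.
Proof.
rewrite mxE (_ : 1 + 1 = 2 :> 'I_3)//.
by rewrite (_ : 1 + 2 = 0 :> 'I_3)//; exact: val_inj.
Qed.

Lemma cross2 x y : cross x y 0 2 = x 0 0 * y 0 1 - x 0 1 * y 0 0.
Proof.
rewrite mxE (_ : 2 + 1 = 0 :> 'I_3); last exact: val_inj.
by rewrite (_ : 2 + 2 = 1 :> 'I_3)//; exact: val_inj.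
Qed.

Definition quat_coordE := (dotE, cross0, cross1, cross2).

Lemma quatP p q : p.1 = q.1 -> p.2 = q.2 -> p = q.
Proof. by case: p q => [a x] [b y] /= -> ->. Qed.

Definition qone : quat R := (1, 0).
Definition qconj p : quat R := (p.1, - p.2).

Ltac quat_ring :=
  apply: quatP => /=; [|apply: row3P]; rewrite /= !(quat_coordE, mxE) /=; ring.

Lemma qmulA p q r : p *q (q *q r) = (p *q q) *q r.
Proof. by quat_ring. Qed.

Lemma qmul1q p : qone *q p = p.
Proof. by quat_ring. Qed.

Lemma qmulq1 p : p *q qone = p.
Proof. by quat_ring. Qed.

Lemma qconjM p q : qconj (p *q q) = qconj q *q qconj p.
Proof. by quat_ring. Qed.

Lemma qconjK p : qconj (qconj p) = p.
Proof. by case: p => a x; rewrite /qconj /= opprK. Qed.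

Lemma qmul_conj p : p *q qconj p = (qnorm2 p, 0).
Proof.
by rewrite /qnorm2; quat_ring.
Qed.

Lemma qconj_mul p : qconj p *q p = (qnorm2 p, 0).
Proof.
by rewrite /qnorm2; quat_ring.
Qed.

Lemma qnorm2M p q : qnorm2 (p *q q) = qnorm2 p * qnorm2 q.
Proof. by rewrite /qnorm2 /= !(quat_coordE, mxE) /=; ring. Qed.

Lemma qnorm2_conj p : qnorm2 (qconj p) = qnorm2 p.
Proof. by rewrite /qnorm2 /= !(quat_coordE, mxE) /=; ring. Qed.

Lemma qnorm2_one : qnorm2 qone = 1.
Proof. by rewrite /qnorm2 /= !(quat_coordE, mxE) /=; ring. Qed.

Lemma qinv_unit p : S3 p -> qinv p = qconj p.
Proof. by rewrite /S3 /= /qinv => ->; rewrite invr1 scale1r. Qed.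

Lemma qmulqV p : S3 p -> p *q qinv p = qone.
Proof. by move=> Sp; rewrite qinv_unit// qmul_conj Sp. Qed.

Lemma qmulVq p : S3 p -> qinv p *q p = qone.
Proof. by move=> Sp; rewrite qinv_unit// qconj_mul Sp. Qed.

Lemma S3_mul p q : S3 p -> S3 q -> S3 (p *q q).
Proof. by rewrite /S3 /= qnorm2M => -> ->; rewrite mulr1. Qed.

Lemma S3_inv p : S3 p -> S3 (qinv p).
Proof. by move=> Sp; rewrite qinv_unit// /S3 /= qnorm2_conj. Qed.

Lemma S3_one : S3 qone. Proof. exact: qnorm2_one. Qed.

Lemma qmulKV p q : S3 p -> p *q (qinv p *q q) = q.
Proof. by move=> Sp; rewrite qmulA qmulqV// qmul1q. Qed.

Lemma qmulVK p q : S3 p -> qinv p *q (p *q q) = q.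
Proof. by move=> Sp; rewrite qmulA qmulVq// qmul1q. Qed.

Lemma qmul_injl p q r : S3 p -> p *q q = p *q r -> q = r.
Proof. by move=> Sp E; rewrite -(qmulVK q Sp) E qmulVK. Qed.

Lemma im_commutator x y :
  im x *q im y - im y *q im x = im (2 *: cross x y).
Proof.
by quat_ring.
Qed.

Lemma qconj_real_part p q : S3 p -> (p *q q *q qinv p).1 = q.1.
Proof.
move=> Sp; rewrite qinv_unit//; move: Sp; rewrite /S3 /= /qnorm2 !(quat_coordE, mxE) /=.
by move=> n1; rewrite -[RHS]mulr1 -n1; ring.
Qed.

End QuaternionAlgebra.

Section QuaternionCalculus.
Context {R : realType}.

Lemma normr_dot (x y : 'rV[R]_3) : `|dot x y| <= 3 * (`|x| * `|y|).
Proof.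
have H i : `|x 0 i * y 0 i| <= `|x| * `|y|.
  by rewrite normrM; apply: ler_pM => //; exact: normr_entry.
rewrite dotE; apply: le_trans (ler_normD _ _) _.
apply: le_trans (lerD (ler_normD _ _) (lexx _)) _.
by have := H 0; have := H 1; have := H 2; lra.
Qed.

Lemma normr_cross (x y : 'rV[R]_3) : `|cross x y| <= 2 * (`|x| * `|y|).
Proof.
have H i j : `|x 0 i * y 0 j| <= `|x| * `|y|.
  by rewrite normrM; apply: ler_pM => //; exact: normr_entry.
apply: normr_row_le => i; rewrite mxE; apply: le_trans (ler_normB _ _) _.
by have := H (i + 1) (i + 2); have := H (i + 2) (i + 1); lra.
Qed.

Lemma bounded_bilinear_qmul : bounded_bilinear (@qmul R).
Proof.
split=> [k x x' y|k x y y'|].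
- by apply: quatP => /=; [|apply: row3P]; rewrite /= !(quat_coordE, mxE) /= /GRing.scale /=; ring.
- by apply: quatP => /=; [|apply: row3P]; rewrite /= !(quat_coordE, mxE) /= /GRing.scale /=; ring.
exists 4 => // x y.
have nM (u v : R) : 0 <= u -> u <= `|x| -> 0 <= v -> v <= `|y| -> u * v <= `|x| * `|y|.
  by move=> *; exact: ler_pM.
have n11 := nM _ _ (normr_ge0 x.1) (normr_fst x) (normr_ge0 y.1) (normr_fst y).
have n12 := nM _ _ (normr_ge0 x.1) (normr_fst x) (normr_ge0 y.2) (normr_snd y).
have n21 := nM _ _ (normr_ge0 x.2) (normr_snd x) (normr_ge0 y.1) (normr_fst y).
have n22 := nM _ _ (normr_ge0 x.2) (normr_snd x) (normr_ge0 y.2) (normr_snd y).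
rewrite prod_normE ge_max /=; apply/andP; split.
  apply: le_trans (ler_normB _ _) _; rewrite normrM.
  have := normr_dot x.2 y.2; lra.
apply: le_trans (ler_normD _ _) _.
apply: le_trans (lerD (ler_normD _ _) (lexx _)) _; rewrite !normrZ.
have := normr_cross x.2 y.2; lra.
Qed.

(** The connection whose parallel maps with real part 1 are the primitives of
    the imaginary part of the form. *)
Definition qprimitive (y a : quat R) : quat R := (0, y.1 *: a.2).

Lemma bounded_bilinear_qprimitive : bounded_bilinear qprimitive.
Proof.
split=> [k x x' y|k x y y'|].
- apply: quatP; rewrite /= ?mulr0 ?addr0 ?scaler0//.
  by rewrite scalerDl scalerA.
- apply: quatP; rewrite /= ?mulr0 ?addr0 ?scaler0//.
  by rewrite scalerDr !scalerA mulrC.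
exists 1 => // x y; rewrite mul1r prod_normE normr0 ge_max mulr_ge0//= normrZ.
by rewrite ler_pM ?normr_fst ?normr_snd.
Qed.

Lemma has_primitives_quat : has_primitives (quat R).
Proof. exact: has_primitives_pair has_primitives_R has_primitives_row. Qed.

Lemma geometrically_complete_quat : geometrically_complete (quat R).
Proof.
exact: geometrically_complete_pair geometrically_complete_R geometrically_complete_row.
Qed.

Lemma bounded_linear_im : bounded_linear (@im R).
Proof.
split=> [k x y|]; first by apply: quatP; rewrite /= ?scaler0 ?mulr0 ?addr0.
by exists 1 => x; rewrite mul1r prod_normE normr0 ge_max normr_ge0 lexx.
Qed.

Lemma bounded_linear_qconj : bounded_linear (@qconj R).
Proof.
split=> [k x y|]; first by apply: quatP; rewrite //= opprD scalerN.
by exists 1 => x; rewrite mul1r !prod_normE /= normrN.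
Qed.

Lemma im_inj (x y : 'rV[R]_3) : im x = im y -> x = y.
Proof. by case. Qed.

Lemma im_of_real_part0 (p : quat R) : p.1 = 0 -> im p.2 = p.
Proof. by move=> p0; apply: quatP. Qed.

Lemma qconj_im (p : quat R) : p.1 = 0 -> qconj p = - p.
Proof. by move=> p0; apply: quatP; rewrite //= p0 oppr0. Qed.

End QuaternionCalculus.

Section LinearMaps.
Context {R : realType}.
Implicit Types U V W : normedModType R.

Lemma bounded_linear_comp U V W (L : V -> W) (L' : U -> V) :
  bounded_linear L -> bounded_linear L' -> bounded_linear (L \o L').
Proof.
move=> [Ll [K LK]] [Ll' [K' LK']]; split=> [k x y /=|].
  by rewrite Ll' Ll.
exists (`|K| * K') => x /=; apply: le_trans (LK _) _; rewrite -mulrA.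
apply: le_trans (_ : `|K| * `|L' x| <= _); first by rewrite ler_wpM2r// ler_norm.
by rewrite ler_wpM2l.
Qed.

Lemma bounded_linear_left U V W (b : U -> V -> W) y :
  bounded_bilinear b -> bounded_linear (b ^~ y).
Proof.
move=> [bl _ [K K0 bK]]; split=> [k x x'|]; first exact: bl.
by exists (K * `|y|) => x; rewrite mulrAC.
Qed.

Lemma bounded_linear_right U V W (b : U -> V -> W) x :
  bounded_bilinear b -> bounded_linear (b x).
Proof.
by move=> [_ br [K K0 bK]]; split=> [k y y'|]; [exact: br | exists (K * `|x|)].
Qed.

Lemma bounded_linear_comb V (k l : R) :
  bounded_linear (fun x : V * V => k *: x.1 + l *: x.2).
Proof.
split=> [h x y /=|].
  by rewrite !scalerDr !scalerA (mulrC h k) (mulrC h l) addrACA.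
exists (`|k| + `|l|) => x; apply: le_trans (ler_normD _ _) _; rewrite !normrZ mulrDl.
by rewrite lerD// ler_wpM2l ?normr_fst ?normr_snd.
Qed.

Lemma is_derive_comb U V (f g : U -> V) z v df dg (k l : R) :
  is_derive z v f df -> is_derive z v g dg ->
  is_derive z v (fun w => k *: f w + l *: g w) (k *: df + l *: dg).
Proof.
move=> fD gD.
exact: (is_derive_linear (bounded_linear_comb V k l) (is_derive_pair fD gD)).
Qed.

Lemma Cinfty_comb (D : set (R * R)) V (f g : R * R -> V) (k l : R) : open D ->
  Cinfty D f -> Cinfty D g -> Cinfty D (fun w => k *: f w + l *: g w).
Proof.
move=> oD cf cg n.
exact: (Cn_linear oD (bounded_linear_comb V k l) (Cn_pair oD (cf n) (cg n))).
Qed.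

Lemma Cinfty_linear (D : set (R * R)) V W (L : V -> W) (f : R * R -> V) : open D ->
  bounded_linear L -> Cinfty D f -> Cinfty D (fun w => L (f w)).
Proof. by move=> oD bL cf n; exact: Cn_linear. Qed.

Lemma Cinfty_bilinear (D : set (R * R)) U V W (b : U -> V -> W) f g : open D ->
  bounded_bilinear b -> Cinfty D f -> Cinfty D g ->
  Cinfty D (fun w => b (f w) (g w)).
Proof. by move=> oD bb cf cg n; apply: Cn_bilinear. Qed.

End LinearMaps.

Section MaurerCartan.
Context {R : realType}.
Notation e1 := ((1, 0) : R * R).
Notation e2 := ((0, 1) : R * R).
Let bq := @bounded_bilinear_qmul R.

Lemma commutator_of_mixed (p a b x y : quat R) : S3 p ->
  (p *q b) *q a + p *q x = (p *q a) *q b + p *q y -> x - y = a *q b - b *q a.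
Proof.
move=> Sp H; rewrite -[LHS](qmulVK _ Sp) -[RHS](qmulVK _ Sp); congr (_ *q _).
rewrite !(bilBr bq) !qmulA.
apply/eqP; rewrite -subr_eq0; apply/eqP; move/eqP: H; rewrite -subr_eq0 => /eqP <-.
lin_module R (quat R).
Qed.

Lemma mixed_of_commutator (a b x y p : quat R) : x - y = a *q b - b *q a ->
  p *q x + (p *q b) *q a = p *q y + (p *q a) *q b.
Proof.
move=> H; have -> : x = y + (a *q b - b *q a) by rewrite -H addrCA subrr addr0.
rewrite (bilDr bq) (bilBr bq) !qmulA; lin_module R (quat R).
Qed.

Lemma commutator_comb (k l m n : R) (u v : quat R) :
  (k *: u + l *: v) *q (m *: u + n *: v) - (m *: u + n *: v) *q (k *: u + l *: v) =
  (k * n - l * m) *: (u *q v - v *q u).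
Proof.
rewrite !(bilDl bq) !(bilDr bq) !(bilZl bq) !(bilZr bq).
move: (u *q u) (u *q v) (v *q u) (v *q v) => a b c d.
lin_module R (quat R).
Qed.

(** The Maurer-Cartan equation of the product of the form [a du + b dv] with the
    complex number [m + i n]; the letters [u] and [v] stand for derivatives.
    Its commutator is multiplied by the determinant of the rotation, and its
    exterior derivative mixes the curl and the divergence of the form. *)
Lemma maurer_cartan_product (a b au av bu bv : quat R) (m n : R) :
  (m *: av + (- n) *: bv) - (n *: au + m *: bu) =
    (m *: a + (- n) *: b) *q (n *: a + m *: b) -
    (n *: a + m *: b) *q (m *: a + (- n) *: b) <->
  m *: (av - bu) - n *: (au + bv) = (m ^+ 2 + n ^+ 2) *: (a *q b - b *q a).
Proof.
rewrite commutator_comb (_ : m * m - (- n) * n = m ^+ 2 + n ^+ 2); last by ring.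
set lhs := (X in X = _ <-> _); set lhs' := (X in _ <-> X = _).
by have -> : lhs = lhs' by rewrite /lhs /lhs'; lin_module R (quat R).
Qed.

Definition maurer_cartan (A B : R * R -> quat R) (z : R * R) : Prop :=
  'D_e2 A z - 'D_e1 B z = A z *q B z - B z *q A z.

(** Both sides of [P_uv = P_vu] are expanded and [P] is cancelled on the left. *)
Lemma maurer_cartan_of_potential (D : set (R * R)) (P A B : R * R -> quat R) z :
  open D -> Cinfty D P -> Cinfty D A -> Cinfty D B ->
  (forall z, D z -> S3 (P z)) ->
  (forall z, D z -> 'D_e1 P z = P z *q A z) ->
  (forall z, D z -> 'D_e2 P z = P z *q B z) ->
  D z -> maurer_cartan A B z.
Proof.
move=> oD cP cA cB P1 Pu Pv Dz.
have nD (f g : R * R -> quat R) : (forall w, D w -> f w = g w) ->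
    \forall w \near z, f w = g w.
  by move=> fg; apply: (filterS (P := D)) => [w|]; [exact: fg | exact: open_nbhs_nbhs].
have E1 : 'D_e2 ('D_e1 P) z = (P z *q B z) *q A z + P z *q 'D_e2 A z.
  rewrite (near_eq_derive e2 (nD _ _ Pu)) -(Pv z Dz).
  by have [_ H] := is_derive_bilinear bq (Cinfty_dv cP Dz) (Cinfty_dv cA Dz); exact: H.
have E2 : 'D_e1 ('D_e2 P) z = (P z *q A z) *q B z + P z *q 'D_e1 B z.
  rewrite (near_eq_derive e1 (nD _ _ Pv)) -(Pu z Dz).
  by have [_ H] := is_derive_bilinear bq (Cinfty_du cP Dz) (Cinfty_du cB Dz); exact: H.
exact: commutator_of_mixed (P1 z Dz)
  (etrans (esym E1) (etrans (Cinfty_mixed oD cP Dz) E2)).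
Qed.

Lemma maurer_cartan_flat A B z y : maurer_cartan A B z ->
  y *q 'D_e2 A z + (y *q B z) *q A z = y *q 'D_e1 B z + (y *q A z) *q B z.
Proof. exact: mixed_of_commutator. Qed.

End MaurerCartan.

(** * Forms and derivatives on a Riemann surface *)

Section SurfaceCalculus.
Context {R : realType} {M : riemannSurface R}.
Notation e1 := ((1, 0) : R * R).
Notation e2 := ((0, 1) : R * R).
Implicit Types (c d : @chart R M) (x : M) (V W : normedModType R).

Definition chart_smooth V c (F : M -> V) := Cinfty (cimg c) (F \o param c).

Lemma partial_u_is_derive V c (F : M -> V) x : chart_smooth c F -> cdom c x ->
  is_derive (coord c x) e1 (F \o param c) (partial_u c F x).
Proof. by move=> cF cx; exact: Cinfty_du cF (cimg_coord cx). Qed.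

Lemma partial_v_is_derive V c (F : M -> V) x : chart_smooth c F -> cdom c x ->
  is_derive (coord c x) e2 (F \o param c) (partial_v c F x).
Proof. by move=> cF cx; exact: Cinfty_dv cF (cimg_coord cx). Qed.

Lemma partial_u_param V c (F : M -> V) z :
  cimg c z -> partial_u c F (param c z) = 'D_e1 (F \o param c) z.
Proof. by move=> cz; rewrite /partial_u paramK. Qed.

Lemma partial_v_param V c (F : M -> V) z :
  cimg c z -> partial_v c F (param c z) = 'D_e2 (F \o param c) z.
Proof. by move=> cz; rewrite /partial_v paramK. Qed.

Lemma partial_uE V c (F : M -> V) x D :
  is_derive (coord c x) e1 (F \o param c) D -> partial_u c F x = D.
Proof. by case. Qed.

Lemma partial_vE V c (F : M -> V) x D :
  is_derive (coord c x) e2 (F \o param c) D -> partial_v c F x = D.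
Proof. by case. Qed.

Lemma near_chart_eq V c (F G : M -> V) x : cdom c x ->
  (forall y, cdom c y -> F y = G y) ->
  \forall z \near coord c x, (F \o param c) z = (G \o param c) z.
Proof.
move=> cx FG; have : \forall z \near coord c x, cimg c z.
  by apply: open_nbhs_nbhs; split; [exact: open_cimg | exact: cimg_coord].
by apply: filterS => z cz; exact/FG/param_cdom.
Qed.

Lemma partial_u_ext V c (F G : M -> V) x : cdom c x ->
  (forall y, cdom c y -> F y = G y) -> partial_u c F x = partial_u c G x.
Proof. by move=> cx FG; exact: near_eq_derive (near_chart_eq cx FG). Qed.

Lemma partial_v_ext V c (F G : M -> V) x : cdom c x ->
  (forall y, cdom c y -> F y = G y) -> partial_v c F x = partial_v c G x.
Proof. by move=> cx FG; exact: near_eq_derive (near_chart_eq cx FG). Qed.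

Lemma chart_smooth_ext V c (F G : M -> V) : (forall y, cdom c y -> F y = G y) ->
  chart_smooth c F -> chart_smooth c G.
Proof.
move=> FG; apply: Cinfty_ext => [|z cz]; first exact: open_cimg.
exact/FG/param_cdom.
Qed.

Lemma chart_smooth_partial_u V c (F : M -> V) :
  chart_smooth c F -> chart_smooth c (partial_u c F).
Proof.
move=> cF; apply: Cinfty_ext (Cinfty_Du cF) => [|z cz]; first exact: open_cimg.
by rewrite /partial_u /= paramK.
Qed.

Lemma chart_smooth_partial_v V c (F : M -> V) :
  chart_smooth c F -> chart_smooth c (partial_v c F).
Proof.
move=> cF; apply: Cinfty_ext (Cinfty_Dv cF) => [|z cz]; first exact: open_cimg.
by rewrite /partial_v /= paramK.
Qed.

Lemma partial_mixed V c (F : M -> V) x : chart_smooth c F -> cdom c x ->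
  partial_v c (partial_u c F) x = partial_u c (partial_v c F) x.
Proof.
move=> cF cx; have Dx := cimg_coord cx; have oD : open (cimg c) by exact: open_cimg.
have nz : \forall z \near coord c x, cimg c z by exact: open_nbhs_nbhs.
have n1 : \forall z \near coord c x, (partial_u c F \o param c) z = 'D_e1 (F \o param c) z.
  by apply: filterS nz => z cz; rewrite /partial_u /= paramK.
have n2 : \forall z \near coord c x, (partial_v c F \o param c) z = 'D_e2 (F \o param c) z.
  by apply: filterS nz => z cz; rewrite /partial_v /= paramK.
have E1 : partial_v c (partial_u c F) x = 'D_e2 ('D_e1 (F \o param c)) (coord c x).
  exact: near_eq_derive e2 n1.
have E2 : partial_u c (partial_v c F) x = 'D_e1 ('D_e2 (F \o param c)) (coord c x).
  exact: near_eq_derive e1 n2.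
exact: (etrans E1 (etrans (Cinfty_mixed oD cF Dx) (esym E2))).
Qed.

Lemma chart_smooth_linear V W (L : V -> W) c (F : M -> V) : bounded_linear L ->
  chart_smooth c F -> chart_smooth c (fun x => L (F x)).
Proof. by move=> bL cF; exact: (Cinfty_linear (@open_cimg R M c) bL cF). Qed.

Lemma partial_u_linear V W (L : V -> W) c (F : M -> V) x : bounded_linear L ->
  chart_smooth c F -> cdom c x -> partial_u c (fun x => L (F x)) x = L (partial_u c F x).
Proof.
move=> bL cF cx; apply: partial_uE.
exact: (is_derive_linear bL (partial_u_is_derive cF cx)).
Qed.

Lemma partial_v_linear V W (L : V -> W) c (F : M -> V) x : bounded_linear L ->
  chart_smooth c F -> cdom c x -> partial_v c (fun x => L (F x)) x = L (partial_v c F x).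
Proof.
move=> bL cF cx; apply: partial_vE.
exact: (is_derive_linear bL (partial_v_is_derive cF cx)).
Qed.

Lemma partial_u_comb V c (F G : M -> V) x (k l : R) :
  chart_smooth c F -> chart_smooth c G -> cdom c x ->
  partial_u c (fun x => k *: F x + l *: G x) x =
    k *: partial_u c F x + l *: partial_u c G x.
Proof.
move=> cF cG cx; apply: partial_uE.
exact: (is_derive_comb k l (partial_u_is_derive cF cx) (partial_u_is_derive cG cx)).
Qed.

Lemma partial_v_comb V c (F G : M -> V) x (k l : R) :
  chart_smooth c F -> chart_smooth c G -> cdom c x ->
  partial_v c (fun x => k *: F x + l *: G x) x =
    k *: partial_v c F x + l *: partial_v c G x.
Proof.
move=> cF cG cx; apply: partial_vE.
exact: (is_derive_comb k l (partial_v_is_derive cF cx) (partial_v_is_derive cG cx)).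
Qed.

Lemma smooth_linear V W (L : V -> W) (F : M -> V) : bounded_linear L ->
  smooth F -> smooth (fun x => L (F x)).
Proof. by move=> bL sF c hc; exact: chart_smooth_linear bL (sF c hc). Qed.

Lemma differential_form V (F : M -> V) : smooth F ->
  smooth_form (fun c => partial_u c F) (fun c => partial_v c F).
Proof.
move=> sF; split=> [c hc|c d x hc Ad cx dx].
  by split; [apply: chart_smooth_partial_u | apply: chart_smooth_partial_v]; exact: sF.
exact: smooth_transition.
Qed.

Lemma form_linear V W (L : V -> W) (al be : @chart R M -> M -> V) : bounded_linear L ->
  smooth_form al be -> smooth_form (fun c x => L (al c x)) (fun c x => L (be c x)).
Proof.
move=> bL [sm tr]; split=> [c hc|c d x hc Ad cx dx a].
  have [sa sb] := sm c hc.
  by split; apply: (chart_smooth_linear bL).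
have [-> ->] := tr c d x hc Ad cx dx.
have LD k l u v : L (k *: u + l *: v) = k *: L u + l *: L v.
  have L0 : L 0 = 0.
    by apply: (addrI (L 0)); rewrite -{1}[L 0]scale1r -bL.1 scale1r !addr0.
  by rewrite bL.1 -[l *: v]addr0 bL.1 L0 addr0.
by rewrite !LD.
Qed.

(** By the Cauchy-Riemann equations the transition matrices act on [al + i be] by
    complex multiplications, which commute with the multiplication by
    [m + i n]. *)
Lemma form_rotation V (al be : @chart R M -> M -> V) (m n : R) : smooth_form al be ->
  smooth_form (fun c x => m *: al c x + (- n) *: be c x)
              (fun c x => n *: al c x + m *: be c x).
Proof.
move=> [sm tr]; split=> [c hc|c d x hc Ad cx dx a].
  have [sa sb] := sm c hc.
  by split; apply: (Cinfty_comb _ _ (@open_cimg R M c)).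
have [-> ->] := tr c d x hc Ad cx dx; rewrite -/a.
by split; lin_module R V.
Qed.

(** Such a map is parallel for the zero form, like the constant maps. *)
Lemma constant_of_zero_differential V (F : M -> V) :
  (forall c, atlas c -> forall x, cdom c x ->
     is_derive (coord c x) e1 (F \o param c) 0 /\
     is_derive (coord c x) e2 (F \o param c) 0) ->
  forall x y, F x = F y.
Proof.
move=> F0 x y; apply/esym; move: y.
pose b0 (_ _ : V) : V := 0.
have bb : bounded_bilinear b0.
  split=> [k u u' v|k u v v'|]; rewrite /b0 ?scaler0 ?addr0//.
  by exists 1 => // u v; rewrite normr0 mul1r mulr_ge0.
pose z0 (_ : @chart R M) (_ : M) : V := 0.
have sf : smooth_form z0 z0.
  split=> [c _|c d z _ _ _ _]; last by rewrite /z0 !scaler0 addr0.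
  by split=> n; apply: Cn_cst; exact: open_cimg.
apply: (parallel_eq bb (x0 := x) sf) => //.
by move=> c Ac z cz; split; exact: is_derive_cst.
Qed.

Lemma constant_difference V (F G : M -> V) : smooth F -> smooth G ->
  (forall c, atlas c -> forall x, cdom c x ->
     partial_u c F x = partial_u c G x /\ partial_v c F x = partial_v c G x) ->
  forall x y, F x - G x = F y - G y.
Proof.
move=> sF sG FG; apply: (constant_of_zero_differential (F := fun x => F x - G x)).
move=> c Ac x cx; have hc := atlas_holomorphic Ac; have [Eu Ev] := FG c Ac x cx.
split.
  rewrite -(subrr (partial_u c F x)) {2}Eu.
  exact: is_derive_sub (partial_u_is_derive (sF c hc) cx) (partial_u_is_derive (sG c hc) cx).
rewrite -(subrr (partial_v c F x)) {2}Ev.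
exact: is_derive_sub (partial_v_is_derive (sF c hc) cx) (partial_v_is_derive (sG c hc) cx).
Qed.

End SurfaceCalculus.

Section LogarithmicDerivative.
Context {R : realType} {M : riemannSurface R}.
Notation e1 := ((1, 0) : R * R).
Notation e2 := ((0, 1) : R * R).
Implicit Types (c d : @chart R M) (x : M) (f : M -> quat R).
Let bq := @bounded_bilinear_qmul R.

Lemma real_part_eq0 (p : quat R) : qconj p + p = 0 -> p.1 = 0.
Proof. by move=> /(congr1 fst) /=; lra. Qed.

Lemma qmul_combr (p u v : quat R) (k l : R) :
  p *q (k *: u + l *: v) = k *: (p *q u) + l *: (p *q v).
Proof. by rewrite (bilDr bq) !(bilZr bq). Qed.

(** The components of [f^-1 df], the pullback by [f] of the left invariant
    Maurer-Cartan form. *)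
Definition logd_u f c x := qinv (f x) *q partial_u c f x.
Definition logd_v f c x := qinv (f x) *q partial_v c f x.

Definition maurer_cartan_form (A B : @chart R M -> M -> quat R) :=
  forall c, holomorphic_coordinate c -> forall x, cdom c x ->
    partial_v c (A c) x - partial_u c (B c) x =
      A c x *q B c x - B c x *q A c x.

Lemma maurer_cartan_formP (A B : @chart R M -> M -> quat R) c x : cdom c x ->
  maurer_cartan (A c \o param c) (B c \o param c) (coord c x) <->
  partial_v c (A c) x - partial_u c (B c) x = A c x *q B c x - B c x *q A c x.
Proof. by move=> cx; rewrite /maurer_cartan /= coordK. Qed.

Lemma maurer_cartan_form_flat A B : maurer_cartan_form A B -> flat_form (@qmul R) A B.
Proof.
move=> mc c hc z y cz; have cx := param_cdom cz.
have := (maurer_cartan_formP A B cx).2 (mc c hc _ cx); rewrite paramK//.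
exact: maurer_cartan_flat.
Qed.

Lemma chart_smooth_bilinear (b : quat R -> quat R -> quat R) c f (g : M -> quat R) :
  bounded_bilinear b -> chart_smooth c f -> chart_smooth c g ->
  chart_smooth c (fun x => b (f x) (g x)).
Proof. by move=> bb cf cg; exact: (Cinfty_bilinear (@open_cimg R M c) bb cf cg). Qed.

Section UnitMap.
Variable f : M -> quat R.
Hypotheses (sf : smooth f) (f1 : forall x, S3 (f x)).

Lemma logd_uE c x : partial_u c f x = f x *q logd_u f c x.
Proof. by rewrite /logd_u qmulKV. Qed.

Lemma logd_vE c x : partial_v c f x = f x *q logd_v f c x.
Proof. by rewrite /logd_v qmulKV. Qed.

Lemma logd_form : smooth_form (logd_u f) (logd_v f).
Proof.
split=> [c hc|c d x hc Ad cx dx].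
  have cf := sf hc; have cc : chart_smooth c (fun x => qconj (f x)).
    exact: chart_smooth_linear (@bounded_linear_qconj R) cf.
  split.
    apply: (@chart_smooth_ext _ _ _ c (fun x => qconj (f x) *q partial_u c f x)).
      by move=> y _; rewrite /logd_u qinv_unit.
    by apply: chart_smooth_bilinear => //; exact: chart_smooth_partial_u.
  apply: (@chart_smooth_ext _ _ _ c (fun x => qconj (f x) *q partial_v c f x)).
    by move=> y _; rewrite /logd_v qinv_unit.
  by apply: chart_smooth_bilinear => //; exact: chart_smooth_partial_v.
rewrite /logd_u /logd_v.
have [-> ->] := smooth_transition sf hc Ad cx dx.
by split; exact: qmul_combr.
Qed.

Lemma logd_parallel c x : holomorphic_coordinate c -> cdom c x ->
  parallel (@qmul R) (logd_u f) (logd_v f) c f x.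
Proof.
move=> hc cx; split.
  by rewrite -logd_uE; exact: partial_u_is_derive (sf hc) cx.
by rewrite -logd_vE; exact: partial_v_is_derive (sf hc) cx.
Qed.

Lemma logd_maurer_cartan : maurer_cartan_form (logd_u f) (logd_v f).
Proof.
move=> c hc x cx; have [sa sb] := logd_form.1 c hc.
refine ((maurer_cartan_formP (logd_u f) (logd_v f) cx).1 _).
apply: (maurer_cartan_of_potential (D := cimg c) (P := f \o param c) _ _ sa sb).
- exact: open_cimg.
- exact: sf.
- by move=> z _; exact: f1.
- move=> z cz; have := logd_uE c (param c z).
  by rewrite /partial_u paramK.
- move=> z cz; have := logd_vE c (param c z).
  by rewrite /partial_v paramK.
- exact: cimg_coord.
Qed.

(** The tangent space of the 3-sphere at 1 consists of the imaginary
    quaternions. *)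
Lemma logd_real_part c x : holomorphic_coordinate c -> cdom c x ->
  (logd_u f c x).1 = 0 /\ (logd_v f c x).1 = 0.
Proof.
move=> hc cx; have cf := sf hc.
have key (D : quat R) v : is_derive (coord c x) v (f \o param c) D ->
    (qinv (f x) *q D).1 = 0.
  move=> fD; set X := qinv (f x) *q D.
  have H := is_derive_bilinear bq (is_derive_linear (@bounded_linear_qconj R) fD) fD.
  have nE : \forall z \near coord c x, qone =
      qconj ((f \o param c) z) *q (f \o param c) z.
    by near=> z; rewrite -qinv_unit ?qmulVq//; exact: f1.
  have H0 : is_derive (coord c x) v
    (fun z => qconj ((f \o param c) z) *q (f \o param c) z) (0 : quat R).
    by apply: near_eq_is_derive nE _; exact: is_derive_cst.
  have := etrans (esym (@derive_val _ _ _ _ _ _ _ H)) (@derive_val _ _ _ _ _ _ _ H0).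
  rewrite /comp coordK// -(qinv_unit (f1 x)).
  have -> : qconj D *q f x = qconj X by rewrite /X qconjM qinv_unit// qconjK.
  exact: real_part_eq0.
split; first exact: key (partial_u_is_derive cf cx).
exact: key (partial_v_is_derive cf cx).
Unshelve. all: by end_near. Qed.

End UnitMap.

(** Conjugation changes the sign of imaginary quaternions, so that the
    differential of [f * conj f] vanishes. *)
Lemma parallel_unit (al be : @chart R M -> M -> quat R) f x0 :
  (forall c x, atlas c -> cdom c x -> (al c x).1 = 0 /\ (be c x).1 = 0) ->
  (forall c, atlas c -> forall x, cdom c x -> parallel (@qmul R) al be c f x) ->
  S3 (f x0) -> forall x, S3 (f x).
Proof.
move=> im0 fP f1 x.
have key c (a : quat R) y v : atlas c -> cdom c y -> a.1 = 0 ->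
    is_derive (coord c y) v (f \o param c) (f y *q a) ->
    is_derive (coord c y) v ((fun x => f x *q qconj (f x)) \o param c) (0 : quat R).
  move=> Ac cy a0 fD.
  have := is_derive_bilinear bq fD (is_derive_linear (@bounded_linear_qconj R) fD).
  rewrite /= coordK// qconjM (qconj_im a0) qmulA.
  have -> : f y *q (- a) = - (f y *q a).
    by rewrite -(scaleN1r a) (bilZr bq) scaleN1r.
  have -> : - (f y *q a) *q qconj (f y) = - (f y *q a *q qconj (f y)).
    by rewrite -(scaleN1r (f y *q a)) (bilZl bq) scaleN1r.
  by rewrite subrr.
have H := @constant_of_zero_differential R M _ (fun x => f x *q qconj (f x)) _ x x0.
have {}H : f x *q qconj (f x) = f x0 *q qconj (f x0).
  apply: H => c Ac y cy; have [a0 b0] := im0 c y Ac cy; have [P1 P2] := fP c Ac y cy.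
  by split; [exact: key a0 P1 | exact: key b0 P2].
by move: H f1; rewrite !qmul_conj /S3 /= => /(congr1 fst) /= ->.
Qed.

End LogarithmicDerivative.

(** * The correspondence *)

(* From here on derivatives are only used through the lemmas above. *)
Opaque partial_u partial_v logd_u logd_v.

Section Trigonometry.
Context {R : realType}.

(** The sine of [pi / 3] and of [2 * pi / 3]. *)
Definition sqrt3_2 : R := Num.sqrt 3 / 2.

Lemma sqrt3_2_sqr : sqrt3_2 * sqrt3_2 = 3 / 4.
Proof.
have := @sqr_sqrtr R 3 (ler0n _ 3); rewrite /sqrt3_2 expr2 => H.
by move: (Num.sqrt 3) H => s H; lra.
Qed.

Lemma sqrt3V : (Num.sqrt 3)^-1 = 2 / 3 * sqrt3_2.
Proof.
have s0 : 0 < Num.sqrt 3 :> R by rewrite sqrtr_gt0.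
have H := @sqr_sqrtr R 3 (ler0n _ 3); rewrite expr2 in H.
apply: (mulfI (lt0r_neq0 s0)); rewrite mulfV ?lt0r_neq0// /sqrt3_2.
by move: (Num.sqrt 3) H {s0} => s H; lra.
Qed.

(** For [c = cos (pi / 3)], the triple angle formula reads
    [(c + 1) * (2 * c - 1) ^+ 2 = 0]. *)
Lemma cos_sin_2pi3 :
  cos (2 * pi / 3 : R) = - (1 / 2) /\ sin (2 * pi / 3 : R) = sqrt3_2.
Proof.
pose x : R := pi / 3.
have pi0 := pi_gt0 R.
have x2 : 2 * pi / 3 = x + x by rewrite /x; lra.
have x3 : x + x + x = pi by rewrite /x; lra.
have cx : 0 < cos x by apply: cos_gt0_pihalf; rewrite /x; apply/andP; split; lra.
have sx : 0 < sin x by apply: sin_gt0_pi; rewrite /x; apply/andP; split; lra.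
rewrite x2 cosD sinD; have := cospi R; rewrite -x3 !cosD sinD.
have := cos2Dsin2 x; rewrite !expr2.
have s20 : 0 < sqrt3_2 by rewrite divr_gt0// sqrtr_gt0.
have := sqrt3_2_sqr.
move: (cos x) (sin x) sqrt3_2 cx sx s20 => c s t c0 s0 t0 tt cs H.
have c2 : c = 1 / 2.
  have : (c + 1) * ((2 * c - 1) * (2 * c - 1)) = 0.
    have -> : (c + 1) * ((2 * c - 1) * (2 * c - 1)) =
      (c * c - s * s) * c - (s * c + c * s) * s + 1 + 3 * c * (c * c + s * s - 1).
      by ring.
    by rewrite H cs; ring.
  by move/eqP; rewrite !mulf_eq0 orbb => /orP[|] /eqP; lra.
rewrite c2 in cs *; split; first by lra.
have : (s - t) * (s + t) = 0 by lra.
by move/eqP; rewrite mulf_eq0 => /orP[|] /eqP; lra.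
Qed.

End Trigonometry.

Section MaurerCartanAlgebra.
Context {R : realType}.
Notation s2 := (@sqrt3_2 R).
Let s22 := @sqrt3_2_sqr R.
Variables (V : lmodType R) (X : V).

(** The hypotheses are the Maurer-Cartan equations of [A du + B dv] and of its
    product with [exp (- i pi / 3)], where [X] is the commutator.  They are two
    independent linear equations for [Av - Bu] and [Au + Bv]; in terms of the
    product with [exp (- 2 i pi / 3)] their solution says that this form is
    closed and has the divergence prescribed by the H-system. *)
Lemma rotation_closed (Au Av Bu Bv : V) : Av - Bu = X ->
  (1 / 2) *: (Av - Bu) - (- s2) *: (Au + Bv) = ((1 / 2) ^+ 2 + (- s2) ^+ 2) *: X ->
  - (1 / 2) *: Av + s2 *: Bv = - s2 *: Au + - (1 / 2) *: Bu /\
  (- (1 / 2) *: Au + s2 *: Bu) + (- s2 *: Av + - (1 / 2) *: Bv) =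
    - (4 / 3 * s2) *: X.
Proof.
have s22' := s22 => h1; rewrite h1 => h2.
have {}h1 : Av = X + Bu by rewrite -h1; lin_module R V.
have s2E : s2 *: (Au + Bv) = (1 / 2) *: X.
  have -> : s2 *: (Au + Bv) =
    (1 / 2) *: X - (- s2) *: (Au + Bv) - (1 / 2) *: X by lin_module R V.
  by rewrite h2; lin_module R V.
have {}h2 : Au = (2 / 3 * s2) *: X - Bv.
  have -> : Au = (4 / 3 * s2) *: (s2 *: (Au + Bv)) - Bv by lin_module R V.
  by rewrite s2E; lin_module R V.
by rewrite h1 h2; split; lin_module R V.
Qed.

(** Conversely, a closed form with the divergence of the H-system satisfies the
    Maurer-Cartan equation after multiplication by any [m + i sqrt3_2] of
    modulus 1. *)
Lemma closed_rotation (au av bu bv : V) (m : R) : m ^+ 2 = 1 / 4 -> av = bu ->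
  au + bv = - (4 / 3 * s2) *: X ->
  m *: (av - bu) - s2 *: (au + bv) = (m ^+ 2 + s2 ^+ 2) *: X.
Proof.
have s22' := s22 => mm -> ->; rewrite mm expr2 s22' subrr scaler0 sub0r.
lin_module R V.
Qed.

Lemma rotationK (al be A B : V) :
  al = - (1 / 2) *: A + s2 *: B -> be = - s2 *: A + - (1 / 2) *: B ->
  A = - (1 / 2) *: al + - s2 *: be /\ B = s2 *: al + - (1 / 2) *: be.
Proof. by have s22' := s22 => -> ->; split; lin_module R V. Qed.

Lemma rotationKV (al be A B : V) :
  A = - (1 / 2) *: al + - s2 *: be -> B = s2 *: al + - (1 / 2) *: be ->
  al = - (1 / 2) *: A + s2 *: B /\ be = - s2 *: A + - (1 / 2) *: B.
Proof. by have s22' := s22 => -> ->; split; lin_module R V. Qed.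

End MaurerCartanAlgebra.

Section AlmostComplexStructure.
Context {R : realType}.
Notation s2 := (@sqrt3_2 R).
Let bq := @bounded_bilinear_qmul R.
Implicit Types (p q A B G H : quat R).

(** In the left invariant frames, [J] relates the logarithmic derivatives of
    the two factors: those of the second are those of the first rotated by an
    angle of pi/3. *)
Lemma J_rotation p q A B G H : S3 p -> S3 q ->
  (p *q B, q *q H) = J (p, q) (p *q A, q *q G) <->
  G = (1 / 2) *: A + s2 *: B /\ H = - s2 *: A + (1 / 2) *: B.
Proof.
have s22 := @sqrt3_2_sqr R => Sp Sq.
have -> : J (p, q) (p *q A, q *q G) =
    (p *q ((2 / 3 * s2) *: (2 *: G - A)), q *q ((2 / 3 * s2) *: (G - 2 *: A))).
  rewrite /J sqrt3V -!qmulA !qmulVK// !(bilZr bq) !(bilBr bq) !(bilZr bq).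
  by congr pair; rewrite /= addrC.
split=> [E|[-> ->]]; last by congr pair; congr (_ *q _); lin_module R (quat R).
have E1 : p *q B = p *q ((2 / 3 * s2) *: (2 *: G - A)) := congr1 fst E.
have E2 : q *q H = q *q ((2 / 3 * s2) *: (G - 2 *: A)) := congr1 snd E.
have {}E1 : B = (2 / 3 * s2) *: (2 *: G - A).
  by rewrite -(qmulVK B Sp) E1 qmulVK.
have {}E2 : H = (2 / 3 * s2) *: (G - 2 *: A).
  by rewrite -(qmulVK H Sq) E2 qmulVK.
by rewrite E2 E1; split; lin_module R (quat R).
Qed.

End AlmostComplexStructure.

Section AlmostComplexImmersions.
Context {R : realType} {M : riemannSurface R}.
Notation s2 := (@sqrt3_2 R).
Implicit Types (c : @chart R M) (x : M).
Let bq := @bounded_bilinear_qmul R.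

Lemma real_part_comb (k l : R) (u v : quat R) :
  u.1 = 0 -> v.1 = 0 -> (k *: u + l *: v).1 = 0.
Proof. by move=> u0 v0; rewrite /= u0 v0 !scaler0 addr0. Qed.

Lemma rotation_det : - (1 / 2) * - (1 / 2) - s2 * - s2 = 1.
Proof. by rewrite !mulrN !mulNr !opprK sqrt3_2_sqr; lra. Qed.

(** The Maurer-Cartan equations of both factors of an almost complex immersion,
    the second form being a rotation of the first one. *)
Lemma rotated_curvature (a b au av bu bv G H Gv Hu : quat R) :
  G = (1 / 2) *: a + s2 *: b -> H = - s2 *: a + (1 / 2) *: b ->
  Gv = (1 / 2) *: av + s2 *: bv -> Hu = - s2 *: au + (1 / 2) *: bu ->
  av - bu = a *q b - b *q a -> Gv - Hu = G *q H - H *q G ->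
  - (1 / 2) *: av + s2 *: bv = - s2 *: au + - (1 / 2) *: bu /\
  (- (1 / 2) *: au + s2 *: bu) + (- s2 *: av + - (1 / 2) *: bv) =
    - (4 / 3 * s2) *: (a *q b - b *q a).
Proof.
move=> -> -> -> -> mc1 mc2; apply: (rotation_closed mc1).
have := maurer_cartan_product a b au av bu bv (1 / 2) (- s2).
by rewrite (opprK s2) => -[H1 _]; exact: H1.
Qed.

Lemma curvature_of_rotation (a b au av bu bv : quat R) (m : R) :
  m ^+ 2 = 1 / 4 -> av = bu -> au + bv = - (4 / 3 * s2) *: (a *q b - b *q a) ->
  (m *: av + - s2 *: bv) - (s2 *: au + m *: bu) =
  (m *: a + - s2 *: b) *q (s2 *: a + m *: b) -
  (s2 *: a + m *: b) *q (m *: a + - s2 *: b).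
Proof.
move=> mm cl He.
have := maurer_cartan_product a b au av bu bv m s2.
by move=> -[_]; apply; exact: closed_rotation.
Qed.

Lemma im_Hsystem (x y : 'rV[R]_3) :
  im (- (4 / Num.sqrt 3) *: cross x y) =
  - (4 / 3 * s2) *: (im x *q im y - im y *q im x).
Proof.
rewrite im_commutator sqrt3V; apply: quatP; rewrite /= ?scaler0// scalerA.
by congr (_ *: _); move: s2 => s; lra.
Qed.

(** Up to a factor, the difference and the sum of the left sides are the real and
    imaginary parts of [(a - i b) * (x + i y)]. *)
Lemma rotations_independent (x y : quat R) (a b : R) :
  a *: (- (1 / 2) *: x + - s2 *: y) + b *: (s2 *: x + - (1 / 2) *: y) = 0 ->
  a *: ((1 / 2) *: x + - s2 *: y) + b *: (s2 *: x + (1 / 2) *: y) = 0 ->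
  a ^+ 2 + b ^+ 2 != 0 -> x = 0 /\ y = 0.
Proof.
have s22 := @sqrt3_2_sqr R => E1 E2 n0.
have D1 : a *: x + b *: y = 0 by rewrite -[RHS]subr0 -{1}E2 -E1; lin_module R (quat R).
have ssa : s2 * s2 * a = 3 / 4 * a by rewrite s22.
have ssb : s2 * s2 * b = 3 / 4 * b by rewrite s22.
have D2 : b *: x + - a *: y = 0.
  rewrite -[RHS](scaler0 _ (4 / 3 * s2 * (1 / 2))) -[in RHS](addr0 0) -{1}E2 -E1.
  by lin_module R (quat R).
have N1 : (a ^+ 2 + b ^+ 2) *: x = 0.
  have -> : (a ^+ 2 + b ^+ 2) *: x =
    a *: (a *: x + b *: y) + b *: (b *: x + - a *: y) by lin_module R (quat R).
  by rewrite D1 D2 !scaler0 addr0.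
have N2 : (a ^+ 2 + b ^+ 2) *: y = 0.
  have -> : (a ^+ 2 + b ^+ 2) *: y =
    b *: (a *: x + b *: y) + - a *: (b *: x + - a *: y) by lin_module R (quat R).
  by rewrite D1 D2 !scaler0 addr0.
by split; apply/eqP; [move/eqP: N1 | move/eqP: N2]; rewrite scaler_eq0 (negPf n0).
Qed.

Definition factor1 (phi : M -> quat R * quat R) x := (phi x).1.
Definition factor2 (phi : M -> quat R * quat R) x := (phi x).2.

Section Factors.
Variable phi : M -> quat R * quat R.
Hypothesis H : almost_complex_immersion phi.
Notation p := (factor1 phi).
Notation q := (factor2 phi).

Lemma factor1_unit x : S3 (p x). Proof. by case: H => /(_ x)[]. Qed.
Lemma factor2_unit x : S3 (q x). Proof. by case: H => /(_ x)[]. Qed.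

Lemma smooth_immersion : smooth phi. Proof. by case: H => _ []. Qed.

Lemma smooth_factor1 : smooth p.
Proof. exact: smooth_linear (bounded_linear_fst _ _) smooth_immersion. Qed.
Lemma smooth_factor2 : smooth q.
Proof. exact: smooth_linear (bounded_linear_snd _ _) smooth_immersion. Qed.

Lemma partial_u_factors c x : holomorphic_coordinate c -> cdom c x ->
  partial_u c phi x = (p x *q logd_u p c x, q x *q logd_u q c x).
Proof.
move=> hc cx; have sphi := smooth_immersion hc.
rewrite [LHS]surjective_pairing -(logd_uE factor1_unit) -(logd_uE factor2_unit).
by rewrite -(partial_u_linear (bounded_linear_fst _ _) sphi cx)
  -(partial_u_linear (bounded_linear_snd _ _) sphi cx).
Qed.

Lemma partial_v_factors c x : holomorphic_coordinate c -> cdom c x ->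
  partial_v c phi x = (p x *q logd_v p c x, q x *q logd_v q c x).
Proof.
move=> hc cx; have sphi := smooth_immersion hc.
rewrite [LHS]surjective_pairing -(logd_vE factor1_unit) -(logd_vE factor2_unit).
by rewrite -(partial_v_linear (bounded_linear_fst _ _) sphi cx)
  -(partial_v_linear (bounded_linear_snd _ _) sphi cx).
Qed.

Lemma factor2_rotation c x : holomorphic_coordinate c -> cdom c x ->
  logd_u q c x = (1 / 2) *: logd_u p c x + s2 *: logd_v p c x /\
  logd_v q c x = - s2 *: logd_u p c x + (1 / 2) *: logd_v p c x.
Proof.
move=> hc cx; case: H => _ _ /(_ c hc x cx).
rewrite (partial_u_factors hc cx) (partial_v_factors hc cx) [phi x]surjective_pairing.
exact: (J_rotation _ _ _ _ (factor1_unit x) (factor2_unit x)).1.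
Qed.

(** The components of the differential of an associated map. *)
Definition eps_u c x := - (1 / 2) *: logd_u p c x + s2 *: logd_v p c x.
Definition eps_v c x := - s2 *: logd_u p c x + - (1 / 2) *: logd_v p c x.

Lemma associatedP (eps : M -> 'rV[R]_3) : associated phi eps <->
  forall c, holomorphic_coordinate c -> forall x, cdom c x ->
    im (partial_u c eps x) = eps_u c x /\ im (partial_v c eps x) = eps_v c x.
Proof.
have [cE sE] := @cos_sin_2pi3 R.
split=> E c hc x cx; have [E1 E2] := E c hc x cx; split.
- by move: E1; rewrite cE sE.
- by move: E2; rewrite cE sE.
- by rewrite cE sE.
- by rewrite cE sE.
Qed.

Lemma eps_form : smooth_form eps_u eps_v.
Proof.
have := form_rotation (- (1 / 2)) (- s2) (logd_form smooth_factor1 factor1_unit).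
by rewrite opprK.
Qed.

Lemma eps_real_part c x : holomorphic_coordinate c -> cdom c x ->
  (eps_u c x).1 = 0 /\ (eps_v c x).1 = 0.
Proof.
move=> hc cx; have [A0 B0] := logd_real_part smooth_factor1 factor1_unit hc cx.
by split; apply: real_part_comb.
Qed.

Lemma eps_equations c x : holomorphic_coordinate c -> cdom c x ->
  partial_v c (eps_u c) x = partial_u c (eps_v c) x /\
  partial_u c (eps_u c) x + partial_v c (eps_v c) x =
    - (4 / 3 * s2) *: (eps_u c x *q eps_v c x - eps_v c x *q eps_u c x).
Proof.
move=> hc cx; have [sA sB] := (logd_form smooth_factor1 factor1_unit).1 c hc.
have mc1 := logd_maurer_cartan smooth_factor1 factor1_unit hc cx.
have mc2 := logd_maurer_cartan smooth_factor2 factor2_unit hc cx.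
set X := (X in _ = X) in mc1.
have [H1 H2] : partial_v c (eps_u c) x = - (1 / 2) *: partial_v c (logd_u p c) x +
     s2 *: partial_v c (logd_v p c) x /\
    partial_v c (eps_v c) x = - s2 *: partial_v c (logd_u p c) x +
     - (1 / 2) *: partial_v c (logd_v p c) x.
  by split; [exact: (partial_v_comb (- (1 / 2)) s2 sA sB cx)
    | exact: (partial_v_comb (- s2) (- (1 / 2)) sA sB cx)].
have [H3 H4] : partial_u c (eps_u c) x = - (1 / 2) *: partial_u c (logd_u p c) x +
     s2 *: partial_u c (logd_v p c) x /\
    partial_u c (eps_v c) x = - s2 *: partial_u c (logd_u p c) x +
     - (1 / 2) *: partial_u c (logd_v p c) x.
  by split; [exact: (partial_u_comb (- (1 / 2)) s2 sA sB cx)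
    | exact: (partial_u_comb (- s2) (- (1 / 2)) sA sB cx)].
have -> : eps_u c x *q eps_v c x - eps_v c x *q eps_u c x = X.
  rewrite /eps_u /eps_v commutator_comb -[RHS]scale1r; congr (_ *: _).
  exact: rotation_det.
rewrite H1 H2 H3 H4.
have [E1 E2] : partial_v c (logd_u q c) x = (1 / 2) *: partial_v c (logd_u p c) x +
     s2 *: partial_v c (logd_v p c) x /\
   partial_u c (logd_v q c) x = - s2 *: partial_u c (logd_u p c) x +
     (1 / 2) *: partial_u c (logd_v p c) x.
  split.
    rewrite -(partial_v_comb _ _ sA sB cx); apply: partial_v_ext => // y cy.
    by have [] := factor2_rotation hc cy.
  rewrite -(partial_u_comb _ _ sA sB cx); apply: partial_u_ext => // y cy.
  by have [] := factor2_rotation hc cy.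
have [E3 E4] := factor2_rotation hc cx.
exact: (rotated_curvature E3 E4 E1 E2 mc1 mc2).
Qed.

(** Two associated maps have the same differential. *)
Lemma associated_unique (eps eps' : M -> 'rV[R]_3) (x0 : M) :
  smooth eps -> smooth eps' -> associated phi eps ->
  (associated phi eps' <-> exists d, forall x, eps' x = eps x + d).
Proof.
move=> se se' /associatedP A; split=> [/associatedP A'|[d Ed]].
  exists (eps' x0 - eps x0) => x; rewrite addrC.
  have <- : eps' x - eps x = eps' x0 - eps x0.
    apply: constant_difference => // c Ac y cy; have hc := atlas_holomorphic Ac.
    have [E1 E2] := A c hc y cy; have [E1' E2'] := A' c hc y cy.
    by split; apply: im_inj; [rewrite E1 | rewrite E2].
  by rewrite subrK.
apply/associatedP => c hc x cx; have [<- <-] := A c hc x cx.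
have E (v : R * R) (D : 'rV[R]_3) : is_derive (coord c x) v (eps \o param c) D ->
    is_derive (coord c x) v (eps' \o param c) D.
  move=> eD; have -> : eps' \o param c = (fun z => (eps \o param c) z - - d).
    by apply/funext => z /=; rewrite Ed opprK.
  by rewrite -[D]subr0; exact: is_derive_sub eD (is_derive_cst _ _ _).
split; congr im.
  by apply: partial_uE; apply: E; exact: partial_u_is_derive (se c hc) cx.
by apply: partial_vE; apply: E; exact: partial_v_is_derive (se c hc) cx.
Qed.

(** The form with components [eps_u] and [eps_v] is closed, hence flat for
    [qprimitive]; the parallel map that starts at [1] keeps the real part 1, and
    its imaginary part is a primitive. *)
Lemma associated_exists (x0 : M) : @simply_connected R M ->
  exists eps : M -> 'rV[R]_3, smooth eps /\ associated phi eps.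
Proof.
move=> scM; have sf := eps_form.
have fl : flat_form (@qprimitive R) eps_u eps_v.
  move=> c hc z y cz; have cx := param_cdom cz.
  have [] := eps_equations hc cx.
  rewrite (partial_v_param (eps_u c) cz) (partial_u_param (eps_v c) cz) => -> _.
  by rewrite /qprimitive /= !scale0r.
have [F [F0 FP]] := parallel_exists (@bounded_bilinear_qprimitive R) x0 qone
  scM (@has_primitives_quat R) (@geometrically_complete_quat R) sf fl.
have sF : smooth F := parallel_smooth (@bounded_bilinear_qprimitive R) sf FP.
have F1 x : (F x).1 = 1.
  have -> : 1 = (F x0).1 :> R by rewrite F0.
  apply: (constant_of_zero_differential (F := fun x => (F x).1)) => c Ac y cy.
  have [P1 P2] := FP c (atlas_holomorphic Ac) y cy.
  have bl := bounded_linear_fst R 'rV[R]_3.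
  by split; [have := is_derive_linear bl P1 | have := is_derive_linear bl P2].
have bl := bounded_linear_snd R 'rV[R]_3.
exists (fun x => (F x).2); split; first exact: smooth_linear bl sF.
apply/associatedP => c hc x cx; have [P1 P2] := FP c hc x cx.
have [r1 r2] := eps_real_part hc cx.
have D1 := partial_uE (F := fun x => (F x).2) (is_derive_linear bl P1).
have D2 := partial_vE (F := fun x => (F x).2) (is_derive_linear bl P2).
rewrite -[eps_u c x]im_of_real_part0// -[eps_v c x]im_of_real_part0//.
by split; congr im; [rewrite -[RHS]scale1r -(F1 x) | rewrite -[RHS]scale1r -(F1 x)].
Qed.

(** At a zero of the differential of [eps], rotating back, the logarithmic
    derivatives of both factors would vanish. *)
Lemma associated_nowhere_vanishing (eps : M -> 'rV[R]_3) :
  associated phi eps -> nowhere_vanishing_differential eps.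
Proof.
move=> /associatedP A c hc x cx [u0 v0].
have im0 : im (0 : 'rV[R]_3) = 0 by [].
have [/esym E1 /esym E2] := A c hc x cx; rewrite u0 v0 im0 in E1 E2.
have [A0 B0] := rotationK (esym E1) (esym E2).
rewrite !scaler0 addr0 in A0 B0.
have pu0 : partial_u c phi x = 0.
  rewrite (partial_u_factors hc cx).
  have [-> _] := factor2_rotation hc cx.
  by rewrite A0 B0 !scaler0 addr0 !(bil0r bq).
case: H => _ [_ /(_ c hc x cx 1 0)] + _.
rewrite pu0 scaler0 scale0r addr0 => /(_ erefl) [/eqP].
by rewrite oner_eq0.
Qed.

Lemma associated_Hsystem (eps : M -> 'rV[R]_3) :
  smooth eps -> associated phi eps -> Hsystem eps.
Proof.
move=> se /associatedP A c hc x cx; apply: im_inj.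
have cu := chart_smooth_partial_u (se c hc); have cv := chart_smooth_partial_v (se c hc).
have bi := @bounded_linear_im R.
have -> : im (partial_u c (partial_u c eps) x + partial_v c (partial_v c eps) x) =
    partial_u c (eps_u c) x + partial_v c (eps_v c) x.
  have <- : partial_u c (fun y => im (partial_u c eps y)) x = partial_u c (eps_u c) x.
    by apply: partial_u_ext => // y cy; have [] := A c hc y cy.
  have <- : partial_v c (fun y => im (partial_v c eps y)) x = partial_v c (eps_v c) x.
    by apply: partial_v_ext => // y cy; have [] := A c hc y cy.
  rewrite (partial_u_linear bi cu cx) (partial_v_linear bi cv cx).
  by apply: quatP; rewrite /= ?addr0.
have [_ ->] := eps_equations hc cx; have [<- <-] := A c hc x cx.
by rewrite im_Hsystem.
Qed.

End Factors.

(** The forms of the two factors must be the products of the differential of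
    [eps] with [exp (2 i pi / 3)] and [exp (i pi / 3)], that is, with
    [m + i sqrt3_2] for [m = - 1 / 2] and [m = 1 / 2].  The H-system makes both
    of them integrable. *)
Lemma immersion_exists (eps : M -> 'rV[R]_3) (x0 : M) : @simply_connected R M ->
  smooth eps -> nowhere_vanishing_differential eps -> Hsystem eps ->
  exists phi : M -> quat R * quat R, almost_complex_immersion phi /\ associated phi eps.
Proof.
move=> scM se nv He.
have s22 := @sqrt3_2_sqr R; have bi := @bounded_linear_im R.
pose al c x := im (partial_u c eps x); pose be c x := im (partial_v c eps x).
have fab : smooth_form al be := form_linear bi (differential_form se).
pose A m c x := m *: al c x + - s2 *: be c x.
pose B m c x := s2 *: al c x + m *: be c x.
have fAB m : smooth_form (A m) (B m) := form_rotation m s2 fab.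
have mcAB m : m ^+ 2 = 1 / 4 -> maurer_cartan_form (A m) (B m).
  move=> mm c hc x cx; have [sa sb] := fab.1 c hc.
  have cu := chart_smooth_partial_u (se c hc); have cv := chart_smooth_partial_v (se c hc).
  have -> : partial_v c (A m c) x = m *: partial_v c (al c) x + - s2 *: partial_v c (be c) x.
    exact: (partial_v_comb m (- s2) sa sb cx).
  have -> : partial_u c (B m c) x = s2 *: partial_u c (al c) x + m *: partial_u c (be c) x.
    exact: (partial_u_comb s2 m sa sb cx).
  have cl : partial_v c (al c) x = partial_u c (be c) x.
    rewrite (partial_v_linear bi cu cx) (partial_u_linear bi cv cx).
    by rewrite (partial_mixed (se c hc) cx).
  have Hs : partial_u c (al c) x + partial_v c (be c) x =
      - (4 / 3 * s2) *: (al c x *q be c x - be c x *q al c x); last first.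
    exact: (curvature_of_rotation mm cl Hs).
  rewrite (partial_u_linear bi cu cx) (partial_v_linear bi cv cx) -im_Hsystem.
  have := He c hc x cx.
  move: (partial_u c (partial_u c eps) x) (partial_v c (partial_v c eps) x) => a b E.
  have -> : im a + im b = im (a + b) by apply: quatP; rewrite /= ?addr0.
  exact: congr1.
have imAB m c x : (A m c x).1 = 0 /\ (B m c x).1 = 0 by split; apply: real_part_comb.
have /choice[P HP] : forall m, exists P : M -> quat R, m ^+ 2 = 1 / 4 ->
    [/\ smooth P, forall x, S3 (P x) & forall c, holomorphic_coordinate c ->
      forall x, cdom c x -> parallel (@qmul R) (A m) (B m) c P x].
  move=> m; have [mm|//] := pselect (m ^+ 2 = 1 / 4); last by exists (fun=> 0).
  have [P [P0 HP]] := parallel_exists bq x0 qone scM (@has_primitives_quat R)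
    (@geometrically_complete_quat R) (fAB m) (maurer_cartan_form_flat (mcAB m mm)).
  have HPu : forall x, S3 (P x).
    have HPa c : atlas c -> forall x, cdom c x -> parallel (@qmul R) (A m) (B m) c P x.
      by move=> /atlas_holomorphic; exact: HP.
    apply: (parallel_unit (fun c x _ _ => imAB m c x) HPa (x0 := x0)).
    by rewrite P0; exact: S3_one.
  have HPs := parallel_smooth bq (fAB m) HP.
  by exists P => _; split; [exact HPs | exact HPu | exact HP].
have m1 : (- (1 / 2)) ^+ 2 = 1 / 4 :> R by rewrite sqrrN expr2; lra.
have m2 : (1 / 2) ^+ 2 = 1 / 4 :> R by rewrite expr2; lra.
have [sp p1 pP] := HP _ m1; have [sq q1 qP] := HP _ m2.
set p := P _ in sp p1 pP; set q := P _ in sq q1 qP.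
pose phi x := (p x, q x).
have phiu c x : holomorphic_coordinate c -> cdom c x ->
    partial_u c phi x = (p x *q A (- (1 / 2)) c x, q x *q A (1 / 2) c x).
  move=> hc cx; apply: partial_uE.
  exact: is_derive_pair (pP c hc x cx).1 (qP c hc x cx).1.
have phiv c x : holomorphic_coordinate c -> cdom c x ->
    partial_v c phi x = (p x *q B (- (1 / 2)) c x, q x *q B (1 / 2) c x).
  move=> hc cx; apply: partial_vE.
  exact: is_derive_pair (pP c hc x cx).2 (qP c hc x cx).2.
have Hphi : almost_complex_immersion phi.
  split=> [x|//|c hc x cx]; first by split; [exact: p1 | exact: q1].
    split=> [c hc n|c hc x cx a b].
      exact: (Cn_pair (@open_cimg R M c) (sp c hc n) (sq c hc n)).
    rewrite phiu// phiv// => E.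
    have E1 : p x *q (a *: A (- (1 / 2)) c x + b *: B (- (1 / 2)) c x) = 0.
      by rewrite qmul_combr; exact (congr1 (@fst (quat R) (quat R)) E).
    have E2 : q x *q (a *: A (1 / 2) c x + b *: B (1 / 2) c x) = 0.
      by rewrite qmul_combr; exact (congr1 (@snd (quat R) (quat R)) E).
    have {}E1 : a *: A (- (1 / 2)) c x + b *: B (- (1 / 2)) c x = 0.
      by rewrite -[LHS](qmulVK _ (p1 x)) E1 (bil0r bq).
    have {}E2 : a *: A (1 / 2) c x + b *: B (1 / 2) c x = 0.
      by rewrite -[LHS](qmulVK _ (q1 x)) E2 (bil0r bq).
    have [n0|n0] := eqVneq (a ^+ 2 + b ^+ 2) 0.
      by move/eqP: n0; rewrite paddr_eq0 ?sqr_ge0// !sqrf_eq0 => /andP[/eqP -> /eqP ->].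
    have [N1 N2] := rotations_independent E1 E2 n0.
    by exfalso; apply: (nv c hc x cx); split; apply: im_inj; [exact: N1 | exact: N2].
  rewrite phiu// phiv//; apply/(J_rotation _ _ _ _ (p1 x) (q1 x)).
  by rewrite /A /B; split; lin_module R (quat R).
exists phi; split=> //.
apply/associatedP => c hc x cx.
have EA : A (- (1 / 2)) c x = logd_u (factor1 phi) c x.
  have := phiu c x hc cx; rewrite (partial_u_factors Hphi hc cx) => E.
  exact (qmul_injl (p1 x) (esym (congr1 (@fst (quat R) (quat R)) E))).
have EB : B (- (1 / 2)) c x = logd_v (factor1 phi) c x.
  have := phiv c x hc cx; rewrite (partial_v_factors Hphi hc cx) => E.
  exact (qmul_injl (p1 x) (esym (congr1 (@fst (quat R) (quat R)) E))).
rewrite /eps_u /eps_v -EA -EB.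
exact: (rotationKV (V := quat R) erefl erefl).
Qed.

End AlmostComplexImmersions.

Section Congruence.
Context {R : realType} {M : riemannSurface R}.
Notation s2 := (@sqrt3_2 R).
Implicit Types (c : @chart R M) (x : M) (f : M -> quat R).
Let bq := @bounded_bilinear_qmul R.

(** The adjoint action on the Lie algebra of imaginary quaternions, extended to
    all quaternions. *)
Definition qad (k z : quat R) := k *q z *q qinv k.

Lemma bounded_linear_qad k : bounded_linear (qad k).
Proof.
exact: bounded_linear_comp (bounded_linear_left (qinv k) bq) (bounded_linear_right k bq).
Qed.

Lemma qad_comb k (a b : R) (u v : quat R) :
  qad k (a *: u + b *: v) = a *: qad k u + b *: qad k v.
Proof.
rewrite /qad; move: (qinv k) => w.
by rewrite (bilDr bq) !(bilZr bq) (bilDl bq) !(bilZl bq).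
Qed.

Section CongruentMaps.
Variables (a k : quat R) (f : M -> quat R).
Hypotheses (Sa : S3 a) (Sk : S3 k) (sf : smooth f) (f1 : forall x, S3 (f x)).

Definition translate x := a *q f x *q qinv k.

Lemma bounded_linear_translate : bounded_linear (fun z => a *q z *q qinv k).
Proof.
exact: bounded_linear_comp (bounded_linear_left (qinv k) bq) (bounded_linear_right a bq).
Qed.

Lemma smooth_translate : smooth translate.
Proof. exact: smooth_linear bounded_linear_translate sf. Qed.

Lemma translate_unit x : S3 (translate x).
Proof. by apply: S3_mul; [exact: S3_mul | exact: S3_inv]. Qed.

Lemma logd_translate c x : holomorphic_coordinate c -> cdom c x ->
  logd_u translate c x = qad k (logd_u f c x) /\
  logd_v translate c x = qad k (logd_v f c x).
Proof.
move=> hc cx; have cf := sf hc.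
have key (D : quat R) : a *q (f x *q D) *q qinv k = translate x *q qad k D.
  by rewrite /translate /qad -!qmulA (qmulVK _ Sk).
have Du : partial_u c translate x = a *q partial_u c f x *q qinv k :=
  partial_u_linear bounded_linear_translate cf cx.
have Dv : partial_v c translate x = a *q partial_v c f x *q qinv k :=
  partial_v_linear bounded_linear_translate cf cx.
have T1 := translate_unit x.
split; apply: (qmul_injl T1).
  by rewrite -(logd_uE translate_unit) Du (logd_uE f1) key.
by rewrite -(logd_vE translate_unit) Dv (logd_vE f1) key.
Qed.

End CongruentMaps.

(** Translations on the left do not change the logarithmic derivative and those
    on the right conjugate it; [a] is chosen to make both sides agree at [x0],
    and then both are parallel for the same form. *)
Lemma congruent_of_logd f f' k (x0 : M) : S3 k ->
  smooth f -> (forall x, S3 (f x)) -> smooth f' -> (forall x, S3 (f' x)) ->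
  (forall c, atlas c -> forall x, cdom c x ->
     logd_u f' c x = qad k (logd_u f c x) /\ logd_v f' c x = qad k (logd_v f c x)) ->
  exists2 a, S3 a & forall x, f' x = a *q f x *q qinv k.
Proof.
move=> Sk sf f1 sf' f'1 E; pose a := f' x0 *q k *q qinv (f x0).
have Sa : S3 a by apply: S3_mul; [exact: S3_mul | exact: S3_inv].
exists a => //.
apply: (parallel_eq bq (logd_form sf' f'1) (x0 := x0)).
- by move=> c /atlas_holomorphic hc x cx; exact: logd_parallel.
- move=> c Ac x cx; have hc := atlas_holomorphic Ac.
  have := logd_parallel (smooth_translate a k sf) (translate_unit Sa Sk f1) hc cx.
  rewrite /parallel; have [-> ->] := logd_translate Sa Sk sf f1 hc cx.
  by have [-> ->] := E c Ac x cx.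
- by rewrite /a -!qmulA (qmulVK _ (f1 x0)) qmulqV// qmulq1.
Qed.

(** The differential of [eps] and the logarithmic derivatives of both factors are
    rotations of each other, so they are conjugated by [k] simultaneously. *)
Lemma associated_congruence (eps eps' : M -> 'rV[R]_3)
    (phi phi' : M -> quat R * quat R) (x0 : M) :
  smooth eps -> smooth eps' ->
  almost_complex_immersion phi -> associated phi eps ->
  almost_complex_immersion phi' -> associated phi' eps' ->
  (congruent_R3 eps eps' <-> congruent_S3S3 phi phi').
Proof.
move=> se se' Hphi /associatedP A Hphi' /associatedP A'.
have sp := smooth_factor1 Hphi; have sq := smooth_factor2 Hphi.
have p1 := factor1_unit Hphi; have q1 := factor2_unit Hphi.
have sp' := smooth_factor1 Hphi'; have sq' := smooth_factor2 Hphi'.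
have p1' := factor1_unit Hphi'; have q1' := factor2_unit Hphi'.
have bi := @bounded_linear_im R.
split=> [[k [d [Sk E]]]|[a [b [k [Sa Sb Sk E]]]]].
- have bL := bounded_linear_comp (bounded_linear_qad k) bi.
  have dE c x : holomorphic_coordinate c -> cdom c x ->
      im (partial_u c eps' x) = qad k (im (partial_u c eps x)) /\
      im (partial_v c eps' x) = qad k (im (partial_v c eps x)).
    move=> hc cx; have ce := se c hc; have ce' := se' c hc.
    have key v D : is_derive (coord c x) v (eps \o param c) D ->
        is_derive (coord c x) v ((fun y => im (eps' y)) \o param c) (qad k (im D)).
      move=> eD; have -> : (fun y => im (eps' y)) \o param c =
         (fun z => (qad k \o im) ((eps \o param c) z) - - im d).
        by apply/funext => z /=; rewrite E opprK.
      by rewrite -[qad k _]subr0;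
        exact: is_derive_sub (is_derive_linear bL eD) (is_derive_cst _ _ _).
    have key1 := partial_uE (F := fun y => im (eps' y)) (key _ _ (partial_u_is_derive ce cx)).
    have key2 := partial_vE (F := fun y => im (eps' y)) (key _ _ (partial_v_is_derive ce cx)).
    split; first exact: (etrans (esym (partial_u_linear bi ce' cx)) key1).
    exact: (etrans (esym (partial_v_linear bi ce' cx)) key2).
  have lp c : atlas c -> forall x, cdom c x ->
      logd_u (factor1 phi') c x = qad k (logd_u (factor1 phi) c x) /\
      logd_v (factor1 phi') c x = qad k (logd_v (factor1 phi) c x).
    move=> Ac x cx; have hc := atlas_holomorphic Ac.
    have [E1 E2] := dE c x hc cx.
    have [F1 F2] := A c hc x cx; have [F1' F2'] := A' c hc x cx.
    have [-> ->] := rotationK (erefl (eps_u phi' c x)) (erefl (eps_v phi' c x)).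
    have [G1 G2] := rotationK (erefl (eps_u phi c x)) (erefl (eps_v phi c x)).
    have H1 : eps_u phi' c x = qad k (eps_u phi c x).
      exact: (etrans (esym F1') (etrans E1 (congr1 (qad k) F1))).
    have H2 : eps_v phi' c x = qad k (eps_v phi c x).
      exact: (etrans (esym F2') (etrans E2 (congr1 (qad k) F2))).
    rewrite H1 H2 -!qad_comb.
    by split; congr (qad k _).
  have lq c : atlas c -> forall x, cdom c x ->
      logd_u (factor2 phi') c x = qad k (logd_u (factor2 phi) c x) /\
      logd_v (factor2 phi') c x = qad k (logd_v (factor2 phi) c x).
    move=> Ac x cx; have hc := atlas_holomorphic Ac.
    have [-> ->] := factor2_rotation Hphi' hc cx.
    have [-> ->] := factor2_rotation Hphi hc cx.
    by have [-> ->] := lp c Ac x cx; rewrite !qad_comb.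
  have [a Sa Ha] := congruent_of_logd x0 Sk sp p1 sp' p1' lp.
  have [b Sb Hb] := congruent_of_logd x0 Sk sq q1 sq' q1' lq.
  exists a, b, k; split=> // x; rewrite [LHS]surjective_pairing.
  by congr pair; [exact: Ha | exact: Hb].
- have pE : factor1 phi' = translate a k (factor1 phi).
    by apply/funext => x; rewrite /factor1 E.
  have bL := bounded_linear_comp (bounded_linear_qad k) bi.
  pose G x := qad k (im (eps x)).
  have sG : smooth G := smooth_linear bL se.
  have si : smooth (fun x => im (eps' x)) := smooth_linear bi se'.
  have dE c x : atlas c -> cdom c x ->
      partial_u c (fun x => im (eps' x)) x = partial_u c G x /\
      partial_v c (fun x => im (eps' x)) x = partial_v c G x.
    move=> Ac cx; have hc := atlas_holomorphic Ac.
    have ce := se c hc; have ce' := se' c hc.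
    have [T1 T2] := logd_translate Sa Sk sp p1 hc cx; rewrite -pE in T1 T2.
    have H1 : eps_u phi' c x = qad k (eps_u phi c x) by rewrite /eps_u T1 T2 qad_comb.
    have H2 : eps_v phi' c x = qad k (eps_v phi c x) by rewrite /eps_v T1 T2 qad_comb.
    have [F1 F2] := A c hc x cx; have [F1' F2'] := A' c hc x cx.
    have L1 : partial_u c G x = qad k (im (partial_u c eps x)) := partial_u_linear bL ce cx.
    have L2 : partial_v c G x = qad k (im (partial_v c eps x)) := partial_v_linear bL ce cx.
    split.
      rewrite (partial_u_linear bi ce' cx) L1 F1 -H1; exact: F1'.
    rewrite (partial_v_linear bi ce' cx) L2 F2 -H2; exact: F2'.
  have cst x : im (eps' x) - G x = im (eps' x0) - G x0.
    by apply: (constant_difference si sG) => c Ac y cy; exact: dE.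
  exists k, (im (eps' x0) - G x0).2; split=> // x.
  have G0 : (G x0).1 = 0 := qconj_real_part (im (eps x0)) Sk.
  have d0 : (im (eps' x0) - G x0).1 = 0.
    exact: (etrans (congr1 (fun r : R => 0 - r) G0) (subrr 0)).
  by rewrite (im_of_real_part0 d0) -(cst x) addrC subrK.
Qed.

End Congruence.

Theorem theorem3p5 (R : realType) (M : riemannSurface R)
    (M_simply_connected : @simply_connected R M) :
  (forall phi : M -> quat R * quat R, almost_complex_immersion phi ->
     (exists eps : M -> 'rV[R]_3, [/\ smooth eps, associated phi eps &
        forall eps' : M -> 'rV[R]_3, smooth eps' ->
          (associated phi eps' <-> exists d, forall x, eps' x = eps x + d)]) /\
     (forall eps : M -> 'rV[R]_3, smooth eps -> associated phi eps ->
        nowhere_vanishing_differential eps /\ Hsystem eps)) /\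
  (forall eps : M -> 'rV[R]_3,
     smooth eps -> nowhere_vanishing_differential eps -> Hsystem eps ->
     exists phi : M -> quat R * quat R,
       almost_complex_immersion phi /\ associated phi eps) /\
  (forall (eps eps' : M -> 'rV[R]_3) (phi phi' : M -> quat R * quat R),
     smooth eps -> nowhere_vanishing_differential eps -> Hsystem eps ->
     smooth eps' -> nowhere_vanishing_differential eps' -> Hsystem eps' ->
     almost_complex_immersion phi -> associated phi eps ->
     almost_complex_immersion phi' -> associated phi' eps' ->
     (congruent_R3 eps eps' <-> congruent_S3S3 phi phi')).
Proof.
(* On an empty surface there are no charts and all conditions are void. *)
have [[x0 _]|M0] := pselect (exists x : M, True); last first.
  have noc (c : @chart R M) : False by apply: M0; exists (param c 0).
  have nox (x : M) : False by apply: M0; exists x.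
  split; last split.
  - move=> phi Hphi; split; last by move=> eps _ _; split=> c; case: (noc c).
    exists (fun=> 0); split=> [c|c|eps' _]; [by case: (noc c) | by case: (noc c) |].
    by split=> [_|_ c]; [exists 0 => x; case: (nox x) | case: (noc c)].
  - move=> eps _ _ _; exists (fun=> (0, 0)); split=> [|c]; last by case: (noc c).
    split=> [x|//|c]; [by case: (nox x) | | by case: (noc c)].
    by split=> c; case: (noc c).
  - move=> eps eps' phi phi' *; split=> _.
      exists qone, qone, qone; split; [exact: S3_one..|].
      by move=> x; case: (nox x).
    by exists qone, 0; split=> [|x]; [exact: S3_one | case: (nox x)].
split; last split.
- move=> phi Hphi; split=> [|eps se ae].
    have [eps [se ae]] := associated_exists Hphi x0 M_simply_connected.
    exists eps; split=> // eps' se'.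
    exact: (associated_unique x0 se se' ae).
  split; first exact: (associated_nowhere_vanishing Hphi ae).
  exact: (associated_Hsystem Hphi se ae).
- by move=> eps se nv He; exact: (immersion_exists x0 M_simply_connected se nv He).
- move=> eps eps' phi phi' se _ _ se' _ _ Hphi ae Hphi' ae'.
  exact: (associated_congruence x0 se se' Hphi ae Hphi' ae').
Qed.
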